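(* Let $H:[0,T]\times\mathbb{R}^n\times\mathbb{R}^n\to\mathbb{R}$ satisfy (H1)–(H4) and (HLC), with $c(\cdot)$, each $k_R(\cdot)$ and $t\mapsto H(t,0,0)$ integrable on $[0,T]$. Let $(\mathbb{R}^{n+1},f,l)$ be the Steiner representation of $H$ and let $$V(t_0,x_0)=\inf_{(x,a)(\cdot)\in S_f(t_0,x_0)}\Big\{g(x(T))+\int_{t_0}^T l(t,x(t),a(t))\,dt\Big\}.$$ If $g:\mathbb{R}^n\to\mathbb{R}$ is continuous, then $V$ is continuous on $[0,T]\times\mathbb{R}^n$; if $g$ is lower semicontinuous, then $V$ is lower semicontinuous on $[0,T]\times\mathbb{R}^n$.
   Context: Hypotheses: (H1) $H(\cdot,x,p)$ Lebesgue measurable; (H2) $H(t,\cdot,\cdot)$ continuous; (H3) $H(t,x,\cdot)$ convex; (H4) there is measurable $c\ge0$ with $|H(t,x,p)-H(t,x,q)|\le c(t)(1+|x|)|p-q|$; (HLC) for each $R>0$ there is measurable $k_R\ge0$ with $|H(t,x,p)-H(t,y,p)|\le k_R(t)(1+|p|)|x-y|$ for $x,y\in\bar B_R$, all $p$. $H^*(t,x,v)=\sup_p\{\langle v,p\rangle-H(t,x,p)\}$. $S_f(t_0,x_0)$: pairs $x(\cdot)$ absolutely continuous on $[t_0,T]$, $a(\cdot)\in L^1([t_0,T],\mathbb{R}^{n+1})$, $\dot x=f(t,x,a)$ a.e., $x(t_0)=x_0$. Steiner representation: $E(t,x)=\mathrm{epi}\,H^*(t,x,\cdot)\subset\mathbb{R}^{n+1}$;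 $\Phi(t,x,a)=E(t,x)\cap\bar B(a,2d(a,E(t,x)))$; Steiner point $s_m(K)=m\int_{S^{m-1}}p\max_{y\in K}\langle p,y\rangle\,\mu(dp)$ ($\mu$ normalized rotation-invariant measure on the unit sphere); $(f,l)(t,x,a)=s_{n+1}(\Phi(t,x,a))$ with $f\in\mathbb{R}^n$, $l\in\mathbb{R}$. *)

(* Defs.v *)
From mathcomp Require Import all_boot all_algebra.
From mathcomp Require Import all_classical all_reals all_analysis.
Set Implicit Arguments. Unset Strict Implicit. Unset Printing Implicit Defensive.
Import GRing.Theory Num.Theory numFieldNormedType.Exports.
Local Open Scope ring_scope.
Local Open Scope classical_set_scope.

(* Points of R^m are row vectors 'rV[R]_m. *)

(* Euclidean inner product and norm on R^m *)
Definition dotv (R : realType) (m : nat) (u v : 'rV[R]_m) : R :=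
  \sum_(i < m) u ord0 i * v ord0 i.
Definition enorm (R : realType) (m : nat) (u : 'rV[R]_m) : R :=
  Num.sqrt (dotv u u).

(* The Lebesgue-measurable structure on R (completion of the Borel sets);
   the completed Lebesgue measure lives on this type. *)
Definition LebT (R : realType) := caratheodory_type (R:=R) ((@wlength R idfun)^*)%mu.
Definition leb (R : realType) : set (LebT R) -> \bar R := @completed_lebesgue_measure R.

(* The Borel sigma-algebra on R^m *)
Definition BorelRV (R : realType) (m : nat) :=
  g_sigma_algebraType (@open 'rV[R]_m).

(* Unit sphere S^{m-1} *)
Definition sphere (R : realType) (m : nat) : set 'rV[R]_m :=
  [set p | enorm p = 1].

(* mu is the normalized rotation-invariant (orthogonal-group invariant)
   measure on the unit sphere of R^m *)
Definition sphere_measure (R : realType) (m : nat)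
    (mu : probability (BorelRV R m) R) : Prop :=
  mu (~` (@sphere R m : set (BorelRV R m))) = 0%E /\
  forall Q : 'M[R]_m, Q *m Q^T = 1%:M ->
    forall A : set (BorelRV R m), measurable A ->
      mu ((fun p : 'rV[R]_m => p *m Q) @^-1` A) = mu A.

(* support function  p |-> max_{y in K} <p,y>  (K nonempty compact) *)
Definition support_fun (R : realType) (m : nat) (K : set 'rV[R]_m) (p : 'rV[R]_m) : R :=
  sup [set dotv p y | y in K].

(* Steiner point  s_m(K) = m \int_{S^{m-1}} p max_{y in K} <p,y> mu(dp) *)
Definition steiner (R : realType) (m : nat) (mu : probability (BorelRV R m) R)
    (K : set 'rV[R]_m) : 'rV[R]_m :=
  \row_(i < m) (m%:R * Rintegral mu setT
                  (fun p : BorelRV R m => p ord0 i * support_fun K p)).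

Section Hamiltonian.
Variables (R : realType) (n : nat) (H : R -> 'rV[R]_n -> 'rV[R]_n -> R).

(* Legendre-Fenchel conjugate H^*(t,x,v) = sup_p { <v,p> - H(t,x,p) } *)
Definition Hstar (t : R) (x v : 'rV[R]_n) : \bar R :=
  ereal_sup [set ((dotv v p - H t x p)%:E) | p in setT].

(* E(t,x) = epi H^*(t,x,.) in R^{n+1} = R^n x R *)
Definition epiHstar (t : R) (x : 'rV[R]_n) : set 'rV[R]_(n + 1) :=
  [set z | (Hstar t x (lsubmx z) <= ((rsubmx z) ord0 ord0)%:E)%E].

(* Euclidean distance from a point to a set *)
Definition edist (m : nat) (a : 'rV[R]_m) (E : set 'rV[R]_m) : R :=
  inf [set enorm (a - y) | y in E].

(* Euclidean closed ball *)
Definition cball (m : nat) (a : 'rV[R]_m) (r : R) : set 'rV[R]_m :=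
  [set y | enorm (y - a) <= r].

Definition Phi (t : R) (x : 'rV[R]_n) (a : 'rV[R]_(n + 1)) : set 'rV[R]_(n + 1) :=
  epiHstar t x `&` cball a (2 * edist a (epiHstar t x)).

Variable mu : probability (BorelRV R (n + 1)) R.

(* Steiner representation (R^{n+1}, f, l) *)
Definition steiner_fl (t : R) (x : 'rV[R]_n) (a : 'rV[R]_(n + 1)) : 'rV[R]_(n + 1) :=
  steiner mu (Phi t x a).
Definition steiner_f (t : R) (x : 'rV[R]_n) (a : 'rV[R]_(n + 1)) : 'rV[R]_n :=
  lsubmx (steiner_fl t x a).
Definition steiner_l (t : R) (x : 'rV[R]_n) (a : 'rV[R]_(n + 1)) : R :=
  (rsubmx (steiner_fl t x a)) ord0 ord0.
End Hamiltonian.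

(* absolute continuity on [a,b] of a map into (R^m, Euclidean norm) *)
Definition abs_cont_on (R : realType) (m : nat) (a b : R) (x : R -> 'rV[R]_m) : Prop :=
  forall eps : R, 0 < eps -> exists2 delta : R, 0 < delta &
    forall (N : nat) (u v : 'I_N -> R),
      (forall k, a <= u k /\ u k <= v k /\ v k <= b) ->
      (forall k j, k != j -> v k <= u j \/ v j <= u k) ->
      \sum_(k < N) (v k - u k) < delta ->
      \sum_(k < N) enorm (x (v k) - x (u k)) < eps.

(* S_f(t0,x0): pairs (x,a), x absolutely continuous on [t0,T],
   a in L^1([t0,T], R^{n+1}), x' = f(t,x,a) a.e. on [t0,T], x(t0) = x0 *)
Definition trajectories (R : realType) (n : nat) (T : R)
    (f : R -> 'rV[R]_n -> 'rV[R]_(n + 1) -> 'rV[R]_n) (t0 : R) (x0 : 'rV[R]_n)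
    : set ((R -> 'rV[R]_n) * (R -> 'rV[R]_(n + 1))) :=
  [set xa : (R -> 'rV[R]_n) * (R -> 'rV[R]_(n + 1)) |
     [/\ abs_cont_on t0 T xa.1,
         (forall i : 'I_(n + 1), (@leb R).-integrable (`[t0, T] : set (LebT R))
                       (fun t => ((xa.2 t) ord0 i)%:E)),
         {ae (@leb R), forall t : LebT R, `[t0, T] t ->
             derivable xa.1 t 1 /\ 'D_1 xa.1 t = f t (xa.1 t) (xa.2 t)}
       & xa.1 t0 = x0]].

(* value function  V(t0,x0) = inf { g(x(T)) + \int_{t0}^T l(t,x,a) dt } *)
Definition value_fun (R : realType) (n : nat) (T : R)
    (f : R -> 'rV[R]_n -> 'rV[R]_(n + 1) -> 'rV[R]_n)
    (l : R -> 'rV[R]_n -> 'rV[R]_(n + 1) -> R) (g : 'rV[R]_n -> R)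
    (t0 : R) (x0 : 'rV[R]_n) : \bar R :=
  ereal_inf [set ((g (xa.1 T))%:E +
                  \int[@leb R]_(t in (`[t0, T] : set (LebT R)))
                     (l t (xa.1 t) (xa.2 t))%:E)%E
            | xa in trajectories T f t0 x0].

(* lower semicontinuity of an extended-real function on a subset D *)
Definition lsc_on (X : topologicalType) (R : realType) (D : set X) (F : X -> \bar R) : Prop :=
  forall z, D z -> forall a : R, (a%:E < F z)%E ->
    exists2 U, nbhs z U & forall w, U w -> D w -> (a%:E < F w)%E.

(* Main.v *)
(** Call an arc a pair (x, w) of a state and an accumulated cost such that
    <x t - x s, p> - (w t - w s) <= \int_s^t H(tau, x tau, p) dtau for all s <= t
    and all p: the integrated form of H^*(t, x, x') <= w'. Since the Steiner point
    of Phi(t, x, a) lies in the epigraph of H^*(t, x, .), and is a itself when a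
    does, V(t0, x0) is the infimum of g(x T) + w T - w t0 over the arcs with
    x t0 = x0: from a trajectory w is a supremum of integrals of affine minorants
    of the Lagrangian along countably many costates p, and from an arc the control
    is (x', sup of these minorants).

    Arcs are closed under limits: by (H4) they satisfy |x'| <= c (1 + |x|), so that
    bounded families of states are equicontinuous, while the costs merely converge
    pointwise along an ultrafilter. Hence V is lower semicontinuous when g is. For upper
    semicontinuity an arc is transported to a nearby initial point by Euler's
    scheme: on each cell the Hamiltonian integrated at a frozen state is convex in
    p and almost dominates the increments of the arc, so the Hahn-Banach theorem
    corrects them at a price given by (HLC), and a discrete Gronwall estimate
    together with the closedness of arcs concludes. *)
From HB Require Import structures.
Require Import Defs.
From mathcomp Require Import all_boot all_order all_algebra.
From mathcomp Require Import all_classical all_reals all_analysis.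
From mathcomp Require Import measurable_realfun ring lra.
Set Implicit Arguments.
Unset Strict Implicit.
Unset Printing Implicit Defensive.
Import Order.TTheory GRing.Theory Num.Theory numFieldNormedType.Exports.
Local Open Scope ring_scope.
Local Open Scope classical_set_scope.

(** * Convex functions on R^n *)

(** The Lagrangian H^*(t, x, .) takes the value +oo and its domain moves with x, so a control cannot
    simply be reused from a nearby state: (HLC) moves epigraphs in a Lipschitz way, and a velocity
    must be corrected together with its cost. This is why state and cost form one object and why
    corrections are sought by convex separation in p. The cost rate is bounded below by an
    integrable function but not above. Costs are thus neither equicontinuous nor continuous, and a
    limit cost may jump upwards. Such jumps are harmless, since only the inequality between the
    integral of the recovered rate and the increment of w is used. Accordingly w enters through
    inequalities between increments and is never differentiated; derivatives are taken of absolutely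
    continuous functions, compared with w on the right of almost every point. Measurability is a
    second obstacle: along an arbitrary trajectory the integrand l(t, x, a) is not known to be
    measurable, so its integral is compared with integrals of measurable minorants. *)

Section Euclidean.
Context {R : realType} {m : nat}.
Implicit Types u v w p q : 'rV[R]_m.

Lemma dotvC u v : dotv u v = dotv v u.
Proof. by apply: eq_bigr => i _; rewrite mulrC. Qed.

Lemma dotvDl u v w : dotv (u + v) w = dotv u w + dotv v w.
Proof. by rewrite -big_split; apply: eq_bigr => i _; rewrite mxE mulrDl. Qed.

Lemma dotvZl a u v : dotv (a *: u) v = a * dotv u v.
Proof. by rewrite mulr_sumr; apply: eq_bigr => i _; rewrite mxE mulrA. Qed.

Lemma dotvNl u v : dotv (- u) v = - dotv u v.
Proof. by rewrite -scaleN1r dotvZl mulN1r. Qed.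

Lemma dotvBl u v w : dotv (u - v) w = dotv u w - dotv v w.
Proof. by rewrite dotvDl dotvNl. Qed.

Lemma dotvDr u v w : dotv w (u + v) = dotv w u + dotv w v.
Proof. by rewrite dotvC dotvDl !(dotvC w). Qed.

Lemma dotvZr a u v : dotv v (a *: u) = a * dotv v u.
Proof. by rewrite dotvC dotvZl dotvC. Qed.

Lemma dotvNr u v : dotv v (- u) = - dotv v u.
Proof. by rewrite dotvC dotvNl dotvC. Qed.

Lemma dotvBr u v w : dotv w (u - v) = dotv w u - dotv w v.
Proof. by rewrite dotvDr dotvNr. Qed.

Lemma dotv0l u : dotv 0 u = 0.
Proof. by rewrite /dotv big1// => i _; rewrite mxE mul0r. Qed.

Lemma dotv0r u : dotv u 0 = 0.
Proof. by rewrite dotvC dotv0l. Qed.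

Lemma dotv_ge0 u : 0 <= dotv u u.
Proof. by apply: sumr_ge0 => i _; rewrite -expr2 sqr_ge0. Qed.

Lemma enorm_ge0 u : 0 <= enorm u.
Proof. exact: sqrtr_ge0. Qed.

Lemma enorm_sqr u : enorm u ^+ 2 = dotv u u.
Proof. by rewrite sqr_sqrtr// dotv_ge0. Qed.

Lemma enorm0 : enorm (0 : 'rV[R]_m) = 0.
Proof. by rewrite /enorm dotv0l sqrtr0. Qed.

Lemma enormZ a u : enorm (a *: u) = `|a| * enorm u.
Proof.
by rewrite /enorm dotvZl dotvZr mulrA -expr2 sqrtrM ?sqr_ge0// sqrtr_sqr.
Qed.

Lemma enormN u : enorm (- u) = enorm u.
Proof. by rewrite /enorm dotvNl dotvNr opprK. Qed.

Lemma enormC u v : enorm (u - v) = enorm (v - u).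
Proof. by rewrite -enormN opprB. Qed.

Lemma normr_coord_le u i : `|u ord0 i| <= enorm u.
Proof.
rewrite -sqrtr_sqr /enorm ler_sqrt ?dotv_ge0// /dotv (bigD1 i)//= expr2.
by rewrite lerDl; apply: sumr_ge0 => j _; rewrite -expr2 sqr_ge0.
Qed.

Lemma enorm_eq0 u : (enorm u == 0) = (u == 0).
Proof.
apply/eqP/eqP => [u0|->]; last exact: enorm0.
apply/rowP => i; rewrite mxE; apply/eqP; rewrite -normr_le0 -u0.
exact: normr_coord_le.
Qed.

Lemma dotv_le u v : dotv u v <= enorm u * enorm v.
Proof.
have [/eqP|v0] := eqVneq (enorm v) 0.
  by rewrite enorm_eq0 => /eqP->; rewrite dotv0r enorm0 mulr0.
have [/eqP|u0] := eqVneq (enorm u) 0.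
  by rewrite enorm_eq0 => /eqP->; rewrite dotv0l enorm0 mul0r.
have {}v0 : 0 < enorm v by rewrite lt_def v0 enorm_ge0.
have {}u0 : 0 < enorm u by rewrite lt_def u0 enorm_ge0.
have := dotv_ge0 (enorm v *: u - enorm u *: v).
rewrite dotvBl !dotvBr !dotvZl !dotvZr (dotvC v u) -!enorm_sqr => h.
have : 0 <= (enorm v * enorm u) * (enorm u * enorm v - dotv u v).
  nra.
by rewrite pmulr_rge0 ?mulr_gt0// subr_ge0.
Qed.

Lemma normr_dotv_le u v : `|dotv u v| <= enorm u * enorm v.
Proof. by rewrite ler_norml lerNl -dotvNl -{1}(enormN u) !dotv_le. Qed.

Lemma enormD u v : enorm (u + v) <= enorm u + enorm v.
Proof.
have h : enorm (u + v) ^+ 2 <= (enorm u + enorm v) ^+ 2.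
  rewrite enorm_sqr dotvDl !dotvDr (dotvC v u) -!enorm_sqr.
  have := dotv_le u v; nra.
by rewrite -(@ler_pXn2r _ 2%N)// nnegrE ?addr_ge0// enorm_ge0.
Qed.

Lemma enormB u v : enorm (u - v) <= enorm u + enorm v.
Proof. by rewrite -(enormN v) enormD. Qed.

Lemma enorm_dist u v : `|enorm u - enorm v| <= enorm (u - v).
Proof.
have := enormD (u - v) v; rewrite subrK => h1.
have := enormD (v - u) u; rewrite subrK enormC => h2.
by rewrite ler_norml; apply/andP; split; lra.
Qed.

(* [dotv u p <= r * enorm p] for all [p] is tested at [p = u]. *)
Lemma enorm_le_dotv u r : 0 <= r ->
  (forall p, dotv u p <= r * enorm p) -> enorm u <= r.
Proof.
move=> r0 /(_ u); rewrite -enorm_sqr expr2 => h.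
by have := enorm_ge0 u; rewrite le_eqVlt => /predU1P[<-//|u0]; rewrite -(ler_pM2r u0).
Qed.

End Euclidean.

Section Sandwich.
Context {R : realType}.

Definition convexf {n} (P : 'rV[R]_n -> R) := forall p q (lam : R),
  0 <= lam <= 1 -> P (lam *: p + (1 - lam) *: q) <= lam * P p + (1 - lam) * P q.

(** Unnormalised positive weights can be chosen to cancel a coordinate, as in the comparison of
    slopes below. *)
Lemma convexf_wsum n (P : 'rV[R]_n -> R) (p q : 'rV[R]_n) (a b : R) :
  convexf P -> 0 < a -> 0 < b ->
  (a + b) * P ((a + b)^-1 *: (a *: p + b *: q)) <= a * P p + b * P q.
Proof.
move=> cP a0 b0; have ab0 : 0 < a + b by rewrite addr_gt0.
have lam01 : 0 <= a / (a + b) <= 1.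
  by rewrite divr_ge0 ?(ltW a0) ?(ltW ab0)//= ler_pdivrMr// mul1r lerDl ltW.
have := cP p q _ lam01.
have -> : 1 - a / (a + b) = b / (a + b) by field; rewrite lt0r_neq0.
rewrite scalerDr !scalerA !(mulrC (_^-1)) => h.
apply: (le_trans (ler_wpM2l (ltW ab0) h)).
rewrite le_eqVlt; apply/orP; left; apply/eqP; field; exact: lt0r_neq0.
Qed.

Lemma dotv_row_mx n (a b : 'rV[R]_1) (u v : 'rV[R]_n) :
  dotv (row_mx a u) (row_mx b v) = a ord0 ord0 * b ord0 ord0 + dotv u v.
Proof.
rewrite /dotv big_split_ord/= big_ord1; congr (_ + _).
  by rewrite !row_mxEl.
by apply: eq_bigr => i _; rewrite !row_mxEr.
Qed.

(* Finite-dimensional Hahn-Banach with a convex majorant, by induction on the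
   dimension: the first coordinate [u1] of the linear form is a subgradient of
   [P] along the first axis, and the other ones come from the partial infimum
   of [P - u1 *] along that axis. *)
Lemma convexf_linear_minorant n (P : 'rV[R]_n -> R) :
  convexf P -> 0 <= P 0 -> exists u, forall p, dotv u p <= P p.
Proof.
elim: n P => [|n IH] P cP P0.
  exists 0 => p; rewrite dotv0l (_ : p = 0)//; exact: thinmx0.
pose e (s : R) (p : 'rV[R]_n) : 'rV[R]_n.+1 :=
  row_mx (const_mx s : 'rV_1) p.
have eE (a b s r : R) p q : a *: e s p + b *: e r q = e (a * s + b * r) (a *: p + b *: q).
  apply/rowP => i; rewrite !mxE.
  by case: splitP => j _; rewrite !mxE.
have e00 : e 0 0 = 0.
  by apply/rowP => i; rewrite !mxE; case: splitP => j _; rewrite !mxE.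
(* The weights [r] and [- s] bring the combination of [e s 0] and [e r 0] to the origin, where [P]
   is nonnegative. *)
have slope s r : s < 0 -> 0 < r -> P (e s 0) / s <= P (e r 0) / r.
  move=> s0 r0; have ms0 : 0 < - s by rewrite oppr_gt0.
  have := @convexf_wsum _ _ (e s 0) (e r 0) r (- s) cP r0 ms0.
  rewrite eE !scaler0 addr0 (_ : r * s + - s * r = 0); last by ring.
  rewrite e00 scaler0 => h.
  have h2 : 0 <= r * P (e s 0) + - s * P (e r 0).
    by apply: le_trans h; rewrite mulr_ge0// addr_ge0// ltW.
  rewrite -subr_ge0.
  have -> : P (e r 0) / r - P (e s 0) / s =
    (r * P (e s 0) + - s * P (e r 0)) / (r * - s).
    by field; rewrite ?(gt_eqF r0) ?(lt_eqF s0).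
  by rewrite divr_ge0// ltW// mulr_gt0.
pose S := [set P (e s 0) / s | s in [set s : R | s < 0]].
have S0 : S !=set0 by exists (P (e (-1) 0) / -1), (-1) => //=; rewrite oppr_lt0.
have Sub r : 0 < r -> ubound S (P (e r 0) / r).
  by move=> r0 _ [s /= s0 <-]; exact: slope.
pose u1 := sup S.
have u1P s : u1 * s <= P (e s 0).
  have [s0|s0|->] := ltgtP s 0.
  - rewrite mulrC -ler_ndivrMl// mulrC; apply: ub_le_sup; last by exists s.
    by exists (P (e 1 0) / 1); apply: Sub.
  - by rewrite -ler_pdivlMr//; apply: ge_sup => //; apply: Sub.
  - by rewrite mulr0 e00.
pose Q s p := P (e s p) - u1 * s.
(* The midpoint of [e s p] and [e 0 (- p)] lies on the first axis, where [u1P] applies; the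
   resulting bound does not depend on [s]. *)
have Qlb s p : - Q 0 (- p) <= Q s p.
  have := @convexf_wsum _ _ (e s p) (e 0 (- p)) 1 1 cP ltr01 ltr01.
  rewrite eE !scale1r subrr mul1r mulr0 addr0.
  have -> : (1 + 1)^-1 *: e s 0 = e ((1 + 1)^-1 * s) 0.
    by have := eE (1 + 1)^-1 0 s 0 0 0; rewrite e00 !scaler0 !addr0 mulr0 addr0.
  set h := (1 + 1)^-1 * s; have sE : s = h + h by rewrite /h; field.
  by have := u1P h; rewrite /Q sE; lra.
pose V p := [set Q s p | s in [set: R]].
have V0 p : V p !=set0 by exists (Q 0 p), 0.
have Vlb p : has_lbound (V p) by exists (- Q 0 (- p)) => _ [s _ <-].
pose P' p := inf (V p).
have P'le s p : P' p <= Q s p by apply: ge_inf => //; exists s.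
have cP' : convexf P'.
  move=> p q lam /andP[l0 l1]; apply/ler_addgt0Pr => eps e0.
  have [_ [s _ <-] hs] := inf_adherent e0 (conj (V0 p) (Vlb p)).
  have [_ [r _ <-] hr] := inf_adherent e0 (conj (V0 q) (Vlb q)).
  rewrite -/(P' p) in hs; rewrite -/(P' q) in hr.
  apply: (le_trans (P'le (lam * s + (1 - lam) * r) _)).
  have := cP (e s p) (e r q) lam; rewrite l0 l1 eE => /(_ isT).
  by rewrite /Q in hs hr *; nra.
have P'0 : 0 <= P' 0.
  apply: lb_le_inf => // _ [s _ <-]; rewrite /Q subr_ge0.
  exact: u1P.
have [u Hu] := IH P' cP' P'0.
exists (e u1 u) => p.
have -> : p = e ((p : 'rV_(1 + n)) ord0 (lshift n ord0)) (rsubmx (p : 'rV_(1 + n))).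
  apply/rowP => i; rewrite !mxE; case: splitP => j ij; rewrite !mxE; congr (p _ _).
    by apply: val_inj; rewrite /= ij (ord1 j).
  exact: val_inj.
set s := (p : 'rV_(1 + n)) _ _; set p' := rsubmx _.
rewrite dotv_row_mx !mxE.
have := le_trans (Hu p') (P'le s p'); rewrite /Q; lra.
Qed.

(* Apply [convexf_linear_minorant] to the inf-convolution of
   [G - dotv X + b] with [r * enorm]. *)
Lemma convexf_sandwich n (G : 'rV[R]_n -> R) (X : 'rV[R]_n) (b r : R) :
  convexf G -> 0 <= r -> (forall p, dotv X p - b - r * enorm p <= G p) ->
  exists Y, enorm (Y - X) <= r /\ forall p, dotv Y p - b <= G p.
Proof.
move=> cG r0 hG.
pose Q p q := G q - dotv X q + b + r * enorm (p - q).
pose V p := [set Q p q | q in [set: 'rV[R]_n]].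
have Qlb p q : - (r * enorm p) <= Q p q.
  have := hG q; have := enormD (q - p) p; rewrite subrK enormC => h1 h2.
  have := ler_wpM2l r0 h1; rewrite /Q; lra.
have V0 p : V p !=set0 by exists (Q p 0), 0.
have Vlb p : has_lbound (V p) by exists (- (r * enorm p)) => _ [q _ <-].
pose P p := inf (V p).
have Ple q p : P p <= Q p q by apply: ge_inf => //; exists q.
have cP : convexf P.
  move=> p q lam /andP[l0 l1]; apply/ler_addgt0Pr => eps e0.
  have [_ [s _ <-] hs] := inf_adherent e0 (conj (V0 p) (Vlb p)).
  have [_ [w _ <-] hw] := inf_adherent e0 (conj (V0 q) (Vlb q)).
  rewrite -/(P p) in hs; rewrite -/(P q) in hw.
  apply: (le_trans (Ple (lam *: s + (1 - lam) *: w) _)).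
  have := cG s w lam; rewrite l0 l1 => /(_ isT) hc.
  have l1' : 0 <= 1 - lam by rewrite subr_ge0.
  have hn : enorm (lam *: p + (1 - lam) *: q - (lam *: s + (1 - lam) *: w)) <=
     lam * enorm (p - s) + (1 - lam) * enorm (q - w).
    have -> : lam *: p + (1 - lam) *: q - (lam *: s + (1 - lam) *: w) =
        lam *: (p - s) + (1 - lam) *: (q - w).
      by rewrite !scalerBr opprD addrACA.
    by apply: le_trans (enormD _ _) _; rewrite !enormZ !ger0_norm.
  have := ler_wpM2l r0 hn.
  rewrite /Q in hs hw *; rewrite dotvDr !dotvZr.
  have := ler_wpM2l l0 (ltW hs); have := ler_wpM2l l1' (ltW hw).
  nra.
have P0 : 0 <= P 0.
  by apply: lb_le_inf => // _ [q _ <-]; apply: le_trans (Qlb _ _); rewrite enorm0 mulr0 oppr0.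
have [u Hu] := convexf_linear_minorant cP P0.
exists (X + u); split.
  rewrite addrC addKr; apply: enorm_le_dotv => // p.
  (* Taking [q = 0] in the infimum bounds [P (t *: p)] by a constant plus [t * (r * enorm p)];
     letting [t] grow leaves only the slopes. *)
  have key (t : R) : 0 < t -> t * (dotv u p - r * enorm p) <= G 0 + b.
    move=> t0; have := le_trans (Hu (t *: p)) (Ple 0 _).
    rewrite /Q dotv0r subr0 subr0 dotvZr enormZ gtr0_norm//; nra.
  rewrite -subr_le0 leNgt; apply/negP => d0.
  have t0 : 0 < (`|G 0 + b| + 1) / (dotv u p - r * enorm p).
    by apply: divr_gt0 => //; apply: ltr_wpDl.
  have := key _ t0; rewrite divfK ?lt0r_neq0//; have := ler_norm (G 0 + b); lra.
move=> p; have := le_trans (Hu p) (Ple p p).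
rewrite /Q subrr enorm0 mulr0 dotvDl; lra.
Qed.

End Sandwich.

(** * Steiner points *)

Section RowTopology.
Context {R : realType} {m : nat}.
Implicit Types u v p q : 'rV[R]_m.

Lemma mxnorm_le_enorm u : `|u| <= enorm u.
Proof.
rewrite [leLHS]mx_normrE; apply: bigmax_le; first exact: enorm_ge0.
by move=> [i j] _ /=; rewrite (ord1 i); exact: normr_coord_le.
Qed.

Lemma enorm_le_mxnorm u : enorm u <= m%:R * `|u|.
Proof.
case: m u => [|k] u; first by rewrite thinmx0 enorm0 normr0 mulr0.
rewrite -(@ler_pXn2r _ 2)// ?nnegrE ?enorm_ge0 ?mulr_ge0//.
rewrite enorm_sqr /dotv; apply: (@le_trans _ _ (\sum_(i < k.+1) `|u| ^+ 2)).
  apply: ler_sum => i _; rewrite -expr2 -[leLHS]real_normK ?num_real//.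
  rewrite ler_pXn2r ?nnegrE// [leRHS]mx_normrE.
  exact: (@le_bigmax _ _ _ _ (fun ij : 'I_1 * 'I_k.+1 => `|u ij.1 ij.2|) (ord0, i)).
rewrite sumr_const card_ord -[leLHS]mulr_natl exprMn.
have h : (k.+1%:R : R) <= k.+1%:R ^+ 2 by rewrite expr2 -natrM ler_nat leq_pmulr.
exact: (ler_wpM2r (sqr_ge0 `|u|) h).
Qed.

Lemma near_enorm p (e : R) : 0 < e -> \forall q \near p, enorm (p - q) < e.
Proof.
move=> e0; have m0 : 0 < (m%:R : R) + 1 by rewrite ltr_wpDl.
near=> q; apply: (le_lt_trans (enorm_le_mxnorm _)).
apply: (@le_lt_trans _ _ ((m%:R + 1) * `|p - q|)).
  by rewrite ler_wpM2r// lerDl.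
rewrite mulrC -ltr_pdivlMr//; near: q.
apply: (@cvgr_dist_lt _ _ _ (nbhs p) _ id p) => //.
by rewrite divr_gt0.
Unshelve. all: by end_near. Qed.

Lemma nbhs_enorm p (U : set 'rV[R]_m) : nbhs p U ->
  exists2 e : R, 0 < e & forall q, enorm (p - q) < e -> U q.
Proof.
move=> /nbhs_ballP[e /= e0 eU]; exists e => // q pq; apply: eU.
by rewrite -ball_normE/=; apply: le_lt_trans pq; exact: mxnorm_le_enorm.
Qed.

Lemma enorm_lipschitz_continuous (F : 'rV[R]_m -> R) (L : R) :
  (forall p q, `|F p - F q| <= L * enorm (p - q)) -> continuous F.
Proof.
move=> FL p A /nbhs_ballP[e /= e0 eA].
have L1 : 0 < `|L| + 1 by rewrite ltr_wpDl.
apply: (filterS _ (near_enorm p (divr_gt0 e0 L1))) => q /= pq; apply: eA.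
apply: (le_lt_trans (FL p q)).
apply: (@le_lt_trans _ _ ((`|L| + 1) * enorm (p - q))).
  by rewrite ler_wpM2r ?enorm_ge0// (le_trans (ler_norm L))// lerDl.
by rewrite mulrC -ltr_pdivlMr.
Qed.

Lemma continuous_enorm : continuous (@enorm R m).
Proof.
by apply: (@enorm_lipschitz_continuous _ 1) => p q; rewrite mul1r enorm_dist.
Qed.

Lemma continuous_dotv q : continuous (dotv q).
Proof.
apply: (@enorm_lipschitz_continuous _ (enorm q)) => p r.
by rewrite -dotvBr normr_dotv_le.
Qed.

Lemma continuous_measurable_BorelRV (F : 'rV[R]_m -> R) :
  continuous F -> measurable_fun (setT : set (BorelRV R m)) F.
Proof.
move=> /continuousP cF; apply: (@measurability _ _ (BorelRV R m) (measurableTypeR R) setT F _ (measurable_realfun.RGenOpens.measurableE R)).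
move=> _ [_ [x [y ->]]] <-; rewrite setTI; apply: sub_sigma_algebra.
by apply: cF; exact: interval_open.
Qed.

End RowTopology.

Lemma sphere_compact (R : realType) m : compact (@sphere R m).
Proof.
case: m => [|k].
  rewrite (_ : @sphere R 0 = set0); first exact: compact0.
  apply/seteqP; split => // p; rewrite /sphere/= (thinmx0 p) enorm0 => /eqP.
  by rewrite eq_sym oner_eq0.
apply: bounded_closed_compact.
  exists 1; split => // M M1 p /=; rewrite /sphere/= => p1.
  by have := mxnorm_le_enorm p; rewrite p1 => h; exact: le_trans h (ltW M1).
rewrite (_ : @sphere R k.+1 = @enorm R _ @^-1` [set 1])//.
by apply: closed_comp; [move=> p _; exact: continuous_enorm|exact: closed_eq].
Qed.

Section SphereIntegral.
Context {R : realType} {m : nat} (mu : probability (BorelRV R m) R).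
Hypothesis hmu : sphere_measure mu.
Implicit Types p q a : 'rV[R]_m.

Let S : set (BorelRV R m) := @sphere R m.
Let I (F : 'rV[R]_m -> R) : R := \int[mu]_(p in S) F p.

Let mS : measurable S.
Proof.
rewrite (_ : S = @enorm R _ @^-1` [set 1])// -[X in measurable X]setTI.
apply: (continuous_measurable_BorelRV continuous_enorm) => //.
Qed.

Let muS : mu S = 1%E.
Proof.
have := probability_setC mu mS; rewrite hmu.1 => /esym/eqP.
by rewrite sube_eq ?ge0_adde_def ?inE// add0e => /eqP.
Qed.

Lemma sphere_integrable (F : 'rV[R]_m -> R) : continuous F -> mu.-integrable S (EFin \o F).
Proof.
move=> cF; apply: measurable_bounded_integrable => //.
- by apply: le_lt_trans (probability_le1 mu mS) _; exact: ltry.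
- by apply: measurable_funTS; exact: continuous_measurable_BorelRV.
- have cS : compact (F @` (@sphere R m)).
    apply: continuous_compact (@sphere_compact R m).
    by apply: continuous_subspaceT.
  have [M [Mr MA]] := @compact_bounded _ R^o _ cS.
  by exists M; split => // x Mx y Sy; apply: (MA x Mx); exists y.
Qed.

(** [steiner] integrates over the whole space, where a continuous integrand may be unbounded; as
    [mu] does not charge the complement of the sphere, only a compact set counts. *)
Lemma sphere_integral_setT (F : 'rV[R]_m -> R) : continuous F ->
  \int[mu]_(p in setT) F p = I F.
Proof.
move=> cF; rewrite /I /Rintegral.

have NS0 : mu (~` S) = 0%E by exact: hmu.1.
have mF : measurable_fun (setT : set (BorelRV R m)) (fun p : BorelRV R m => (F p)%:E).
  by apply/measurable_EFinP; exact: continuous_measurable_BorelRV.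
have SE : setT `\` ~` S = S by rewrite setTD setCK.
rewrite (negligible_integral _ measurableT _ NS0) ?SE//.
  exact: measurableC.
apply/(negligible_integrable _ measurableT mF NS0); first exact: measurableC.
by rewrite SE; exact: sphere_integrable.
Qed.

(** Hyperplane reflections are the only isometries used: along [e i] they change the sign of a
    coordinate, along [e i - e j] they swap two coordinates, and along [q] they give the half-space
    bound for Steiner points. *)
Definition reflection q p : 'rV[R]_m := p - (2 * dotv p q / dotv q q) *: q.

Lemma reflection_isometry q p : q != 0 ->
  dotv (reflection q p) (reflection q p) = dotv p p.
Proof.
move=> q0; have q0' : dotv q q != 0.
  by rewrite -enorm_sqr expf_neq0// enorm_eq0.
rewrite /reflection dotvBl !dotvBr !dotvZl !dotvZr (dotvC q p).
by field.
Qed.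

Lemma reflectionK q p : q != 0 -> reflection q (reflection q p) = p.
Proof.
move=> q0; have q0' : dotv q q != 0.
  by rewrite -enorm_sqr expf_neq0// enorm_eq0.
rewrite {1}/reflection /reflection dotvBl dotvZl -addrA -opprD -scalerDl.
rewrite [X in X *: q](_ : _ = 0) ?scale0r ?subr0//.
by field.
Qed.

Lemma reflectionB q p p' :
  reflection q p - reflection q p' = reflection q (p - p').
Proof.
rewrite /reflection dotvBl mulrBr mulrBl scalerBl.
by apply/rowP => i; rewrite !mxE; ring.
Qed.

Lemma continuous_reflection q : q != 0 -> continuous (reflection q).
Proof.
move=> q0 p A /nbhs_enorm[e e0 eA].
apply: (filterS _ (near_enorm p e0)) => p' /= pp'; apply: eA.
by rewrite reflectionB /enorm reflection_isometry.
Qed.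

Let refl_mx q : 'M[R]_m := 1%:M - (2 / dotv q q) *: (q^T *m q).

Let refl_mxE q p : p *m refl_mx q = reflection q p.
Proof.
rewrite /refl_mx mulmxBr mulmx1 -scalemxAr mulmxA /reflection; congr (_ - _).
have -> : p *m q^T = (dotv p q)%:M.
  apply/matrixP => i j; rewrite (ord1 i) (ord1 j) !mxE; apply: eq_bigr => k _.
  by rewrite mxE.
by rewrite mul_scalar_mx scalerA mulrAC.
Qed.

Let refl_mx_ortho q : q != 0 -> refl_mx q *m (refl_mx q)^T = 1%:M.
Proof.
move=> q0.
have -> : (refl_mx q)^T = refl_mx q.
  by rewrite /refl_mx linearB linearZ/= trmx1 trmx_mul trmxK.
apply/row_matrixP => i; rewrite row_mul refl_mxE rowE refl_mxE reflectionK//.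
by rewrite rowE mulmx1.
Qed.

Lemma sphere_integral_reflection (F : 'rV[R]_m -> R) q : q != 0 ->
  continuous F -> I (F \o reflection q) = I F.
Proof.
move=> q0 cF; pose phi (p : BorelRV R m) : BorelRV R m := reflection q p.
have mphi : measurable_fun setT phi.
  apply: (@measurability _ _ (BorelRV R m) (BorelRV R m) setT phi open) => //.
  move=> _ [A oA <-]; rewrite setTI; apply: sub_sigma_algebra.
  by move/continuousP: (continuous_reflection q0); apply.
have phiS : phi @^-1` S = S.
  by apply/seteqP; split => p; rewrite /S /sphere/= /phi /enorm reflection_isometry.
have cFr : continuous (F \o reflection q).
  by move=> p; apply: continuous_comp; [exact: continuous_reflection|exact: cF].
rewrite /I /Rintegral; congr fine.
transitivity (\int[pushforward mu phi]_(p in S) (F p)%:E)%E.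
  rewrite integral_pushforward ?phiS//.
    by apply/measurable_EFinP; exact: continuous_measurable_BorelRV.
  exact: sphere_integrable.
apply: eq_measure_integral => A mA AS; rewrite /pushforward.
have := hmu.2 (refl_mx q) (refl_mx_ortho q0) A mA.
by congr (mu _ = _); apply/seteqP; split => p; rewrite /preimage/= refl_mxE.
Qed.

Lemma continuous_coord_row i : continuous (fun p : 'rV[R]_m => p ord0 i).
Proof.
apply: (@enorm_lipschitz_continuous _ _ _ 1) => p q; rewrite mul1r.
by have := normr_coord_le (p - q) i; rewrite !mxE.
Qed.

Lemma continuous_cst_row (c : R) : continuous (fun _ : 'rV[R]_m => c).
Proof.
by apply: (@enorm_lipschitz_continuous _ _ _ 0) => p q; rewrite subrr normr0 mul0r.
Qed.

Lemma continuousMf (F G : 'rV[R]_m -> R) :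
  continuous F -> continuous G -> continuous (fun p => F p * G p).
Proof. by move=> cF cG p; exact: (@continuousM _ _ F G p (cF p) (cG p)). Qed.

Lemma sphere_integral_sum (s : seq 'I_m) (F : 'I_m -> 'rV[R]_m -> R) :
  (forall k, continuous (F k)) ->
  continuous (fun p => \sum_(k <- s) F k p) /\
  I (fun p => \sum_(k <- s) F k p) = \sum_(k <- s) I (F k).
Proof.
move=> cF; elim: s => [|k s [IHc IH]].
  rewrite big_nil (_ : (fun p => _) = fun=> 0); last first.
    by apply/funext => p; rewrite big_nil.
  split; first exact: continuous_cst_row.
  by rewrite /I Rintegral_cst// mul0r.
rewrite big_cons (_ : (fun p => _) = fun p => F k p + \sum_(k <- s) F k p); last first.
  by apply/funext => p; rewrite big_cons.
split; first by move=> p; exact: (cvgD (cF k p) (IHc p)).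
rewrite /I (@RintegralD _ _ _ mu S (F k) (fun p => \sum_(k <- s) F k p))//.
- by rewrite -IH.
- exact: sphere_integrable.
- exact: sphere_integrable.
Qed.

Let e i : 'rV[R]_m := delta_mx ord0 i.

Let dotve p i : dotv p (e i) = p ord0 i.
Proof.
rewrite /dotv (bigD1 i)//= big1 ?addr0; first by rewrite mxE !eqxx mulr1.
by move=> j ji; rewrite mxE (negPf ji) andbF mulr0.
Qed.

Let ee i j : dotv (e i) (e j) = (i == j)%:R.
Proof. by rewrite dotve mxE eqxx/= eq_sym. Qed.

Let e_neq0 i : e i != 0.
Proof.
apply/eqP => e0; have := ee i i; rewrite e0 dotv0l eqxx => /eqP.
by rewrite eq_sym oner_eq0.
Qed.

Let sphere_moment_off i j : i != j -> I (fun p => p ord0 i * p ord0 j) = 0.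
Proof.
move=> ij; set F := fun p : 'rV[R]_m => _.
have cF : continuous F by apply: continuousMf; exact: continuous_coord_row.
have := sphere_integral_reflection (e_neq0 i) cF.
have -> : F \o reflection (e i) = fun p => (-1) * F p.
  apply/funext => p; rewrite /F /reflection/= ee dotve !mxE !eqxx/=.
  by rewrite (eq_sym j i) (negPf ij)/=; field.
rewrite {1}/I RintegralZl//; last exact: sphere_integrable.
by rewrite -/(I F); lra.
Qed.

Let sphere_moment_diag i j :
  I (fun p => p ord0 i * p ord0 i) = I (fun p => p ord0 j * p ord0 j).
Proof.
have [->//|ij] := eqVneq i j.
have cF : continuous (fun p : 'rV[R]_m => p ord0 i * p ord0 i).
  by apply: continuousMf; exact: continuous_coord_row.
have q2 : dotv (e i - e j) (e i - e j) = 2.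
  by rewrite dotvBl !dotvBr !ee !eqxx (eq_sym j i) (negPf ij)/=; ring.
have q0 : e i - e j != 0.
  apply/eqP => q0; move: q2; rewrite q0 dotv0l => /eqP.
  by rewrite eq_sym pnatr_eq0.
rewrite -(sphere_integral_reflection q0 cF); congr I; apply/funext => p /=.
have -> : reflection (e i - e j) p ord0 i = p ord0 j.
  by rewrite /reflection q2 dotvBr !dotve !mxE !eqxx/= (negPf ij)/=; field.
by [].
Qed.

(** Off the diagonal a sign change kills the moment. The diagonal moments are equal by symmetry and
    add up to the integral of |p|^2, which is 1 on the sphere. *)
Lemma sphere_moment i j :
  m%:R * I (fun p => p ord0 i * p ord0 j) = (i == j)%:R.
Proof.
have [<-|ij] := eqVneq i j; last by rewrite sphere_moment_off ?mulr0.
have cF k : continuous (fun p : 'rV[R]_m => p ord0 k * p ord0 k).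
  by apply: continuousMf; exact: continuous_coord_row.
transitivity (\sum_(k < m) I (fun p => p ord0 k * p ord0 k)).
  rewrite (eq_bigr (fun=> I (fun p => p ord0 i * p ord0 i))); last first.
    by move=> k _; exact: sphere_moment_diag.
  by rewrite sumr_const card_ord mulr_natl.
rewrite -(sphere_integral_sum _ cF).2.
transitivity (I (fun=> 1)).
  by apply: eq_Rintegral => p; rewrite inE /S /sphere/= => p1; rewrite -/(dotv p p) -enorm_sqr p1 expr1n.
transitivity (fine (mu S)); first by rewrite /I Rintegral_cst// mul1r.
by rewrite muS.
Qed.

Let sphere_moment_dotv q i : m%:R * I (fun p => dotv q p * p ord0 i) = q ord0 i.
Proof.
have cF k : continuous (fun p : 'rV[R]_m => q ord0 k * (p ord0 k * p ord0 i)).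
  apply: continuousMf; first exact: continuous_cst_row.
  by apply: continuousMf; exact: continuous_coord_row.
have -> : (fun p : 'rV[R]_m => dotv q p * p ord0 i) =
    fun p => \sum_(k <- index_enum 'I_m) q ord0 k * (p ord0 k * p ord0 i).
  by apply/funext => p; rewrite mulr_suml; apply: eq_bigr => k _; rewrite mulrA.
rewrite (sphere_integral_sum _ cF).2 mulr_sumr (bigD1 i)//= big1 ?addr0.
  rewrite {1}/I RintegralZl//; last first.
    by apply: sphere_integrable; apply: continuousMf; exact: continuous_coord_row.
  by rewrite mulrCA -/(I _) sphere_moment eqxx mulr1.
move=> k ki; rewrite {1}/I RintegralZl//; last first.
  by apply: sphere_integrable; apply: continuousMf; exact: continuous_coord_row.
by rewrite mulrCA -/(I _) sphere_moment (negPf ki) mulr0.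
Qed.

(** The support function of a point is linear, so only second moments of the sphere occur. *)
Lemma steiner_set1 a : steiner mu [set a] = a.
Proof.
apply/rowP => i; rewrite mxE sphere_integral_setT; last first.
  apply: continuousMf; first exact: continuous_coord_row.
  by move=> p; rewrite /support_fun; under eq_fun do rewrite image_set1 sup1 dotvC; exact: continuous_dotv.
rewrite -[RHS](sphere_moment_dotv a i); congr (_ * I _); apply/funext => p.
by rewrite /support_fun image_set1 sup1 mulrC dotvC.
Qed.

Section SteinerOfBounded.
Variables (K : set 'rV[R]_m) (M : R).
Hypotheses (K0 : K !=set0) (KM : forall y, K y -> enorm y <= M).

Let h := support_fun K.

Let h_sup p : has_sup [set dotv p y | y in K].
Proof.
split; first by case: K0 => y Ky; exists (dotv p y), y.
exists (enorm p * M) => _ [y Ky <-]; apply: le_trans (dotv_le p y) _.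
by apply: ler_wpM2l (KM Ky); exact: enorm_ge0.
Qed.

Let h_ub p y : K y -> dotv p y <= h p.
Proof. by move=> Ky; apply: ub_le_sup; [exact: (h_sup p).2|exists y]. Qed.

Let h_le p c : (forall y, K y -> dotv p y <= c) -> h p <= c.
Proof.
by move=> hc; apply: ge_sup (h_sup p).1 _ => _ [y Ky <-]; exact: hc.
Qed.

Let hZ (a : R) p : 0 <= a -> h (a *: p) <= a * h p.
Proof.
by move=> a0; apply: h_le => y Ky; rewrite dotvZl ler_wpM2l// h_ub.
Qed.

Let h_sub p q : h p - h q <= h (p - q).
Proof.
rewrite lerBlDr; apply: h_le => y Ky.
by rewrite -{1}(subrK q p) dotvDl lerD// h_ub.
Qed.

Let continuous_h : continuous h.
Proof.
have hl p q : h p - h q <= M * enorm (p - q).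
  apply: le_trans (h_sub _ _) _; apply: h_le => y Ky.
  apply: le_trans (dotv_le _ _) _; rewrite mulrC ler_wpM2r ?enorm_ge0//.
  exact: KM.
apply: (@enorm_lipschitz_continuous _ _ _ M) => p q.
by rewrite ler_norml hl andbT lerNl opprB enormC hl.
Qed.

(* The reflection [p'] of [p] across the hyperplane orthogonal to [q] satisfies
   [dotv q p' = - dotv q p], so that twice the integral of [dotv q p * h p] is the
   integral of [dotv q p * (h p - h p')], which subadditivity of [h] bounds by
   the integral of [2 * (dotv q p)^2 * h q / |q|^2 ]. *)
Lemma steiner_halfspace q c :
  (forall y, K y -> dotv q y <= c) -> dotv q (steiner mu K) <= c.
Proof.
move=> hc; have [q0|q0] := eqVneq q 0.
  by case: K0 => y /hc; rewrite q0 !dotv0l.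
have qq : 0 < dotv q q.
  by rewrite lt_def dotv_ge0 andbT -enorm_sqr expf_neq0// enorm_eq0.
apply: (@le_trans _ _ (h q)); last exact: h_le.
pose F p := dotv q p * h p.
have cF : continuous F by apply: continuousMf => //; exact: continuous_dotv.
have cq i : continuous (fun p : 'rV[R]_m => p ord0 i * h p).
  by apply: continuousMf => //; exact: continuous_coord_row.
have cqi i : continuous (fun p : 'rV[R]_m => q ord0 i * (p ord0 i * h p)).
  by apply: continuousMf => //; exact: continuous_cst_row.
have -> : dotv q (steiner mu K) = m%:R * I F.
  have -> : F = fun p => \sum_(k <- index_enum 'I_m) q ord0 k * (p ord0 k * h p).
    by apply/funext => p; rewrite /F mulr_suml; apply: eq_bigr => k _; rewrite mulrA.
  rewrite (sphere_integral_sum _ cqi).2 mulr_sumr; apply: eq_bigr => k _.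
  rewrite mxE sphere_integral_setT// mulrCA; congr (_ * _).
  by rewrite [in RHS]/I RintegralZl//; exact: sphere_integrable.
pose G p := dotv q p * dotv q p * (2 * h q / dotv q q).
have cG : continuous G.
  apply: continuousMf; last exact: continuous_cst_row.
  by apply: continuousMf; exact: continuous_dotv.
have cFr : continuous (F \o reflection q).
  by move=> p; apply: continuous_comp; [exact: continuous_reflection|exact: cF].
have IG : m%:R * I G = 2 * h q.
  have cqq i : continuous (fun p : 'rV[R]_m => q ord0 i * (dotv q p * p ord0 i)).
    apply: continuousMf; first exact: continuous_cst_row.
    by apply: continuousMf; [exact: continuous_dotv|exact: continuous_coord_row].
  rewrite /I /G RintegralZr//; last first.
    by apply: sphere_integrable; apply: continuousMf; exact: continuous_dotv.
  rewrite mulrA (_ : m%:R * _ = dotv q q); first by field; rewrite lt0r_neq0.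
  have -> : (fun p : 'rV[R]_m => dotv q p * dotv q p) =
      fun p => \sum_(k <- index_enum 'I_m) q ord0 k * (dotv q p * p ord0 k).
    apply/funext => p; rewrite {2}/dotv mulr_sumr; apply: eq_bigr => k _.
    by rewrite mulrCA.
  rewrite -/(I _) (sphere_integral_sum _ cqq).2 mulr_sumr; apply: eq_bigr => k _.
  rewrite {1}/I RintegralZl//; last first.
    apply: sphere_integrable; apply: continuousMf; first exact: continuous_dotv.
    exact: continuous_coord_row.
  by rewrite mulrCA sphere_moment_dotv.
have : I F + I (F \o reflection q) <= I G.
  rewrite /I -RintegralD//; [|exact: sphere_integrable..].
  apply: le_Rintegral => //; [|exact: sphere_integrable|].
    by apply: sphere_integrable => p; exact: cvgD (cF p) (cFr p).
  move=> p _; rewrite /F /G/=.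
  have -> : dotv q (reflection q p) = - dotv q p.
    rewrite /reflection dotvBr dotvZr (dotvC p); field; exact: lt0r_neq0.
  set p' := reflection q p; set s := dotv q p.
  have pp' : p - p' = (2 * s / dotv q q) *: q.
    by rewrite /p' /reflection opprB addrC subrK (dotvC p).
  have [s0|s0] := leP 0 s.
    have h1 : h p - h p' <= (2 * s / dotv q q) * h q.
      by apply: le_trans (h_sub _ _) _; rewrite pp' hZ// divr_ge0 ?mulr_ge0// ltW.
    by have := ler_wpM2l s0 h1; lra.
  have h1 : h p' - h p <= (2 * (- s) / dotv q q) * h q.
    apply: le_trans (h_sub _ _) _; rewrite -opprB pp' -scaleNr.
    rewrite (_ : - (2 * s / dotv q q) = 2 * (- s) / dotv q q) ?hZ//; last by field; rewrite lt0r_neq0.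
    by rewrite divr_ge0 ?mulr_ge0// ?oppr_ge0 ltW.
  have s0' : 0 <= - s by rewrite oppr_ge0 ltW.
  by have := ler_wpM2l s0' h1; lra.
rewrite sphere_integral_reflection// => h2.
have := ler_wpM2l (ler0n R m) h2; rewrite IG; lra.
Qed.

End SteinerOfBounded.
End SphereIntegral.

Section SteinerRepresentation.
Context {R : realType} {n : nat} (H : R -> 'rV[R]_n -> 'rV[R]_n -> R).
Context (mu : probability (BorelRV R (n + 1)) R) (hmu : sphere_measure mu).
Implicit Types (t : R) (x p v : 'rV[R]_n) (a z : 'rV[R]_(n + 1)).

(** Pairing with [q p], that is (p, -1), presents the epigraph as the intersection over [p] of the
    half-spaces bounded by [H t x p]. *)
Let q p : 'rV[R]_(n + 1) := row_mx p (const_mx (-1) : 'rV_1).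

Lemma epiHstarP t x z : epiHstar H t x z <->
  forall p, dotv (lsubmx z) p - (rsubmx z) ord0 ord0 <= H t x p.
Proof.
split=> [|h].
  rewrite /epiHstar/= /Hstar => h p.
  have : ((dotv (lsubmx z) p - H t x p)%:E <= (rsubmx z ord0 ord0)%:E)%E.
    by apply: le_trans h; apply: ereal_sup_ubound; exists p.
  by rewrite lee_fin; lra.
apply: ge_ereal_sup => _ [p _ <-]; rewrite lee_fin; have := h p; lra.
Qed.

Let dotv_q p z : dotv (q p) z = dotv (lsubmx z) p - (rsubmx z) ord0 ord0.
Proof.
rewrite /dotv big_split_ord/= big_ord1; congr (_ + _).
  by apply: eq_bigr => i _; rewrite /q row_mxEl mxE mulrC.
by rewrite /q row_mxEr !mxE mulN1r.
Qed.

(** A subgradient of [H t x] at 0, together with the cost [- H t x 0], is a point of the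
    epigraph. *)
Lemma epiHstar_neq0 t x (C : R) : 0 <= C -> convexf (H t x) ->
  (forall p p', `|H t x p - H t x p'| <= C * enorm (p - p')) ->
  epiHstar H t x !=set0.
Proof.
move=> C0 cH HL.
have [p|v [_ hv]] := @convexf_sandwich _ _ (H t x) 0 (- H t x 0) C cH C0.
  rewrite dotv0l; have := HL 0 p; rewrite sub0r enormN ler_norml; lra.
exists (row_mx v (const_mx (- H t x 0))); apply/epiHstarP => p.
by rewrite row_mxKl row_mxKr mxE.
Qed.

Let edist_ub t x a z : epiHstar H t x z -> Defs.edist a (epiHstar H t x) <= enorm (a - z).
Proof.
move=> Ez; apply: ge_inf; last by exists z.
by exists 0 => _ [y _ <-]; exact: enorm_ge0.
Qed.

Let edist_ge0 t x a : epiHstar H t x !=set0 -> 0 <= Defs.edist a (epiHstar H t x).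
Proof.
move=> [z Ez]; apply: lb_le_inf; first by exists (enorm (a - z)), z.
by move=> _ [y _ <-]; exact: enorm_ge0.
Qed.

(** The distance vanishes, so the ball in [Phi] shrinks to the point [a]. *)
Lemma steiner_fl_id t x a : epiHstar H t x a -> steiner_fl H mu t x a = a.
Proof.
move=> Ea; rewrite /steiner_fl (_ : Phi H t x a = [set a]) ?steiner_set1//.
have d0 : Defs.edist a (epiHstar H t x) = 0.
  apply/eqP; rewrite eq_le edist_ge0 ?andbT; last by exists a.
  by have := edist_ub a Ea; rewrite subrr enorm0.
rewrite /Phi d0 mulr0; apply/seteqP; split=> [y [_]|_ ->].
  rewrite /cball/= => ya; apply/eqP; rewrite -subr_eq0 -enorm_eq0.
  by rewrite eq_le ya enorm_ge0.
by split => //; rewrite /cball/= subrr enorm0.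
Qed.

(** [Phi] is bounded and nonempty, so its Steiner point stays in each half-space containing it, in
    particular in those that define the epigraph. *)
Lemma steiner_fl_in t x a (C : R) : 0 <= C -> convexf (H t x) ->
  (forall p p', `|H t x p - H t x p'| <= C * enorm (p - p')) ->
  epiHstar H t x (steiner_fl H mu t x a).
Proof.
move=> C0 cH HL; have E0 := epiHstar_neq0 C0 cH HL.
set d := Defs.edist a (epiHstar H t x).
have d0 : 0 <= d by exact: edist_ge0.
have near_inf (e : R) : 0 < e -> exists2 y, epiHstar H t x y & enorm (a - y) < d + e.
  move=> e0; have [|_ [y Ey <-] ye] := @inf_adherent _ [set enorm (a - y) | y in epiHstar H t x] _ e0.
    split; first by case: E0 => z Ez; exists (enorm (a - z)), z.
    by exists 0 => _ [y _ <-]; exact: enorm_ge0.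
  by exists y.
have Phi0 : Phi H t x a !=set0.
  (* The factor 2 in the radius matters here: if [d > 0], a point at distance less than [2 * d]
     exists without a projection being chosen. If [d = 0], [a] itself satisfies every half-space
     inequality by approximation. *)
  have [dpos|] := ltP 0 d.
    have [y Ey ya] := near_inf d dpos; exists y; split => //.
    by rewrite /cball/= enormC -/d; lra.
  move=> dle; exists a; split; last by rewrite /cball/= subrr enorm0 mulr_ge0.
  apply/epiHstarP => p; apply/ler_addgt0Pr => e e0.
  have q1 : 0 < enorm (q p) + 1 by rewrite ltr_wpDl// enorm_ge0.
  have [y /epiHstarP/(_ p) Ey ya] := near_inf _ (divr_gt0 e0 q1).
  rewrite -!dotv_q in Ey *.
  have h1 := dotv_le (q p) (a - y).
  have h2 : enorm (q p) * enorm (a - y) <= e.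
    have ya' : enorm (a - y) <= e / (enorm (q p) + 1) by lra.
    apply: le_trans (ler_wpM2l (enorm_ge0 _) ya') _.
    rewrite mulrA ler_pdivrMr// mulrC ler_wpM2l ?(ltW e0)//; lra.
  rewrite dotvBr in h1; lra.
apply/epiHstarP => p; rewrite -dotv_q.
apply: (@steiner_halfspace _ _ _ hmu _ (enorm a + 2 * d)) => //.
  move=> y [_]; rewrite /cball/= -/d => ya.
  have := enormD (y - a) a; rewrite subrK; lra.
by move=> y [/epiHstarP/(_ p) + _]; rewrite dotv_q.
Qed.

End SteinerRepresentation.

(** * Integrals over intervals *)

Section LebesgueVersusBorel.
Context {R : realType}.
Local Notation lam := (@lebesgue_measure R).
Local Notation leb := (@leb R).
Local Notation BR := (measurableTypeR R).

Lemma measurable_LebT (A : set BR) :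
  measurable A -> measurable (A : set (LebT R)).
Proof. by move=> mA; exact: sub_caratheodory. Qed.

Lemma lebE (A : set R) : leb A = lam A.
Proof. by []. Qed.

Lemma measurable_fun_LebT d (Y : measurableType d) (D : set BR) (f : BR -> Y) :
  measurable D -> measurable_fun D f ->
  measurable_fun (D : set (LebT R)) (f : LebT R -> Y).
Proof. by move=> mD mf _ B mB; apply: measurable_LebT; exact: mf. Qed.

Lemma leb_itv (s t : R) : s <= t -> leb (`[s, t]%classic : set R) = (t - s)%:E.
Proof.
move=> st; rewrite lebE lebesgue_measure_itv/= lte_fin.
have [_|ts] := ltP s t; first by rewrite EFinD.
by rewrite (@le_anti _ _ s t) ?st ?ts// subrr.
Qed.

Let idm : measurable_fun (setT : set (LebT R)) (idfun : LebT R -> BR).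
Proof. exact: (@measurable_fun_LebT _ BR setT idfun measurableT (@measurable_id _ _ _)). Qed.

(** The identity is measurable from the completed sigma-algebra to the Borel one and transports
    [leb] to [lam]. *)
Lemma ge0_integral_LebT (D : set BR) (f : BR -> \bar R) : measurable D ->
  measurable_fun D f -> (forall x, D x -> (0 <= f x)%E) ->
  (\int[leb]_(x in (D : set (LebT R))) f x = \int[lam]_(x in D) f x)%E.
Proof.
move=> mD mf f0.
have := @ge0_integral_pushforward _ _ (LebT R) BR R idfun idm leb D f mD mf.
move=> <-; last by move=> x; rewrite inE => /f0.
by apply: eq_measure_integral => A mA AD.
Qed.

Lemma integrable_LebT (D : set BR) (f : BR -> R) : measurable D ->
  measurable_fun D f ->
  leb.-integrable (D : set (LebT R)) (EFin \o f) <-> lam.-integrable D (EFin \o f).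
Proof.
move=> mD mf.
have e : (\int[leb]_(x in (D : set (LebT R))) `|(f x)%:E| =
          \int[lam]_(x in D) `|(f x)%:E|)%E.
  apply: ge0_integral_LebT => //; apply/measurableT_comp => //.
  exact/measurable_EFinP.
split => /integrableP[_ h]; apply/integrableP; split.
- exact/measurable_EFinP.
- by rewrite -e.
- by apply/measurable_EFinP; exact: measurable_fun_LebT.
- by rewrite e.
Qed.

Lemma integral_LebT (D : set BR) (f : BR -> \bar R) : measurable D ->
  measurable_fun D f ->
  (\int[leb]_(x in (D : set (LebT R))) f x = \int[lam]_(x in D) f x)%E.
Proof.
move=> mD mf; rewrite integralE [in RHS]integralE !ge0_integral_LebT//.
- exact: measurable_funeneg.
- exact: measurable_funepos.
Qed.

Lemma LebT_approx (A : set (LebT R)) : measurable A ->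
  exists B M : set BR, [/\ measurable B, measurable M, lam M = 0%E,
    (B `<=` A) & A `\` M `<=` B].
Proof.
move=> mA; have : (completed_algebra_gen lam).-sigma.-measurable A.
  by rewrite completed_caratheodory_measurable.
rewrite g_sigma_completed_algebra_genE => -[B mB [N [M [mM M0 NM]]] <-].
exists B, M; split => //.
by move=> x [[//|/NM]].
Qed.

Lemma negligible_LebT (N : set (LebT R)) : leb.-negligible N ->
  exists M : set BR, [/\ measurable M, lam M = 0%E & N `<=` M].
Proof.
move=> [A [mA A0 NA]]; have [B [M [mB mM M0 BA AM]]] := LebT_approx mA.
exists (B `|` M); split.
- exact: measurableU.
- apply/eqP; rewrite eq_le measure_ge0 andbT.
  apply: (le_trans (@measureU2 _ _ _ lam _ _ mB mM)).
  have B0 : (lam B <= 0)%E by rewrite -A0 lebE; apply: le_outer_measure.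
  have M0' : (lam M <= 0)%E by rewrite M0.
  by rewrite -[leRHS]adde0; exact: leeD B0 M0'.
- move=> x /NA Ax; have [?|nMx] := pselect (M x); [by right|left].
  exact: AM.
Qed.

Lemma ae_LebT (P : R -> Prop) :
  {ae lam, forall x, P x} -> {ae leb, forall x : LebT R, P x}.
Proof.
move=> [N [mN N0 PN]]; exists N; split => //; exact: measurable_LebT.
Qed.

(** Each sublevel set at a rational is Borel up to a Borel null set; the countable union [M] of
    these null sets is where the function is replaced by 0. *)
Lemma borel_modification (f : R -> R) :
  measurable_fun (setT : set (LebT R)) (f : LebT R -> R) ->
  exists M : set BR, [/\ measurable M, lam M = 0%E & measurable_fun (setT : set BR) (f \_ (~` M))].
Proof.
move=> mf.
have /choice[BM BMP] : forall q : rat, exists BM : set BR * set BR,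
    [/\ measurable BM.1, measurable BM.2, lam BM.2 = 0%E,
      BM.1 `<=` [set x | f x < ratr q] & [set x | f x < ratr q] `\` BM.2 `<=` BM.1].
  move=> q; have [|B [M [? ? ? ? ?]]] := @LebT_approx [set x | f x < ratr q].
    have -> : [set x | f x < ratr q] = setT `&` f @^-1` `]-oo, (ratr q)[.
      by apply/seteqP; split => x /=; rewrite in_itv/= ?andbT; [split|case].
    exact: mf.
  by exists (B, M).
pose M := \bigcup_q (BM q).2.
have mM : measurable M by apply: bigcupT_measurable_rat => q; case: (BMP q).
have [u uK] : exists u : nat -> option rat, forall q, exists k, u k = Some q.
  by exists unpickle => q; exists (pickle q); exact: pickleK.
exists M; split => //.
  have : lam.-negligible M.
    have -> : M = \bigcup_k (oapp (fun q => (BM q).2) set0 (u k)).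
      apply/seteqP; split => [x [q _ xq]|x [k _]].
        by have [k uk] := uK q; exists k => //; rewrite uk.
      by case: (u k) => //= q xq; exists q.
    apply: negligible_bigcup => k; case: (u k) => [q|]/=; last exact: negligible_set0.
    by case: (BMP q) => _ mB B0 _ _; apply/negligibleP.
  by move/negligibleP; apply.
apply: (@measurability _ _ BR _ setT (f \_ (~` M)) _ (RGenInftyO.measurableE R)) => //.
move=> _ [_ [x ->] <-]; rewrite setTI.
(* The modified function is 0 on [M], so [M] belongs to the sublevel set at [q] exactly when
   [0 < q]. *)
pose C (q : rat) := if (ratr q <= x)%R then
  ((BM q).1 `\` M) `|` (if (0 < ratr q :> R)%R then M else set0) else set0.
have -> : (f \_ (~` M)) @^-1` `]-oo, x[ = \bigcup_q C q.
  apply/seteqP; split => y /=; rewrite in_itv/=.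
    move=> /rat_in_itvoo[q]; rewrite in_itv/= => /andP[yq qx].
    exists q => //; rewrite /C (ltW qx); move: yq; rewrite patchE.
    case: ifPn => [|] ; rewrite ?inE ?notin_setE => My yq; last first.
      by right; rewrite yq; apply: contrapT.
    left; split => //; case: (BMP q) => _ _ _ _; apply; split => //.
    by move=> qy; apply: My; exists q.
  move=> [q _]; rewrite /C; case: ifPn => // qx; rewrite patchE.
  move=> [[Bq My]|].
    rewrite mem_set//; apply: lt_le_trans qx.
    by case: (BMP q) => _ _ _ + _; apply.
  case: ifPn => // q0 My; rewrite memNset; last by move=> /(_ My).
  exact: lt_le_trans q0 qx.
apply: bigcupT_measurable_rat => q; rewrite /C; case: ifPn => // _.
case: (BMP q) => mB _ _ _ _; apply: measurableU; first exact: measurableD.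
by case: ifPn.
Qed.

End LebesgueVersusBorel.

Section IntegralOnIntervals.
Context {R : realType}.
Local Notation lam := (@lebesgue_measure R).
Local Notation leb := (@leb R).
Local Notation BR := (measurableTypeR R).

(** Integrability on the whole line spares the tracking of intervals and allows primitives from -oo;
    the data of the theorem are extended by 0 outside [0, T] with [truncT]. *)
Definition L1 (f : R -> R) := leb.-integrable (setT : set (LebT R)) (EFin \o f).
Definition Ig (f : R -> R) (s t : R) : R :=
  \int[leb]_(r in (`[s, t]%classic : set (LebT R))) f r.

Implicit Types (f g : R -> R) (s r t : R).

Let mitv s t : measurable (`[s, t]%classic : set (LebT R)).
Proof. by apply: measurable_LebT; exact: measurable_itv. Qed.

Let Sitv f s t : L1 f -> leb.-integrable (`[s, t]%classic : set (LebT R)) (EFin \o f).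
Proof. by move=> f1; apply: integrableS f1. Qed.

Lemma L1D f g : L1 f -> L1 g -> L1 (fun t => f t + g t).
Proof. by move=> f1 g1; exact: (integrableD measurableT f1 g1). Qed.

Lemma L1Z f (a : R) : L1 f -> L1 (fun t => a * f t).
Proof. by move=> f1; exact: (integrableZl measurableT a f1). Qed.

Lemma L1Zr f (a : R) : L1 f -> L1 (fun t => f t * a).
Proof. by move=> f1; under eq_fun do rewrite mulrC; exact: L1Z. Qed.

Lemma L1N f : L1 f -> L1 (fun t => - f t).
Proof. by move=> f1; under eq_fun do rewrite -mulN1r; exact: L1Z. Qed.

Lemma L1B f g : L1 f -> L1 g -> L1 (fun t => f t - g t).
Proof. by move=> f1 g1; apply: L1D => //; exact: L1N. Qed.

Lemma L1_norm f : L1 f -> L1 (fun t => `|f t|).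
Proof. by move=> f1; exact: (integrable_abse f1). Qed.

Lemma L1_measurable f : L1 f ->
  measurable_fun (setT : set (LebT R)) (f : LebT R -> R).
Proof. by move=> /integrableP[/measurable_EFinP]. Qed.

Lemma L1_dominated f g : measurable_fun (setT : set (LebT R)) (f : LebT R -> R) ->
  L1 g -> (forall t, `|f t| <= g t) -> L1 f.
Proof.
move=> mf g1 fg; apply: (le_integrable measurableT _ _ g1) => /=.
  exact/measurable_EFinP.
move=> t _; rewrite lee_fin; apply: le_trans (fg t) (ler_norm _).
Qed.

Lemma IgD f g s t : L1 f -> L1 g -> Ig (fun r => f r + g r) s t = Ig f s t + Ig g s t.
Proof. by move=> f1 g1; rewrite /Ig RintegralD//; exact: Sitv. Qed.

Lemma IgZ f (a : R) s t : L1 f -> Ig (fun r => a * f r) s t = a * Ig f s t.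
Proof. by move=> f1; rewrite /Ig RintegralZl//; exact: Sitv. Qed.

Lemma IgZr f (a : R) s t : L1 f -> Ig (fun r => f r * a) s t = Ig f s t * a.
Proof. by move=> f1; rewrite /Ig RintegralZr//; exact: Sitv. Qed.

Lemma IgB f g s t : L1 f -> L1 g -> Ig (fun r => f r - g r) s t = Ig f s t - Ig g s t.
Proof. by move=> f1 g1; rewrite /Ig RintegralB//; exact: Sitv. Qed.

Lemma IgN f s t : L1 f -> Ig (fun r => - f r) s t = - Ig f s t.
Proof.
move=> f1; have := IgZ (-1) s t f1; rewrite mulN1r => <-; congr Ig.
by apply/funext => r; rewrite mulN1r.
Qed.

Lemma Ig_le f g s t : L1 f -> L1 g ->
  (forall r, s <= r <= t -> f r <= g r) -> Ig f s t <= Ig g s t.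
Proof.
move=> f1 g1 fg; apply: le_Rintegral; [by []|exact: Sitv|exact: Sitv|].
by move=> r /=; rewrite in_itv/= => /fg.
Qed.

Lemma eq_Ig f g s t : (forall r, s <= r <= t -> f r = g r) -> Ig f s t = Ig g s t.
Proof. by move=> fg; apply: eq_Rintegral => r; rewrite inE/= in_itv/= => /fg. Qed.

Lemma Ig_ge0 f s t : (forall r, 0 <= f r) -> 0 <= Ig f s t.
Proof. by move=> f0; apply: Rintegral_ge0. Qed.

Lemma Ig_norm f s t : L1 f -> `|Ig f s t| <= Ig (fun r => `|f r|) s t.
Proof. by move=> f1; apply: le_normr_Rintegral => //; exact: Sitv. Qed.

Lemma Ig_ge f s t : t < s -> Ig f s t = 0.
Proof.
move=> ts; rewrite /Ig set_itv_ge ?Rintegral_set0//.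
by rewrite bnd_simp -ltNge.
Qed.

Let leb_set1 s : leb [set s] = 0%E.
Proof. by rewrite lebE lebesgue_measure_set1. Qed.

Lemma Ig_oc f s t : L1 f ->
  \int[leb]_(r in (`]s, t]%classic : set (LebT R))) f r = Ig f s t.
Proof.
move=> f1; have [st|ts] := leP s t; last first.
  by rewrite Ig_ge// set_itv_ge ?Rintegral_set0// bnd_simp -leNgt ltW.
have E : (`[s, t]%classic : set (LebT R)) `\` [set s] = `]s, t]%classic.
  by rewrite setDitv1l.
rewrite /Ig /Rintegral; congr fine; rewrite -E; apply/esym.
apply: negligible_integral => //.
- by apply: (@measurable_LebT _ [set s]); exact: measurable_set1.
- exact: Sitv.
- exact: leb_set1.
Qed.

Lemma Ig_split f s r t : L1 f -> s <= r <= t -> Ig f s t = Ig f s r + Ig f r t.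
Proof.
move=> f1 /andP[sr rt]; rewrite -(Ig_oc r t f1) /Ig.
have E : (`[s, t]%classic : set (LebT R)) = `[s, r] `|` `]r, t].
  by rewrite -itv_bndbnd_setU//= bnd_simp.
rewrite E Rintegral_setU//.
- by apply: measurable_LebT; exact: measurable_itv.
- by rewrite -E; exact: Sitv.
- by apply/disj_setPS => y [/=]; rewrite !in_itv/= => /andP[_ yr] /andP[]; rewrite ltNge yr.
Qed.

Lemma Igss f s : L1 f -> Ig f s s = 0.
Proof.
move=> f1; have := @Ig_split f s s s f1; rewrite !lexx => /(_ isT); lra.
Qed.

(* Absolute continuity of the integral; only the length of the interval matters. *)
Lemma Ig_small f (e : R) : L1 f -> 0 < e -> exists2 d : R, 0 < d &
  forall s t, s <= t -> t - s < d -> Ig (fun r => `|f r|) s t < e.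
Proof.
move=> f1 e0; have [d [d0 H]] := integral_normr_continuous f1 e0.
exists d => // s t st tsd; apply: H => //.
have h : (leb `[s, t]%classic < d%:E)%E by rewrite leb_itv// lte_fin.
exact: h.
Qed.

Definition primitive f t : R :=
  \int[leb]_(r in (`]-oo, t]%classic : set (LebT R))) f r.

Lemma primitiveB f s t : L1 f -> s <= t ->
  primitive f t - primitive f s = Ig f s t.
Proof.
move=> f1 st; rewrite /primitive -(Ig_oc s t f1).
have E : (`]-oo, t]%classic : set (LebT R)) = `]-oo, s] `|` `]s, t].
  by rewrite -itv_bndbnd_setU.
have mNy r : measurable (`]-oo, r]%classic : set (LebT R)).
  by apply: measurable_LebT; exact: measurable_itv.
rewrite E Rintegral_setU//.
- by rewrite addrC addKr.
- by apply: measurable_LebT; exact: measurable_itv.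
- by rewrite -E; apply: integrableS f1.
- by apply/disj_setPS => y [/=]; rewrite !in_itv/= => ys /andP[]; rewrite ltNge ys.
Qed.

Lemma primitive_small f (e : R) : L1 f -> 0 < e -> exists2 d : R, 0 < d &
  forall s t, `|t - s| < d -> `|primitive f t - primitive f s| < e.
Proof.
move=> f1 e0; have [d d0 H] := Ig_small f1 e0; exists d => // s t.
wlog st : s t / s <= t => [wlg|].
  have [/wlg//|/ltW ts] := leP s t; rewrite distrC => /(wlg _ _ ts).
  by rewrite distrC.
rewrite ger0_norm ?subr_ge0// => tsd; rewrite primitiveB//.
by apply: le_lt_trans (Ig_norm _ _ f1) _; exact: H.
Qed.

Lemma continuous_primitive f : L1 f -> continuous (primitive f).
Proof.
move=> f1 t; apply/(@cvgrPdist_lt _ R^o) => e e0.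
have [d d0 H] := primitive_small f1 e0.
near=> s; apply: H; near: s.
exact: (@cvgr_dist_lt _ R^o _ (nbhs t) _ id t).
Unshelve. all: by end_near. Qed.

Lemma primitive_nondecreasing f : L1 f -> (forall t, 0 <= f t) ->
  {homo primitive f : s t / s <= t}.
Proof.
by move=> f1 f0 s t st; rewrite -subr_ge0 primitiveB//; exact: Ig_ge0.
Qed.

Lemma Ig_le_ae f g s t : L1 f -> L1 g ->
  {ae leb, forall r : LebT R, s <= r <= t -> f r <= g r} -> Ig f s t <= Ig g s t.
Proof.
move=> f1 g1 [N [mN N0 fgN]].
have mD : measurable ((`[s, t]%classic : set (LebT R)) `\` N) by exact: measurableD.
have E h : L1 h -> Ig h s t = \int[leb]_(r in `[s, t]%classic `\` N) h r.
  move=> h1; rewrite /Ig /Rintegral; congr fine.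
  by apply: negligible_integral => //; exact: Sitv.
rewrite !E//; apply: le_Rintegral => //; [exact: integrableS f1|exact: integrableS g1|].
move=> r [/=]; rewrite in_itv/= => sr Nr; apply: contrapT => fg; apply: Nr.
by apply: fgN => /= h; apply: fg; exact: h.
Qed.

End IntegralOnIntervals.

(** * Densities *)

Section Differentiation.
Context {R : realType}.
Local Notation lam := (@lebesgue_measure R).
Local Notation leb := (@leb R).
Local Notation BR := (measurableTypeR R).
Implicit Types (f g x : R -> R) (s t r : R).

Lemma ae_S (P Q : R -> Prop) : {ae leb, forall t : LebT R, P t} ->
  (forall t, P t -> Q t) -> {ae leb, forall t : LebT R, Q t}.
Proof.
move=> [N [mN N0 PN]] PQ; exists N; split => // t /= Qt; apply: PN => /= Pt.
by apply: Qt; exact: PQ.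
Qed.

Lemma ae_I (P Q : R -> Prop) : {ae leb, forall t : LebT R, P t} ->
  {ae leb, forall t : LebT R, Q t} -> {ae leb, forall t : LebT R, P t /\ Q t}.
Proof.
move=> aeP aeQ.
have [N [mN N0 PN]] : leb.-negligible (~` (P : set (LebT R)) `|` ~` (Q : set (LebT R))).
  exact: negligibleU.
exists N; split => // t /= nPQ; apply: PN; apply: contrapT.
by move=> /not_orP[/contrapT Pt /contrapT Qt]; apply: nPQ.
Qed.

Lemma ae_S2 (P Q U : R -> Prop) : {ae leb, forall t : LebT R, P t} ->
  {ae leb, forall t : LebT R, Q t} -> (forall t, P t -> Q t -> U t) ->
  {ae leb, forall t : LebT R, U t}.
Proof. by move=> aeP aeQ PQU; apply: (ae_S (ae_I aeP aeQ)) => t []; exact: PQU. Qed.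

Lemma ae_neq (a : R) : {ae leb, forall t : LebT R, t != a}.
Proof.
exists [set a]; split; first by apply: measurable_LebT; exact: measurable_set1.
  by rewrite lebE lebesgue_measure_set1.
by move=> t /= /negP; rewrite negbK => /eqP.
Qed.

Lemma L1_borel f : L1 f -> exists g : BR -> R, exists M : set BR,
  [/\ measurable M, lam M = 0%E,
      lam.-integrable setT (EFin \o g), (forall t, ~ M t -> g t = f t) &
      (forall t, 0 <= f t) -> forall t, 0 <= g t].
Proof.
move=> f1; have [M [mM M0 mg]] := borel_modification (L1_measurable f1).
exists (f \_ (~` M)), M; split => //.
- apply/(integrable_LebT measurableT mg).
  have mM' : measurable (M : set (LebT R)) by exact: measurable_LebT.
  have M0' : leb M = 0%E by exact: M0.
  apply/(negligible_integrable mM' measurableT _ M0').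
    by apply/measurable_EFinP; exact: measurable_fun_LebT.
  have := integrableS measurableT (measurableD measurableT mM') (@subsetT _ _) f1.
  apply: eq_integrable; first exact: measurableD.
  by move=> t; rewrite inE => -[_ Mt] /=; rewrite patchE mem_set.
- by move=> t Mt; rewrite patchE mem_set.
- by move=> f0 t; rewrite patchE; case: ifP.
Qed.

Lemma Rintegral_LebT f (g : BR -> R) (M D : set BR) : L1 f ->
  measurable M -> lam M = 0%E -> measurable D -> lam.-integrable setT (EFin \o g) ->
  (forall t, ~ M t -> g t = f t) ->
  \int[leb]_(t in (D : set (LebT R))) f t = \int[lam]_(t in D) g t.
Proof.
move=> f1 mM M0 mD g1 gf; rewrite /Rintegral; congr fine.
have mM' : measurable (M : set (LebT R)) by exact: measurable_LebT.
have mD' : measurable (D : set (LebT R)) by exact: measurable_LebT.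
have mg : measurable_fun setT g by case/integrableP : g1 => /measurable_EFinP.
have mgD : measurable_fun D (EFin \o g).
  by apply/measurable_EFinP; exact: measurable_funTS.
rewrite -integral_LebT//.
have g1' : leb.-integrable (setT : set (LebT R)) (EFin \o g).
  exact/(integrable_LebT measurableT mg).
have M0' : leb M = 0%E by exact: M0.
rewrite (negligible_integral mM' mD' _ M0'); last exact: integrableS f1.
rewrite [RHS](negligible_integral mM' mD' _ M0'); last exact: integrableS g1'.
by apply: eq_integral => t; rewrite inE => -[_ Mt]; rewrite gf.
Qed.

Lemma ae_derivable_primitive f : L1 f ->
  {ae leb, forall t : LebT R, derivable (primitive f) t 1 /\ 'D_1 (primitive f) t = f t}.
Proof.
move=> f1; have [g [M [mM M0 g1 gf _]]] := L1_borel f1.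
have PE : primitive f = fun t => \int[lam]_(r in `]-oo, t]) g r.
  by apply/funext => t; apply: (Rintegral_LebT f1 mM M0 _ g1 gf); exact: measurable_itv.
have lg : locally_integrable [set: R] g.
  by apply: open_integrable_locally => //; exact: openT.
have gy y : lam.-integrable `]-oo, y] (EFin \o g).
  by apply: integrableS g1 => //; exact: measurable_itv.
have := FTC1Ny gy lg.
rewrite -PE => /ae_LebT dP.
have aeM : {ae leb, forall t : LebT R, ~ M t}.
  by apply: (@ae_LebT _ (fun t => ~ M t)); exists M; split => // t /= /contrapT.
apply: (ae_S2 aeM dP) => t Mt [df dfE]; split => //.
by rewrite -derive1E dfE gf.
Qed.

End Differentiation.

Section Density.
Context {R : realType}.
Local Notation lam := (@lebesgue_measure R).
Local Notation leb := (@leb R).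
Local Notation BR := (measurableTypeR R).

(** The two proofs are arguments of the identity so that a cumulative structure can be attached to
    the term; [density_measure] and [finite_stieltjes] carry their hypotheses for the same
    reason. *)
Definition cumul (F : R -> R) (nd : {homo F : s t / s <= t}) (cF : continuous F) := F.

HB.instance Definition _ F nd cF := isCumulative.Build R _ R (@cumul F nd cF)
  nd (right_continuousW cF).

Definition stieltjes F nd cF : {measure set BR -> \bar R} :=
  lebesgue_stieltjes_measure (@cumul F nd cF : cumulative R R).

Lemma stieltjes_itv F nd cF s t : s <= t ->
  @stieltjes F nd cF `]s, t]%classic = (F t - F s)%:E.
Proof.
move=> st; rewrite /stieltjes/= /lebesgue_stieltjes_measure/= /measure_extension/=.
rewrite measurable_mu_extE/=; last exact: is_ocitv.
by rewrite wlength_itv_bnd.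
Qed.

Lemma stieltjes_eq (m : {measure set BR -> \bar R}) F nd cF :
  (forall s t, s <= t -> m `]s, t]%classic = (F t - F s)%:E) ->
  forall A, measurable A -> @stieltjes F nd cF A = m A.
Proof.
move=> mF A mA; apply: lebesgue_stieltjes_measure_unique => // X [[s t] _ <-]/=.
have [st|ts] := leP s t; last first.
  by rewrite set_itv_ge ?measure0// bnd_simp -leNgt ltW.
by rewrite mF//; exact: stieltjes_itv.
Qed.

Definition density_measure (h : BR -> \bar R) (mh : measurable_fun setT h)
  (h0 : forall t, (0 <= h t)%E) : set BR -> \bar R :=
  fun A => (\int[lam]_(t in A) h t)%E.

Section DensityMeasure.
Variables (h : BR -> \bar R).
Hypotheses (mh : measurable_fun setT h) (h0 : forall t, (0 <= h t)%E).

Let dm0 : density_measure mh h0 set0 = 0%E.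
Proof. by rewrite /density_measure integral_set0. Qed.

Let dm_ge0 A : (0 <= density_measure mh h0 A)%E.
Proof. by apply: integral_ge0. Qed.

HB.instance Definition _ := isMeasure.Build _ _ _ (density_measure mh h0) dm0 dm_ge0
  (semi_sigma_additive_nng_induced mh h0).

End DensityMeasure.

Definition finite_stieltjes F nd cF (fin : (@stieltjes F nd cF setT < +oo)%E) :
  set BR -> \bar R := @stieltjes F nd cF.

Section FiniteStieltjes.
Variables (F : R -> R) (nd : {homo F : s t / s <= t}) (cF : continuous F).
Hypothesis fin : (@stieltjes F nd cF setT < +oo)%E.

HB.instance Definition _ := Measure.on (finite_stieltjes fin).

Let finA : fin_num_fun (finite_stieltjes fin).
Proof.
move=> A mA; rewrite ge0_fin_numE//.
by apply: le_lt_trans fin; apply: le_measure; rewrite ?inE.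
Qed.

HB.instance Definition _ := Measure_isFinite.Build _ _ _ (finite_stieltjes fin) finA.

End FiniteStieltjes.

(** With G a primitive of [gam], both G + x and G - x are nondecreasing, and their Stieltjes
    measures add up to that of 2 G, which has a density. The measure of G + x is therefore finite
    and absolutely continuous; its Radon-Nikodym density minus [gam] is the density of [x]. *)
Lemma lipschitz_density (gam x : R -> R) : L1 gam -> (forall t, 0 <= gam t) ->
  (forall s t, s <= t -> `|x t - x s| <= Ig gam s t) ->
  exists2 rho, L1 rho & forall s t, s <= t -> x t - x s = Ig rho s t.
Proof.
move=> gam1 gam0 xgam.
pose G := primitive gam.
have cG : continuous G by exact: continuous_primitive.
have cx : continuous x.
  move=> t; apply/(@cvgrPdist_lt _ R^o) => e e0.
  have [d d0 H] := Ig_small gam1 e0.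
  near=> s.
  have st : `|t - s| < d.
    by near: s; exact: (@cvgr_dist_lt _ R^o _ (nbhs t) _ id t).
  have gE a b : Ig gam a b = Ig (fun r => `|gam r|) a b.
    by apply: eq_Ig => r _; rewrite ger0_norm.
  have [ts|/ltW ts] := leP s t.
    apply: le_lt_trans (xgam _ _ ts) _; rewrite gE; apply: H => //.
    exact: le_lt_trans (ler_norm _) st.
  rewrite distrC; apply: le_lt_trans (xgam _ _ ts) _; rewrite gE; apply: H => //.
  by apply: le_lt_trans (ler_norm _) _; rewrite distrC.
pose Fp t := G t + x t; pose Fm t := G t - x t; pose F2 t := 2 * G t.
have ndp : {homo Fp : s t / s <= t}.
  move=> s t st; have := xgam s t st; rewrite -primitiveB// -/G ler_norml /Fp; lra.
have ndm : {homo Fm : s t / s <= t}.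
  move=> s t st; have := xgam s t st; rewrite -primitiveB// -/G ler_norml /Fm; lra.
have nd2 : {homo F2 : s t / s <= t}.
  by move=> s t st; have := ndp s t st; have := ndm s t st; rewrite /Fp /Fm /F2; lra.
have cp : continuous Fp by move=> t; exact: cvgD (cG t) (cx t).
have cm : continuous Fm by move=> t; exact: cvgB (cG t) (cx t).
have c2 : continuous F2.
  by move=> t; apply: (@continuousM _ _ (fun=> 2) G t); [exact: cvg_cst|exact: cG].
have [g [M [mM M0 g1 gf /(_ gam0) g0]]] := L1_borel gam1.
pose h (t : BR) := (2 * g t)%:E.
have h1 : lam.-integrable setT h := integrableZl measurableT 2 g1.
have mh : measurable_fun setT h by case/integrableP : h1.
have h0 t : (0 <= h t)%E by rewrite lee_fin mulr_ge0.
have Eg s t : s <= t -> \int[lam]_(r in `]s, t]) g r = Ig gam s t.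
  move=> st; rewrite -(Ig_oc s t gam1); apply/esym.
  by apply: (Rintegral_LebT gam1 mM M0 _ g1 gf); exact: measurable_itv.
have nu2 A : measurable A -> @stieltjes F2 nd2 c2 A = density_measure mh h0 A.
  apply: (@stieltjes_eq (density_measure mh h0 : measure _ _)) => s t st.
  have mst : measurable (`]s, t]%classic : set BR) by exact: measurable_itv.
  have g1st : lam.-integrable (`]s, t]%classic : set BR) (EFin \o g).
    exact: integrableS g1.
  have -> : F2 t - F2 s = \int[lam]_(r in `]s, t]) (2 * g r).
    by rewrite RintegralZl// Eg// -primitiveB// /F2 /G; ring.
  rewrite /= /density_measure /Rintegral fineK//.
  by apply: integrable_fin_num => //; exact: integrableS h1.
pose mup := @stieltjes Fp ndp cp; pose mum := @stieltjes Fm ndm cm.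
have nus A : measurable A -> @stieltjes F2 nd2 c2 A = (mup A + mum A)%E.
  move=> mA; rewrite -measure_addE.
  apply: (@stieltjes_eq (measure_add mup mum)) => // s t st.
  rewrite [LHS]measure_addE !stieltjes_itv// -EFinD; congr EFin.
  by rewrite /F2 /Fp /Fm; ring.
have mup_le A : measurable A -> (mup A <= density_measure mh h0 A)%E.
  by move=> mA; rewrite -nu2// nus// leeDl.
have fin : (mup setT < +oo)%E.
  apply: le_lt_trans (mup_le _ measurableT) _.
  have := integrable_fin_num measurableT h1.
  by rewrite ge0_fin_numE//; apply: integral_ge0.
pose nu : {finite_measure set BR -> \bar R} := finite_stieltjes fin.
have nulam : nu `<< lam.
  apply/null_content_dominatesP => A mA A0; apply/eqP.
  rewrite eq_le measure_ge0 andbT; apply: le_trans (mup_le _ mA) _.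
  by rewrite /density_measure (null_set_integral mA (measurable_funTS mh) A0).
have rho_int := Radon_Nikodym_SigmaFinite.f_integral nulam.
have rho1 := Radon_Nikodym_SigmaFinite.f_integrable nulam.
have rho_fin := Radon_Nikodym_SigmaFinite.f_fin_num nulam.
set rhoE := Radon_Nikodym_SigmaFinite.f nu lam in rho_int rho1 rho_fin.
pose rhop (t : BR) := fine (rhoE t).
have rhopE : EFin \o rhop = rhoE by apply/funext => t; rewrite /= /rhop fineK.
have rhop1 : L1 rhop.
  apply/(integrable_LebT measurableT).
    by apply: measurableT_comp => //; case/integrableP: rho1.
  by rewrite rhopE.
exists (fun t => rhop t - gam t); first exact: L1B.
move=> s t st; rewrite IgB// -(Ig_oc s t rhop1).
have mst : measurable (`]s, t]%classic : set BR) by exact: measurable_itv.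
have -> : \int[leb]_(r in (`]s, t]%classic : set (LebT R))) rhop r = Fp t - Fp s.
  rewrite /Rintegral integral_LebT//; last first.
    apply: measurable_funTS; rewrite -[X in measurable_fun _ X]/(EFin \o rhop) rhopE.
    by case/integrableP: rho1.
  rewrite -[X in (\int[lam]_(r in _) X r)%E]/(EFin \o rhop) rhopE -rho_int//.
  by rewrite [X in fine X](stieltjes_itv ndp cp st).
rewrite -primitiveB// /Fp /G; ring.
Unshelve. all: by end_near. Qed.

End Density.

(** * Absolutely continuous functions *)

Section AbsoluteContinuity.
Context {R : realType}.
Local Notation lam := (@lebesgue_measure R).
Local Notation leb := (@leb R).
Local Notation BR := (measurableTypeR R).
Implicit Types (a b s t : R) (F om : R -> R) (u v : nat -> R).

(* Finite families of non-overlapping intervals [u k, v k] for k < N, indexed by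
   nat rather than 'I_N so that a family can be extended by one interval. *)
Definition nonoverlapping a b (N : nat) u v :=
  (forall k, (k < N)%N -> a <= u k /\ u k <= v k /\ v k <= b) /\
  (forall k j, (k < N)%N -> (j < N)%N -> k != j -> v k <= u j \/ v j <= u k).

Definition ac_on a b F := forall eps : R, 0 < eps -> exists2 delta : R, 0 < delta &
  forall N u v, nonoverlapping a b N u v -> \sum_(k < N) (v k - u k) < delta ->
  \sum_(k < N) `|F (v k) - F (u k)| < eps.

Lemma nonoverlapping_trivIset a b N u v : nonoverlapping a b N u v ->
  trivIset [set: 'I_N] (fun k : 'I_N => `]u k, v k]%classic).
Proof.
move=> [uv dj] k j _ _ [y [/=]]; rewrite !in_itv/= => /andP[uy yv] /andP[uy' yv'].
apply/val_inj/eqP; apply: contrapT => /negP kj.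
have [h|h] := dj _ _ (ltn_ord k) (ltn_ord j) kj.
- by have := lt_le_trans uy' yv; rewrite ltNge h.
- by have := lt_le_trans uy yv'; rewrite ltNge h.
Qed.

Lemma nonoverlapping_measure a b N u v : nonoverlapping a b N u v ->
  (lam (\big[setU/set0]_(k < N) `]u k, v k]%classic) = (\sum_(k < N) (v k - u k))%:E)%E.
Proof.
move=> uv; rewrite measure_bigsetU_ord//=.
- rewrite -sumEFin; apply: eq_bigr => k _; have [+ _] := uv => /(_ k (ltn_ord k))[_ [uvk _]].
  rewrite lebesgue_measure_itv/= lte_fin; move: uvk; rewrite le_eqVlt => /predU1P[->|->].
    by rewrite ltxx subrr.
  by rewrite EFinD.
- exact: nonoverlapping_trivIset uv.
Qed.

Lemma lipschitz_ac gam a b F : L1 gam -> (forall t, 0 <= gam t) ->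
  (forall s t, a <= s -> s <= t -> t <= b -> `|F t - F s| <= Ig gam s t) -> ac_on a b F.
Proof.
move=> gam1 gam0 FG eps e0.
have [d [d0 H]] := integral_normr_continuous gam1 e0.
exists d => // N u v uv uvd.
have mU : measurable (\big[setU/set0]_(k < N) `]u k, v k]%classic : set (LebT R)).
  by apply: bigsetU_measurable => k _; apply: measurable_LebT; exact: measurable_itv.
apply: le_lt_trans (H _ mU _); last first.
  have : (leb (\big[setU/set0]_(k < N) `]u k, v k]%classic) < d%:E)%E.
    by rewrite lebE (nonoverlapping_measure uv) lte_fin.
  exact.
rewrite {mU}/Rintegral integral_bigsetU_EFin//=; last 4 first.
- by move=> k; apply: measurable_LebT; exact: measurable_itv.
- exact: index_enum_uniq.
- by have := nonoverlapping_trivIset uv; apply: sub_trivIset.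
- by apply: measurable_funTS; apply/measurable_EFinP; apply: L1_measurable; exact: L1_norm.
have Ek (k : 'I_N) : (\int[leb]_(r in (`]u k, v k]%classic : set (LebT R))) (`|gam r|)%:E)%E =
    (Ig gam (u k) (v k))%:E.
  rewrite -(Ig_oc _ _ gam1) /Rintegral fineK; last first.
    have muv : measurable (`]u k, v k]%classic : set (LebT R)).
      by apply: measurable_LebT; exact: measurable_itv.
    by apply: integrable_fin_num => //; apply: integrableS gam1.
  by apply: eq_integral => r _; rewrite ger0_norm.
under [X in fine X]eq_bigr do rewrite Ek.
rewrite sumEFin/=; apply: ler_sum => k _.
by have [/(_ k (ltn_ord k))[auk [uvk vbk]] _] := uv; exact: FG.
Qed.

(* A continuous-induction argument: on the exceptional null set, the growth of [F]
   is charged to its variation over a small open neighbourhood of that set. *)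
Lemma ac_le_nondecreasing a b F om : a <= b -> ac_on a b F ->
  (forall s t, a <= s -> s <= t -> t <= b -> om s <= om t) ->
  {ae leb, forall t : LebT R, a <= t < b -> forall eps : R, 0 < eps ->
     exists2 d : R, 0 < d & forall s, t < s -> s < t + d -> s <= b ->
       F s - F t <= om s - om t + eps * (s - t)} ->
  F b - F a <= om b - om a.
Proof.
move=> ab acF omnd ae_incr.
(* The term [e * (b - a)] is the error at points where the differential inequality holds; the last
   [e] is the variation of [F] near the exceptional null set. *)
suff key (e : R) : 0 < e -> F b - F a <= om b - om a + e * (b - a) + e.
  apply/ler_addgt0Pr => e e0; have ba0 : 0 < b - a + 1 by rewrite ltr_wpDl ?subr_ge0.
  have := key (e / (b - a + 1)) (divr_gt0 e0 ba0).
  have : e / (b - a + 1) * (b - a) + e / (b - a + 1) = e by field; rewrite lt0r_neq0.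
  lra.
move=> e0; have [d d0 acd] := acF e e0.
have [M [mM M0 NM]] := negligible_LebT ae_incr.
have Mfin : (lam M < +oo)%E by rewrite M0 ltry.
have [G [oG MG GM]] : exists U : set R, [/\ open U, M `<=` U & (lam (U `\` M) < d%:E)%E].
  exact: lebesgue_regularity_outer mM Mfin d0.
have mG : measurable G by exact: open_measurable.
have Gd : (lam G < d%:E)%E.
  apply: le_lt_trans GM.
  rewrite -[X in (lam X <= _)%E](setDUK MG).
  apply: (le_trans (@measureU2 _ _ _ lam _ _ mM (measurableD mG mM))).
  have M0' : (lam M <= 0)%E by rewrite M0.
  by rewrite -[leRHS]add0e; apply: leeD.
pose fam (t c : R) : Prop := exists N u v, [/\ nonoverlapping a t N u v,
  (forall k, (k < N)%N -> `[u k, v k] `<=` G) &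
  c = \sum_(k < N) `|F (v k) - F (u k)|].
have fam_lt (t c : R) : t <= b -> fam t c -> c < e.
  move=> tb [N [u [v [[uv1 uv2] uvG ->]]]]; apply: acd.
    split => // k kN; have [auk [uvk vkt]] := uv1 k kN; do 2 split => //.
    exact: le_trans vkt tb.
  rewrite -lte_fin -(nonoverlapping_measure (conj uv1 uv2)).
  apply: le_lt_trans Gd; apply: le_measure; rewrite ?inE//.
    by apply: bigsetU_measurable => k _; exact: measurable_itv.
  apply: (@big_ind _ (fun A => A `<=` G)) => // [A B AG BG|k _].
    by move=> y [/AG|/BG].
  move=> y; rewrite /= in_itv/= => /andP[uy yv].
  by apply: (uvG k (ltn_ord k)); rewrite /= in_itv/= (ltW uy).
have fam0 t : fam t 0.
  exists 0%N, (fun=> 0), (fun=> 0); split => //; last by rewrite big_ord0.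
(* [phi t] is the variation of [F] over the part of [a, t] inside [G]; it is at most [e] because [G]
   has measure less than the [d] of absolute continuity. *)
pose phi t := sup [set c | fam t c].
have phis t : t <= b -> has_sup [set c | fam t c].
  by move=> tb; split; [exists 0; exact: fam0|exists e => c /(fam_lt _ _ tb)/ltW].
have phi_ub (t c : R) : t <= b -> fam t c -> c <= phi t.
  by move=> tb tc; apply: ub_le_sup => //; exact: (phis t tb).2.
have phi_le (t c : R) : t <= b -> (forall c', fam t c' -> c' <= c) -> phi t <= c.
  by move=> tb tc; apply: ge_sup; [exact: (phis t tb).1|exact: tc].
have phi_e t : t <= b -> phi t <= e.
  by move=> tb; apply: phi_le => // c /(fam_lt _ _ tb)/ltW.
have phi_nd s t : s <= t -> t <= b -> phi s <= phi t.
  move=> st tb; apply: phi_le; first exact: le_trans tb.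
  move=> c [N [u [v [[uv1 uv2] uvG ->]]]]; apply: phi_ub => //.
  exists N, u, v; split => //; split => // k kN.
  have [auk [uvk vkt]] := uv1 k kN; do 2 split => //.
  exact: le_trans vkt st.
have phi_add s t : a <= s -> s <= t -> t <= b -> `[s, t] `<=` G ->
    phi s + `|F t - F s| <= phi t.
  move=> as_ st tb stG; rewrite -lerBrDr; apply: phi_le; first exact: le_trans tb.
  move=> c [N [u [v [[uv1 uv2] uvG ->]]]]; rewrite lerBrDr; apply: phi_ub => //.
  exists N.+1, (fun k => if (k < N)%N then u k else s), (fun k => if (k < N)%N then v k else t).
  split; last first.
  - rewrite big_ord_recr/= ltnn; congr (_ + _); apply: eq_bigr => k _.
    by rewrite (ltn_ord k).
  - by move=> k; rewrite ltnS leq_eqVlt => /predU1P[->|kN]; rewrite ?ltnn ?kN//; exact: uvG.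
  split.
    move=> k; rewrite ltnS leq_eqVlt => /predU1P[->|kN]; rewrite ?ltnn ?kN//.
    have [auk [uvk vkt]] := uv1 k kN; do 2 split => //.
    exact: le_trans vkt st.
  move=> k j; rewrite ltnS (leq_eqVlt k) => /predU1P[->|kN];
    rewrite ltnS (leq_eqVlt j) => /predU1P[->|jN].
  - by rewrite eqxx.
  - by rewrite ltnn jN => _; right; have [_ []] := uv1 j jN.
  - by rewrite ltnn kN => _; left; have [_ []] := uv1 k kN.
  - by rewrite kN jN; exact: uv2.
pose P t := F t - F a <= om t - om a + e * (t - a) + phi t.
pose S := [set t | a <= t <= b /\ P t].
have Sa : S a.
  split; first by rewrite lexx ab.
  by rewrite /P !subrr mulr0 !add0r; apply: phi_ub.
have Sub : has_sup S by split; [exists a|exists b => t [/andP[]]].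
pose ts := sup S.
have ats : a <= ts by apply: ub_le_sup Sa; exact: Sub.2.
have tsb : ts <= b by apply: ge_sup; [exists a|move=> t [/andP[]]].
(* The property passes to the supremum because [F] is continuous, while [om] and [phi], which may
   jump, only increase. *)
have Pts : P ts.
  apply/ler_addgt0Pr => eta eta0.
  have [d' d'0 acd'] := acF eta eta0.
  have [t [/andP[at_ tb] Pt] tst] := sup_adherent d'0 Sub.
  have tts : t <= ts by apply: ub_le_sup; [exact: Sub.2|split; [rewrite at_ tb|]].
  have := acd' 1%N (fun=> t) (fun=> ts); rewrite !big_ord1 => Fts.
  have {}Fts : `|F ts - F t| < eta.
    apply: Fts; last by rewrite -/ts in tst; lra.
    by split => // k j; rewrite !ltnS !leqn0 => /eqP-> /eqP->.
  have := omnd t ts at_ tts tsb; have := phi_nd t ts tts tsb.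
  have : e * (t - a) <= e * (ts - a) by rewrite ler_pM2l// lerD2r.
  by move: Pt Fts; rewrite /P ltr_norml; lra.
suff tsE : ts = b by move: Pts; rewrite /P tsE; have := phi_e b (lexx b); lra.
apply/eqP; rewrite eq_le tsb/= leNgt; apply/negP => tslt.
suff [s [tss sb Ps]] : exists s, [/\ ts < s, s <= b & P s].
  have : s <= ts.
    by apply: ub_le_sup; [exact: Sub.2|split => //; rewrite sb andbT (le_trans ats)// ltW].
  by rewrite leNgt tss.
(* Beyond [ts], the growth of [F] is charged to [phi] if [ts] lies in the open set [G]; otherwise
   [ts] is a good point and the differential inequality applies. *)
have [Gts|nGts] := pselect (G ts).
  have /nbhs_ballP[r /= r0 rG] : nbhs ts G by exact: open_nbhs_nbhs.
  pose s := Num.min b (ts + r / 2).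
  have tss : ts < s by rewrite /s lt_min tslt ltrDl divr_gt0.
  have sb : s <= b by rewrite /s ge_min lexx.
  have sr : s <= ts + r / 2 by rewrite /s ge_min lexx orbT.
  exists s; split => //.
  have := phi_add ts s ats (ltW tss) sb; rewrite -lerBrDl => h.
  have {}h : `|F s - F ts| <= phi s - phi ts.
    apply: h => y /=; rewrite in_itv/= => /andP[tsy ys]; apply: rG.
    by rewrite /ball/= ler0_norm ?subr_le0//; lra.
  have := omnd ts s ats (ltW tss) sb.
  have : e * (ts - a) <= e * (s - a) by rewrite ler_pM2l// lerD2r ltW.
  by move: h Pts; rewrite ler_norml /P; lra.
have : ~ ~ (a <= ts < b -> forall eps : R, 0 < eps ->
     exists2 d : R, 0 < d & forall s, ts < s -> s < ts + d -> s <= b ->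
       F s - F ts <= om s - om ts + eps * (s - ts)).
  by move=> h; apply: nGts; apply: MG; apply: NM => /= /h.
move=> /contrapT; rewrite ats tslt => /(_ isT e e0)[r r0 H].
pose s := Num.min b (ts + r / 2).
have tss : ts < s by rewrite /s lt_min tslt ltrDl divr_gt0.
have sb : s <= b by rewrite /s ge_min lexx.
have sr : s <= ts + r / 2 by rewrite /s ge_min lexx orbT.
exists s; split => //.
have := H s tss _ sb; have := phi_nd ts s (ltW tss) sb.
move: Pts; rewrite /P => h1 h2 h3.
have h4 : s < ts + r by lra.
have := h3 h4; lra.
Qed.

End AbsoluteContinuity.

Section RealLemmas.
Context {R : realType}.
Implicit Types (a b s t : R).

Lemma scaled_le0 a b : (forall lam : R, 0 < lam -> lam * a <= b) -> a <= 0.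
Proof.
move=> h; rewrite leNgt; apply/negP => a0.
have := h ((`|b| + 1) / a); rewrite divfK ?lt0r_neq0// divr_gt0 ?ltr_wpDl//.
by move=> /(_ isT); have := ler_norm b; lra.
Qed.

Lemma cts_within (f : R -> R) (A : set R) : continuous f -> {within A, continuous f}.
Proof. by move=> cf; apply: continuous_subspaceT. Qed.

Lemma cts_near (f : R -> R) t (e : R) : continuous f -> 0 < e ->
  exists2 d : R, 0 < d & forall s, `|s - t| < d -> `|f s - f t| < e.
Proof.
move=> cf e0; have /(@cvgrPdist_lt _ R^o)/(_ e e0)/nbhs_ballP[d /= d0 dH] := cf t.
by exists d => // s st; rewrite distrC; apply: dH; rewrite /ball/= distrC.
Qed.

(** Continuous induction. On an interval where [C] grows by q <= 1/2, the maximum U of [u] satisfies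
    U (1 - q) <= V, where V is the bound already reached; the factor 2 comes from 1 / (1 - q) <= 1 +
    2 q <= exp (2 q). *)
Lemma gronwall (t0 T : R) (u C : R -> R) :
  continuous u -> continuous C -> {homo C : s t / s <= t} -> (forall t, 0 <= u t) ->
  (forall s t M, t0 <= s -> s <= t -> t <= T -> (forall r, s <= r <= t -> u r <= M) ->
     u t <= u s + M * (C t - C s)) ->
  forall t, t0 <= t <= T -> u t <= u t0 * expR (2 * (C t - C t0)).
Proof.
move=> cu cC ndC u0 H t1 /andP[t01 t1T].
pose E t := u t0 * expR (2 * (C t - C t0)).
have cE : continuous E.
  move=> t; apply: (@continuousM _ _ (fun=> u t0) (fun t => expR (2 * (C t - C t0))) t).
    exact: cvg_cst.
  apply: (@continuous_comp _ _ _ (fun t => 2 * (C t - C t0)) (@expR R)).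
    apply: (@continuousM _ _ (fun=> 2) (fun t => C t - C t0) t); first exact: cvg_cst.
    by apply: (@continuousB _ _ _ C (fun=> C t0)); [exact: cC|exact: cvg_cst].
  exact: continuous_expR.
pose S := [set t | t0 <= t <= T /\ forall s, t0 <= s <= t -> u s <= E s].
have St0 : S t0.
  split; first by rewrite lexx (le_trans t01).
  move=> s /andP[h1 h2]; rewrite (_ : s = t0) /E ?subrr ?mulr0 ?expR0 ?mulr1//.
  by apply/eqP; rewrite eq_le h1 h2.
have Sub : has_sup S by split; [exists t0|exists T => t [/andP[]]].
pose ts := sup S.
have t0ts : t0 <= ts by apply: ub_le_sup St0; exact: Sub.2.
have tsT : ts <= T by apply: ge_sup; [exists t0|move=> t [/andP[]]].
have below s : t0 <= s -> s < ts -> u s <= E s.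
  move=> t0s sts; have ts0 : 0 < ts - s by rewrite subr_gt0.
  have [t [_ Ht] st] := sup_adherent ts0 Sub.
  by apply: Ht; rewrite t0s/= ltW//; move: st; rewrite -/ts; lra.
have Sts : u ts <= E ts.
  have [->|neq] := eqVneq ts t0; first by apply: St0.2; rewrite lexx.
  have t0lt : t0 < ts by rewrite lt_def neq.
  rewrite leNgt; apply/negP => Eu; have e0 : 0 < (u ts - E ts) / 2 by lra.
  have [d1 d10 H1] := cts_near ts cu e0; have [d2 d20 H2] := cts_near ts cE e0.
  pose s := Num.max t0 (Num.max (ts - d1 / 2) (ts - d2 / 2)).
  have s0 : t0 <= s by rewrite /s le_max lexx.
  have s1 : ts - d1 / 2 <= s by rewrite /s !le_max lexx orbT.
  have s2 : ts - d2 / 2 <= s by rewrite /s !le_max lexx !orbT.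
  have sts : s < ts by rewrite /s !gt_max t0lt/= !ltrBlDr !ltrDl !divr_gt0.
  have h1 : `|s - ts| < d1 by rewrite ler0_norm; lra.
  have h2 : `|s - ts| < d2 by rewrite ler0_norm; lra.
  have := H1 s h1; have := H2 s h2; have := below s s0 sts.
  by rewrite !ltr_norml; lra.
suff tsE : ts = T.
  have [->|neq] := eqVneq t1 ts; first exact: Sts.
  by apply: below => //; rewrite lt_def eq_sym neq tsE.
apply/eqP; rewrite eq_le tsT/= leNgt; apply/negP => tsltT.
have half0 : 0 < 1 / 2 :> R by [].
have [d d0 Cd] := cts_near ts cC half0.
pose t' := Num.min T (ts + d / 2).
have t'T : t' <= T by rewrite /t' ge_min lexx.
have t'd : t' <= ts + d / 2 by rewrite /t' ge_min lexx orbT.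
have tst' : ts < t' by rewrite /t' lt_min tsltT ltrDl divr_gt0.
suff : S t' by move=> /(ub_le_sup Sub.2); rewrite leNgt -/ts tst'.
split; first by rewrite t'T (le_trans t0ts (ltW tst')).
move=> s /andP[t0s st']; have [sts|tss] := ltP s ts; first exact: below.
have [r rin rmax] := EVT_max tss (cts_within cu).
move: rin; rewrite in_itv/= => /andP[tsr rs].
have k0 : 0 <= C r - C ts by rewrite subr_ge0 ndC.
have k1 : C r - C ts <= 1 / 2.
  have : `|r - ts| < d by rewrite ger0_norm; lra.
  by move=> /Cd; rewrite ltr_norml; lra.
have hr : u r <= u ts + u r * (C r - C ts).
  apply: H => //; first exact: le_trans rs (le_trans st' t'T).
  by move=> q /andP[tsq qr]; apply: rmax; rewrite in_itv/= tsq (le_trans qr).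
have us : u s <= u r by apply: rmax; rewrite in_itv/= tss lexx.
apply: le_trans us _.
have : E ts * expR (2 * (C r - C ts)) <= E s.
  rewrite /E -mulrA -expRD ler_wpM2l// ler_expR.
  by have := ndC r s rs; lra.
apply: le_trans.
have := expR_ge1Dx (2 * (C r - C ts)) => h1.
have h2 : u r * (1 - (C r - C ts)) <= E ts by lra.
have E0 : 0 <= E ts by rewrite /E mulr_ge0// expR_ge0.
have h3 : E ts * (1 + 2 * (C r - C ts)) <= E ts * expR (2 * (C r - C ts)).
  by rewrite ler_wpM2l.
apply: le_trans h3.
move: h2 k0 k1 E0 (u0 r); move: (u r) (E ts) (C r - C ts) => U V q hUV q0 q1 V0 U0.
have q2 : 0 <= 1 + 2 * q by lra.
have q3 : 0 <= 1 - 2 * q by lra.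
have h5 : 0 <= V - U * (1 - q) by lra.
have := mulr_ge0 q2 h5; have := mulr_ge0 U0 (mulr_ge0 q0 q3); lra.
Qed.

End RealLemmas.

Section VectorPaths.
Context {R : realType} {n : nat}.
Local Notation leb := (@leb R).
Implicit Types (y : R -> 'rV[R]_n) (gam : R -> R) (s t a b : R) (p : 'rV[R]_n).

Lemma enorm_le_sum (u : 'rV[R]_n) : enorm u <= \sum_(i < n) `|u ord0 i|.
Proof.
have S0 : 0 <= \sum_(i < n) `|u ord0 i| by apply: sumr_ge0.
apply: enorm_le_dotv => // p; rewrite mulr_suml; apply: ler_sum => i _.
apply: le_trans (ler_norm _) _; rewrite normrM ler_wpM2l//.
exact: normr_coord_le.
Qed.

Lemma L1_sum (I : Type) (r : seq I) (F : I -> R -> R) :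
  (forall i, L1 (F i)) -> L1 (fun t => \sum_(i <- r) F i t) /\
  forall s t, Ig (fun t => \sum_(i <- r) F i t) s t = \sum_(i <- r) Ig (F i) s t.
Proof.
move=> F1; elim: r => [|i r [IH1 IH2]].
  rewrite (_ : (fun t => _) = fun=> 0); last by apply/funext => t; rewrite big_nil.
  split; first exact: integrable0.
  move=> s t; rewrite big_nil.
  by apply: le_anti; rewrite /Ig /Rintegral integral0 lexx.
rewrite (_ : (fun t => _) = fun t => F i t + \sum_(i <- r) F i t); last first.
  by apply/funext => t; rewrite big_cons.
split; first exact: L1D.
by move=> s t; rewrite IgD// IH2 big_cons.
Qed.

Lemma vector_density y gam : L1 gam -> (forall t, 0 <= gam t) ->
  (forall s t, s <= t -> enorm (y t - y s) <= Ig gam s t) ->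
  exists rho : R -> 'rV[R]_n, [/\ forall p, L1 (fun t => dotv (rho t) p),
    forall p s t, s <= t -> dotv (y t - y s) p = Ig (fun r => dotv (rho r) p) s t &
    {ae leb, forall t : LebT R, derivable y t 1 /\ 'D_1 y t = rho t}].
Proof.
move=> gam1 gam0 yg.
have /choice[r rP] : forall i : 'I_n, exists rho : R -> R, L1 rho /\
    forall s t, s <= t -> y t ord0 i - y s ord0 i = Ig rho s t.
  move=> i; have [|rho rho1 rhoE] := @lipschitz_density _ gam (fun t => y t ord0 i) gam1 gam0.
    move=> s t st; apply: le_trans (yg s t st).
    by have := normr_coord_le (y t - y s) i; rewrite !mxE.
  by exists rho.
pose rho t := \row_i r i t.
have dE p : (fun t => dotv (rho t) p) = fun t => \sum_(i < n) p ord0 i * r i t.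
  by apply/funext => t; apply: eq_bigr => i _; rewrite mxE mulrC.
have r1 i : L1 (r i) := (rP i).1.
have r1p p i : L1 (fun t => p ord0 i * r i t) by exact: L1Z.
exists rho; split.
- by move=> p; rewrite dE; apply: (L1_sum _ _).1.
- move=> p s t st; rewrite dE (L1_sum _ (r1p p)).2; apply: eq_bigr => i _.
  by rewrite IgZ// -(rP i).2// !mxE mulrC.
have : {ae leb, forall t : LebT R, forall i : 'I_n,
    derivable (primitive (r i)) t 1 /\ 'D_1 (primitive (r i)) t = r i t}.
  have /(@ae_foralln _ _ _ leb (fun k (t : LebT R) => forall lt : (k < n)%N,
      derivable (primitive (r (Ordinal lt))) t 1 /\
      'D_1 (primitive (r (Ordinal lt))) t = r (Ordinal lt) t)) aeall : forall k : nat,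
     {ae leb, forall t : LebT R, forall lt : (k < n)%N,
      derivable (primitive (r (Ordinal lt))) t 1 /\
      'D_1 (primitive (r (Ordinal lt))) t = r (Ordinal lt) t}.
    move=> k; have [kn|nk] := pselect (is_true (k < n)%N).
      apply: (ae_S (ae_derivable_primitive (r1 (Ordinal kn)))) => t h lt.
      by rewrite (_ : Ordinal lt = Ordinal kn)//; apply: val_inj.
    by apply: (ae_S (ae_derivable_primitive gam1)) => t _ lt.
  apply: (ae_S aeall) => t h i.
  by have := h i (ltn_ord i); rewrite (_ : Ordinal _ = i)//; apply: val_inj.
move=> /ae_S; apply => t h.
have yE i : (fun t => y t ord0 i) = primitive (r i) \+ cst (y 0 ord0 i - primitive (r i) 0).
  apply/funext => s /=; have [s0|/ltW s0] := leP 0 s.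
    by have := (rP i).2 _ _ s0; rewrite -primitiveB//; lra.
  by have := (rP i).2 _ _ s0; rewrite -primitiveB//; lra.
have dy : derivable y t 1.
  apply/derivable_mxP => i j; rewrite (ord1 i) yE.
  by apply: derivableD; [exact: (h j).1|exact: derivable_cst].
split => //; rewrite derive_mx//; apply/rowP => i; rewrite !mxE.
rewrite yE deriveD; [|exact: (h i).1|exact: derivable_cst].
by rewrite derive_cst addr0 (h i).2.
Qed.

Lemma lipschitz_abs_cont y gam a b : L1 gam -> (forall t, 0 <= gam t) ->
  (forall s t, s <= t -> enorm (y t - y s) <= Ig gam s t) -> abs_cont_on a b y.
Proof.
move=> gam1 gam0 yg eps e0.
have Pg r q : r <= q -> `|primitive gam q - primitive gam r| = Ig gam r q.
  by move=> rq; rewrite primitiveB// ger0_norm// Ig_ge0.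
have [|d d0 H] := @lipschitz_ac _ gam a b (primitive gam) gam1 gam0 _ eps e0.
  by move=> r q _ rq _; rewrite Pg.
exists d => // N u v uv dj uvd.
pose ext (f : 'I_N -> R) (k : nat) := oapp f 0 (insub k).
have extE f (k : 'I_N) : ext f k = f k by rewrite /ext valK.
have := H N (ext u) (ext v).
move=> h; apply: (le_lt_trans _ (h _ _)); first 2 last.
- by rewrite (eq_bigr (fun k => v k - u k))// => k _; rewrite !extE.
- apply: ler_sum => k _; have [_ [uvk _]] := uv k.
  by rewrite !extE Pg// yg.
split => [k kN|k j kN jN kj].
  by have := uv (Ordinal kN); rewrite -!extE.
have := dj (Ordinal kN) (Ordinal jN); rewrite -!extE; apply.
by apply: contra kj => /eqP[->].
Qed.

Lemma abs_cont_ac a b y (F : R -> R) : abs_cont_on a b y ->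
  (forall s t, a <= s -> s <= t -> t <= b -> `|F t - F s| <= enorm (y t - y s)) -> ac_on a b F.
Proof.
move=> acy Fy eps e0; have [d d0 H] := acy eps e0; exists d => // N u v [uv dj] uvd.
apply: le_lt_trans (H N (fun k => u k) (fun k => v k) _ _ uvd).
- by apply: ler_sum => k _; have [? [? ?]] := uv k (ltn_ord k); exact: Fy.
- by move=> k; exact: uv.
- by move=> k j kj; apply: dj.
Qed.

End VectorPaths.

(** * Arcs *)

(** The assumptions of the theorem in the form used below: valid at all times and, for [k], for
    every real radius. [tame_truncation] provides them. *)
Record tame_hamiltonian {R : realType} {n : nat} (H : R -> 'rV[R]_n -> 'rV[R]_n -> R)
    (c : R -> R) (k : R -> R -> R) : Prop := TameHamiltonian {
  tame_measurable : forall x p,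
    measurable_fun (setT : set (LebT R)) (fun t : LebT R => H t x p);
  tame_convex : forall t x, convexf (H t x);
  tame_c_ge0 : forall t, 0 <= c t;
  tame_c_L1 : L1 c;
  tame_lip_p : forall t x p q,
    `|H t x p - H t x q| <= c t * (1 + enorm x) * enorm (p - q);
  tame_k_ge0 : forall r t, 0 <= k r t;
  tame_k_L1 : forall r, L1 (k r);
  tame_lip_x : forall r t x y p, enorm x <= r -> enorm y <= r ->
    `|H t x p - H t y p| <= k r t * (1 + enorm p) * enorm (x - y);
  tame_0 : L1 (fun t => H t 0 0) }.

Section Tame.
Context {R : realType} {n : nat} {H : R -> 'rV[R]_n -> 'rV[R]_n -> R}.
Context {c : R -> R} {k : R -> R -> R} (tame : tame_hamiltonian H c k).
Local Notation leb := (@leb R).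
Implicit Types (x y : R -> 'rV[R]_n) (p q : 'rV[R]_n) (s t r : R).

(** Rounding the time inside [x] down to a grid leaves countably many frozen states, each giving a
    measurable function; the Lipschitz bound in the state makes the rounded functions converge. *)
Lemma tame_measurable_comp x p : continuous x ->
  measurable_fun (setT : set (LebT R)) (fun t : LebT R => H t (x t) p).
Proof.
move=> cx.
pose fl (m : nat) t : R := (Num.floor (m.+1%:R * t))%:~R / m.+1%:R.
pose h (m : nat) (t : LebT R) : R := H t (x (fl m t)) p.
have [u uK] : exists u : nat -> option int, forall j, exists i, u i = Some j.
  by exists unpickle => j; exists (pickle j); exact: pickleK.
have mfl (m : nat) (j : int) :
    measurable ([set t | Num.floor (m.+1%:R * t) = j] : set (LebT R)).
  rewrite (_ : [set t | _] = `[j%:~R / m.+1%:R, (j + 1)%:~R / m.+1%:R[%classic).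
    by apply: measurable_LebT; exact: measurable_itv.
  apply/seteqP; split => t /=; rewrite in_itv/= ler_pdivrMr// ltr_pdivlMr// (mulrC t).
    by move=> <-; exact: floor_itv.
  by move=> h1; exact: floor_def.
have mh m : measurable_fun (setT : set (LebT R)) (h m).
  move=> _ B mB; rewrite setTI.
  pose A (i : nat) : set (LebT R) := if u i is Some j then
    [set t | Num.floor (m.+1%:R * t) = j] `&`
    (fun t : LebT R => H t (x (j%:~R / m.+1%:R)) p) @^-1` B else set0.
  have -> : h m @^-1` B = \bigcup_i A i.
    apply/seteqP; split => t.
      move=> hB; have [i ui] := uK (Num.floor (m.+1%:R * t)).
      by exists i => //; rewrite /A ui.
    by move=> [i _]; rewrite /A; case: (u i) => // j [/= jt]; rewrite /h /fl jt.
  apply: bigcupT_measurable => i; rewrite /A; case: (u i) => [j|]; last exact: measurable0.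
  apply: measurableI; first exact: mfl.
  by have := tame_measurable tame (x (j%:~R / m.+1%:R)) p measurableT mB; rewrite setTI.
apply: (measurable_fun_cvg mh) => t _.
have k0 := tame_k_ge0 tame.
pose r := enorm (x t) + 1.
apply/(@cvgrPdist_lt _ R^o) => e e0.
pose K := k r t * (1 + enorm p) + 1.
have K0 : 0 < K by rewrite ltr_wpDl// mulr_ge0 ?addr_ge0 ?enorm_ge0.
pose e' := Num.min 1 (e / K).
have e'0 : 0 < e' by rewrite lt_min ltr01 divr_gt0.
have := cx t; move=> /(_ _ (near_enorm (x t) e'0))/nbhs_ballP[d /= d0 dH].
have fldist m : `|t - fl m t| <= m.+1%:R^-1.
  have /andP[h1 h2] := floor_itv (m.+1%:R * t); rewrite -/(fl m t).
  have m0 : (0 : R) < m.+1%:R by [].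
  have g1 : fl m t <= t by rewrite /fl ler_pdivrMr// [leRHS]mulrC.
  rewrite ger0_norm ?subr_ge0// lerBlDl -(ler_pM2r m0) mulrDl mulVf ?lt0r_neq0//.
  by rewrite /fl divfK ?lt0r_neq0// mulrC; rewrite intrD in h2; apply: ltW.
near=> m.
have xd : enorm (x t - x (fl m t)) < e'.
  apply: dH; rewrite /ball/=; apply: le_lt_trans (fldist m) _.
  near: m; exact: near_infty_natSinv_lt (PosNum d0).
have e1 : e' <= 1 by rewrite ge_min lexx.
have eK : e' <= e / K by rewrite ge_min lexx orbT.
rewrite /h; apply: le_lt_trans (tame_lip_x tame t (r := r) p _ _) _.
- by rewrite /r lerDl.
- have := enormD (x (fl m t) - x t) (x t); rewrite subrK enormC /r; lra.
- apply: (@le_lt_trans _ _ (k r t * (1 + enorm p) * e')).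
    by rewrite ler_wpM2l ?mulr_ge0 ?addr_ge0 ?enorm_ge0// ltW.
  apply: (@lt_le_trans _ _ (K * e')); last by rewrite mulrC -ler_pdivlMr.
  by rewrite ltr_pM2r// /K ltrDl.
Unshelve. all: by end_near. Qed.

Lemma tame_bound t (z : 'rV[R]_n) p r : enorm z <= r ->
  `|H t z p| <= `|H t 0 0| + k r t * r + c t * (1 + r) * enorm p.
Proof.
move=> zr; have r0 : 0 <= r := le_trans (enorm_ge0 z) zr.
have h1 := tame_lip_p tame t z p 0; have h2 := tame_lip_x tame t (r := r) (x := z) (y := 0) 0 zr.
rewrite enorm0 !subr0 addr0 mulr1 in h1 h2; have {}h2 := h2 r0.
have h3 : k r t * enorm z <= k r t * r by rewrite ler_wpM2l// (tame_k_ge0 tame).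
have h4 : c t * (1 + enorm z) * enorm p <= c t * (1 + r) * enorm p.
  by rewrite ler_wpM2r ?enorm_ge0// ler_wpM2l ?(tame_c_ge0 tame)// lerD2l.
have := ler_normD (H t z p - H t z 0) (H t z 0); rewrite subrK => h5.
have := ler_normD (H t z 0 - H t 0 0) (H t 0 0); rewrite subrK => h6.
lra.
Qed.

Definition running (x : R -> 'rV[R]_n) p t : R := H t (x t) p.

Lemma running_L1 x p r : continuous x -> (forall t, enorm (x t) <= r) ->
  L1 (running x p).
Proof.
move=> cx xr.
have g1 : L1 (fun t => `|H t 0 0| + k r t * r + c t * (1 + r) * enorm p).
  apply: L1D; first apply: L1D.
  - exact: L1_norm (tame_0 tame).
  - exact: L1Zr (tame_k_L1 tame r).
  - by do 2 apply: L1Zr; exact: (tame_c_L1 tame).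
apply: L1_dominated g1 _; first exact: tame_measurable_comp.
by move=> t; exact: tame_bound.
Qed.

(* [x] is an admissible state and [w] its accumulated cost: the inequality is the
   integrated form of [ H^*(t, x t, x' t) <= w' t ]. In this form it is stable
   under pointwise limits of [w] and uniform limits of [x], and it needs neither
   derivatives nor measurable controls. *)
Definition arc (t0 T : R) x (w : R -> R) := [/\ continuous x,
  exists r, forall t, enorm (x t) <= r &
  forall s t p, t0 <= s -> s <= t -> t <= T ->
    dotv (x t - x s) p - (w t - w s) <= Ig (running x p) s t].

Lemma arc_running t0 T x w p : arc t0 T x w -> L1 (running x p).
Proof. by move=> [cx [r xr] _]; exact: running_L1 xr. Qed.

Lemma running_lip x p q r : (forall t, enorm (x t) <= r) -> forall t,
  running x p t <= running x q t + c t * ((1 + r) * enorm (p - q)).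
Proof.
move=> xr t; have := tame_lip_p tame t (x t) p q.
have h4 : c t * (1 + enorm (x t)) * enorm (p - q) <= c t * ((1 + r) * enorm (p - q)).
  by rewrite mulrA ler_wpM2r ?enorm_ge0// ler_wpM2l ?(tame_c_ge0 tame)// lerD2l.
by rewrite /running ler_norml; lra.
Qed.

(** With [lam *: p] in place of [p], the cost does not scale with [lam]; as [lam] grows it
    disappears, and only the linear growth of [H] in [p] bounds the displacement. *)
Lemma arc_speed t0 T x w s t M : arc t0 T x w -> t0 <= s -> s <= t -> t <= T ->
  (forall r, s <= r <= t -> 1 + enorm (x r) <= M) -> enorm (x t - x s) <= M * Ig c s t.
Proof.
move=> [cx [r xr] ax] t0s st tT xM.
have M0 : 0 <= M.
  by apply: le_trans (xM s _); rewrite ?addr_ge0 ?enorm_ge0// lexx st.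
apply: enorm_le_dotv.
  by rewrite mulr_ge0// Ig_ge0//; exact: (tame_c_ge0 tame).
move=> p; rewrite -subr_le0; apply: (@scaled_le0 _ _ (w t - w s + Ig (running x 0) s t)).
move=> lam lam0; have := ax s t (lam *: p) t0s st tT.
have H1 q : L1 (running x q) by exact: running_L1 xr.
have : Ig (running x (lam *: p)) s t <=
    Ig (fun r => running x 0 r + c r * (M * (lam * enorm p))) s t.
  apply: Ig_le => //; first by apply: L1D => //; apply: L1Zr; exact: (tame_c_L1 tame).
  move=> q sqt; have := tame_lip_p tame q (x q) (lam *: p) 0.
  rewrite subr0 enormZ (gtr0_norm lam0) => h.
  have h4 : c q * (1 + enorm (x q)) * (lam * enorm p) <= c q * (M * (lam * enorm p)).
    rewrite [leRHS]mulrA; apply: ler_wpM2r.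
      by apply: mulr_ge0; [exact: ltW|exact: enorm_ge0].
    by apply: ler_wpM2l; [exact: (tame_c_ge0 tame)|exact: xM].
  by move: h; rewrite /running ler_norml; lra.
rewrite IgD ?IgZr//; first last.
- by apply: L1Zr; exact: (tame_c_L1 tame).
- exact: (tame_c_L1 tame).
by rewrite dotvZr; lra.
Qed.

Lemma arc_bound t0 T x w t : arc t0 T x w -> t0 <= t <= T ->
  1 + enorm (x t) <= (1 + enorm (x t0)) * expR (2 * (primitive c t - primitive c t0)).
Proof.
move=> ax tT; have [cx _ _] := ax.
have c1 := tame_c_L1 tame; have c0 := tame_c_ge0 tame.
apply: (@gronwall _ t0 T (fun t => 1 + enorm (x t))) => //.
- have c1e : continuous (fun u : 'rV[R]_n => 1 + enorm u).
    apply: (@enorm_lipschitz_continuous _ _ _ 1) => u v.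
    by rewrite mul1r opprD addrACA subrr add0r enorm_dist.
  by move=> s; exact: continuous_comp (cx s) (c1e (x s)).
- exact: continuous_primitive.
- exact: primitive_nondecreasing.
- by move=> s; rewrite addr_ge0// enorm_ge0.
- move=> s r M t0s sr rT xM; rewrite primitiveB//.
  have := arc_speed ax t0s sr rT xM; have := enormD (x r - x s) (x s).
  by rewrite subrK; lra.
Qed.

Lemma running_ge x r t : (forall t, enorm (x t) <= r) ->
  `|running x 0 t| <= `|H t 0 0| + k r t * r.
Proof. by move=> xr; have := tame_bound t 0 (xr t); rewrite enorm0 mulr0 addr0. Qed.

(** Arcs are constrained on [t0, T] only, whereas densities and bounds are wanted at all times:
    composition with [clamp] freezes a state outside the interval. *)
Definition clamp (a b : R) t := Num.max a (Num.min b t).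

Lemma clamp_id a b t : a <= t <= b -> clamp a b t = t.
Proof. by move=> /andP[at_ tb]; rewrite /clamp (min_idPr tb) (max_idPr at_). Qed.

Lemma clamp_itv a b t : a <= b -> a <= clamp a b t <= b.
Proof. by move=> ab; rewrite /clamp le_max lexx ge_max ab ge_min lexx. Qed.

Lemma clamp_le a b s t : s <= t -> clamp a b s <= clamp a b t.
Proof.
move=> st; by rewrite /clamp ge_max !le_max lexx/= le_min !ge_min lexx st !orbT/=.
Qed.

Lemma continuous_clamp a b : continuous (clamp a b).
Proof.
move=> t; apply: (@continuous_max _ _ (fun=> a) (fun t => Num.min b t)).
  exact: cvg_cst.
by apply: (@continuous_min _ _ (fun=> b) id); [exact: cvg_cst|exact: cvg_id].
Qed.

Lemma Ig_clamp (gam : R -> R) a b s t : L1 gam -> (forall t, 0 <= gam t) -> a <= b ->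
  s <= t -> Ig gam (clamp a b s) (clamp a b t) <= Ig gam s t.
Proof.
move=> g1 g0 ab st.
have [ta|at_] := leP t a.
  have E r : r <= a -> clamp a b r = a.
    by move=> ra; rewrite /clamp; apply/max_idPl; rewrite ge_min ra orbT.
  by rewrite !E ?(le_trans st)// Igss// Ig_ge0.
have [bs|sb] := leP b s.
  have E r : b <= r -> clamp a b r = b.
    by move=> br; rewrite /clamp (min_idPl br); apply/max_idPr.
  by rewrite !E ?(le_trans bs)// Igss// Ig_ge0.
have sc : s <= clamp a b s by rewrite /clamp le_max le_min lexx (ltW sb)/= orbT.
have ct : clamp a b t <= t by rewrite /clamp ge_max (ltW at_) ge_min lexx orbT.
have cc : clamp a b s <= clamp a b t by exact: clamp_le.
rewrite (@Ig_split _ gam s (clamp a b s) t)//; last by rewrite sc (le_trans cc ct).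
rewrite (@Ig_split _ gam (clamp a b s) (clamp a b t) t)//; last by rewrite cc ct.
by have := Ig_ge0 s (clamp a b s) g0; have := Ig_ge0 (clamp a b t) t g0; lra.
Qed.

End Tame.

(** * Arcs and trajectories *)

Section DenseRows.
Context {R : realType} {n : nat}.

(** The zero costate comes first so that every partial maximum of the affine minorants dominates the
    one at p = 0, which has an integrable lower bound. *)
Lemma dense_row_sequence : exists P : nat -> 'rV[R]_n, P 0%N = 0 /\
  forall p (e : R), 0 < e -> exists i, enorm (p - P i) < e.
Proof.
have [u uK] : exists u : nat -> option 'rV[rat]_n, forall q, exists i, u i = Some q.
  by exists unpickle => q; exists (pickle q); exact: pickleK.
exists (fun i => if i is j.+1 then map_mx ratr (odflt 0 (u j)) else 0); split => //.
move=> p e e0; have n0 : 0 < (n%:R : R) + 1 by rewrite ltr_wpDl.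
have /choice[q qP] : forall i : 'I_n, exists q : rat, `|p ord0 i - ratr q| < e / (n%:R + 1).
  move=> i; have d0 : 0 < e / (n%:R + 1) by rewrite divr_gt0.
  have [|q] := @rat_in_itvoo R (p ord0 i - e / (n%:R + 1)) (p ord0 i + e / (n%:R + 1)).
    by rewrite ltrBlDr -addrA ltrDl addr_gt0.
  by rewrite in_itv/= => /andP[h1 h2]; exists q; rewrite distrC ltr_distl h1 h2.
have [j uj] := uK (\row_i q i); exists j.+1; rewrite uj/=.
apply: le_lt_trans (enorm_le_sum _) _.
apply: (@le_lt_trans _ _ (\sum_(i < n) e / (n%:R + 1))).
  by apply: ler_sum => i _; rewrite !mxE; exact/ltW.
rewrite sumr_const card_ord -[ltLHS]mulr_natl mulrA ltr_pdivrMr//; lra.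
Qed.

End DenseRows.

Section DerivativeOfPath.
Context {R : realType}.

Lemma derivable_right {n : nat} (g : R -> 'rV[R]_n) (t e : R) : derivable g t 1 -> 0 < e ->
  exists2 d : R, 0 < d & forall s, t < s -> s < t + d ->
    enorm (g s - g t - (s - t) *: 'D_1 g t) <= e * (s - t).
Proof.
move=> dg e0.
have /(_ _ (near_enorm ('D_1 g t) e0)) : h^-1 *: (g (h *: (1 : R) + t) - g t) @[h --> (0 : R)^'] --> 'D_1 g t.
  by move/cvg_ex : dg => [l gl]; rewrite /derive (cvg_lim _ gl).
move=> /nbhs_ballP[d /= d0 dH]; exists d => // s ts std.
have st0 : 0 < s - t by rewrite subr_gt0.
have := dH (s - t); rewrite /ball/= sub0r normrN gtr0_norm//.
have std' : s - t < d by rewrite ltrBlDl.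
move=> /(_ std' (lt0r_neq0 st0)).
rewrite (_ : (s - t) *: (1 : R) + t = s); last by rewrite /GRing.scale/= mulr1 subrK.
move=> /ltW h.
have -> : g s - g t - (s - t) *: 'D_1 g t =
    (s - t) *: ((s - t)^-1 *: (g s - g t) - 'D_1 g t).
  by rewrite scalerBr scalerA divff ?scale1r// lt0r_neq0.
by rewrite enormZ gtr0_norm// mulrC ler_wpM2r ?(ltW st0)// enormC.
Qed.

Lemma derivable_right_real (g : R -> R) (t e : R) : derivable g t 1 -> 0 < e ->
  exists2 d : R, 0 < d & forall s, t < s -> s < t + d ->
    `|g s - g t - (s - t) * 'D_1 g t| <= e * (s - t).
Proof.
move=> dg e0.
have : h^-1 *: (g (h *: (1 : R) + t) - g t) @[h --> (0 : R)^'] --> 'D_1 g t.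
  by move/cvg_ex : dg => [l gl]; rewrite /derive (cvg_lim _ gl).
move=> /(@cvgrPdist_lt _ R^o)/(_ e e0)/nbhs_ballP[d /= d0 dH]; exists d => // s ts std.
have st0 : 0 < s - t by rewrite subr_gt0.
have := dH (s - t); rewrite /ball/= sub0r normrN gtr0_norm//.
have std' : s - t < d by rewrite ltrBlDl.
move=> /(_ std' (lt0r_neq0 st0)).
rewrite (_ : (s - t) *: (1 : R) + t = s); last by rewrite /GRing.scale/= mulr1 subrK.
move=> /ltW h.
have -> : g s - g t - (s - t) * 'D_1 g t =
    (s - t) * ((s - t)^-1 * (g s - g t) - 'D_1 g t).
  by rewrite mulrBr mulrA divff ?mul1r// lt0r_neq0.
by rewrite normrM gtr0_norm// mulrC ler_wpM2r ?(ltW st0)// distrC.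
Qed.

End DerivativeOfPath.

Section MaxOfAffine.
Context {R : realType}.
Local Notation leb := (@leb R).
Implicit Types (f g : R -> R) (q : nat -> R -> R) (s t : R).

Lemma L1_max f g : L1 f -> L1 g -> L1 (fun t => Num.max (f t) (g t)).
Proof.
move=> f1 g1; have h1 : L1 (fun t => `|f t| + `|g t|) by apply: L1D; exact: L1_norm.
apply: L1_dominated h1 _.
  by apply: measurable_maxr; exact: L1_measurable.
by move=> t; rewrite /Num.max; case: ifP => _; rewrite ?lerDr ?lerDl.
Qed.

Fixpoint maxseq q (N : nat) t : R :=
  if N is N'.+1 then Num.max (maxseq q N' t) (q N t) else q 0%N t.

Lemma L1_maxseq q N : (forall i, L1 (q i)) -> L1 (maxseq q N).
Proof. by move=> q1; elim: N => [|N IH] /=; [exact: q1|exact: L1_max]. Qed.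

Lemma maxseq_ge q N i t : (i <= N)%N -> q i t <= maxseq q N t.
Proof.
elim: N => [|N IH] /=; first by rewrite leqn0 => /eqP->.
rewrite leq_eqVlt => /predU1P[->|iN]; first by rewrite le_max lexx orbT.
by rewrite le_max IH.
Qed.

Lemma maxseq_attained q N t : exists i, maxseq q N t = q i t.
Proof.
elim: N => [|N [i IH]] /=; first by exists 0%N.
by case: leP => _; [exists N.+1|exists i].
Qed.

Lemma maxseq_nondecreasing q t (N M : nat) : (N <= M)%N -> maxseq q N t <= maxseq q M t.
Proof.
move=> /subnK <-; elim: (M - N)%N => [|j IH] //=.
by rewrite le_max IH.
Qed.

(* No measurability is needed for monotonicity, as the integral of a nonnegative
   function is defined as a supremum over simple functions. *)
Lemma le_integral_nonmeasurable (D : set (LebT R)) (f g : LebT R -> \bar R) :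
  (forall t, D t -> (f t <= g t)%E) ->
  (\int[leb]_(t in D) f t <= \int[leb]_(t in D) g t)%E.
Proof.
move=> fg.
have mono (f' g' : LebT R -> \bar R) : (forall t, D t -> (0 <= f' t)%E) ->
    (forall t, D t -> (f' t <= g' t)%E) ->
    (\int[leb]_(t in D) f' t <= \int[leb]_(t in D) g' t)%E.
  move=> f0 fg'; have g0 t : D t -> (0 <= g' t)%E.
    by move=> Dt; apply: le_trans (fg' t Dt); exact: f0.
  rewrite (ge0_integralE leb f0) (ge0_integralE leb g0).
  apply: ereal_sup_le => _ [h /= hf <-]; exists h => // t.
  apply: le_trans (hf t) _; rewrite !patchE; case: ifPn => //.
  by rewrite inE => /fg'.
rewrite integralE [leRHS]integralE; apply: leeB.
  apply: mono => [t _|t Dt]; first exact: funepos_ge0.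
  by rewrite !funeposE; apply: le_max2; rewrite ?fg.
apply: mono => [t _|t Dt]; first exact: funeneg_ge0.
rewrite !funenegE; apply: le_max2 => //.
by rewrite leeN2 fg.
Qed.

Lemma L1_integralE f (a b : R) : L1 f ->
  (\int[leb]_(t in (`[a, b]%classic : set (LebT R))) (f t)%:E = (Ig f a b)%:E)%E.
Proof.
move=> f1; rewrite /Ig /Rintegral fineK//.
have mab : measurable (`[a, b]%classic : set (LebT R)).
  by apply: measurable_LebT; exact: measurable_itv.
by apply: integrable_fin_num => //; apply: integrableS f1.
Qed.

End MaxOfAffine.

Section ArcsAndTrajectories.
Context {R : realType} {n : nat} {H : R -> 'rV[R]_n -> 'rV[R]_n -> R}.
Context {c : R -> R} {k : R -> R -> R} (tame : tame_hamiltonian H c k).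
Local Notation leb := (@leb R).
Local Notation running := (@running R n H).
Local Notation arc := (@arc R n H).
Implicit Types (x y : R -> 'rV[R]_n) (p : 'rV[R]_n) (s t : R).

(* Along a dense sequence [P] of costates, the Lagrangian [H^*(t, y t, rho t)] is
   the supremum of [affine rho y P i t]. *)
Let affine (rho y : R -> 'rV[R]_n) (P : nat -> 'rV[R]_n) i t :=
  dotv (rho t) (P i) - running y (P i) t.

(** Both sides of the arc inequality are Lipschitz in [p]; [K] exceeds the sum of the two
    constants. *)
Lemma arc_dense t0 T y w r (P : nat -> 'rV[R]_n) :
  (forall p (e : R), 0 < e -> exists i, enorm (p - P i) < e) ->
  continuous y -> (forall t, enorm (y t) <= r) ->
  (forall s t i, t0 <= s -> s <= t -> t <= T ->
    dotv (y t - y s) (P i) - (w t - w s) <= Ig (running y (P i)) s t) ->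
  arc t0 T y w.
Proof.
move=> dP cy yr H1; split => //; first by exists r.
move=> s t p t0s st tT; apply/ler_addgt0Pr => e e0.
have c0 : 0 <= Ig c s t by apply: Ig_ge0; exact: (tame_c_ge0 tame).
have r0 : 0 <= r := le_trans (enorm_ge0 _) (yr 0).
pose K := enorm (y t - y s) + (1 + r) * Ig c s t + 1.
have K0 : 0 < K by rewrite ltr_wpDl// addr_ge0 ?enorm_ge0// mulr_ge0// addr_ge0.
have [i ip] := dP p (e / K) (divr_gt0 e0 K0).
have h1 := H1 s t i t0s st tT.
have h2 := dotv_le (y t - y s) (p - P i); rewrite dotvBr in h2.
have L1r q : L1 (running y q) by exact: (running_L1 tame).
have c1 := tame_c_L1 tame.
have h3 : Ig (running y (P i)) s t <=
    Ig (fun q => running y p q + c q * ((1 + r) * enorm (P i - p))) s t.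
  apply: Ig_le => //; first by apply: L1D => //; exact: L1Zr.
  by move=> q _; exact: (running_lip tame).
rewrite IgD ?IgZr// in h3; last exact: L1Zr.
rewrite enormC in h3.
have h4 : K * enorm (p - P i) <= e by rewrite mulrC -ler_pdivlMr// ltW.
have h5 := enorm_ge0 (p - P i).
move: h4; rewrite /K; lra.
Qed.

(** No measurability of [l] is available, so the cost cannot be its primitive; the suprema of
    integrals of measurable minorants remain below the bound [B]. *)
Lemma trajectory_arc (t0 T : R) x (f : R -> 'rV[R]_n) (l : R -> R) (B : R) : t0 <= T ->
  abs_cont_on t0 T x ->
  {ae leb, forall t : LebT R, t0 <= t <= T -> derivable x t 1 /\ 'D_1 x t = f t} ->
  (forall t p, t0 <= t <= T -> dotv (f t) p - l t <= H t (x t) p) ->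
  (\int[leb]_(t in (`[t0, T]%classic : set (LebT R))) (l t)%:E <= B%:E)%E ->
  exists w, arc t0 T (x \o clamp t0 T) w /\ w T - w t0 <= B.
Proof.
move=> t0T acx aex fl lB; set y := x \o clamp t0 T.
have yx t : t0 <= t <= T -> y t = x t by move=> tT; rewrite /y/= clamp_id.
have ycl t : y t = y (clamp t0 T t).
  by rewrite /y/= (@clamp_id _ _ _ (clamp t0 T t))//; exact: clamp_itv.
have ucx (e : R) : 0 < e -> exists2 d : R, 0 < d & forall s t,
    t0 <= s -> s <= t -> t <= T -> t - s < d -> enorm (x t - x s) < e.
  move=> e0; have [d d0 h] := acx e e0; exists d => // s t t0s st tT std.
  have := h 1%N (fun=> s) (fun=> t); rewrite !big_ord1; apply => //.
  by move=> i j; rewrite (ord1 i) (ord1 j).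
have cy : continuous y.
  move=> t A /nbhs_enorm[e e0 eA].
  have [d d0 xd] := ucx e e0.
  have [d' d'0 cd] := cts_near t (@continuous_clamp _ t0 T) d0.
  apply/nbhs_ballP; exists d' => //= s; rewrite /ball/= distrC => /cd sd; apply: eA.
  have /andP[a1 a2] := clamp_itv t t0T; have /andP[a3 a4] := clamp_itv s t0T.
  have [h|/ltW h] := leP (clamp t0 T s) (clamp t0 T t).
    by apply: xd => //; apply: le_lt_trans sd; rewrite distrC ler_norm.
  by rewrite enormC; apply: xd => //; apply: le_lt_trans sd; exact: ler_norm.
have [r yr] : exists r, forall t, enorm (y t) <= r.
  have ce : continuous (fun t => enorm (y t)).
    by move=> t; exact: continuous_comp (cy t) (@continuous_enorm _ _ (y t)).
  have [q _ qmax] := EVT_max t0T (cts_within ce).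
  exists (enorm (y q)) => t; rewrite ycl; apply: qmax.
  by rewrite in_itv/=; exact: clamp_itv.
have r0 : 0 <= r := le_trans (enorm_ge0 _) (yr 0).
have c0 := tame_c_ge0 tame; have c1 := tame_c_L1 tame.
pose gam t := c t * (1 + r).
have gam1 : L1 gam by exact: L1Zr.
have gam0 t : 0 <= gam t by rewrite mulr_ge0 ?addr_ge0.
have fgam t : t0 <= t <= T -> enorm (f t) <= gam t.
  move=> tT; apply: enorm_le_dotv => // p; rewrite -subr_le0.
  apply: (@scaled_le0 _ _ (l t + H t (x t) 0)) => lam lam0.
  have := fl t (lam *: p) tT; have := tame_lip_p tame t (x t) (lam *: p) 0.
  rewrite subr0 enormZ (gtr0_norm lam0) dotvZr => h1 h2.
  have : c t * (1 + enorm (x t)) * (lam * enorm p) <= gam t * (lam * enorm p).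
    apply: ler_wpM2r; first by rewrite mulr_ge0 ?enorm_ge0// ltW.
    by apply: ler_wpM2l => //; rewrite lerD2l -yx.
  by move: h1; rewrite ler_norml; lra.
have aegam : {ae leb, forall t : LebT R, derivable (primitive gam) t 1 /\
    'D_1 (primitive gam) t = gam t} by exact: ae_derivable_primitive.
have speed s t : t0 <= s -> s <= t -> t <= T -> enorm (y t - y s) <= Ig gam s t.
  move=> t0s st tT.
  (* The comparison is made for the distance to the fixed point [y s], a real function, whose right
     increments are controlled by those of [x] and hence by [gam]. *)
  have := @ac_le_nondecreasing _ s t (fun q => enorm (y q - y s)) (primitive gam) st.
  rewrite subrr enorm0 subr0 primitiveB//; apply.
  - apply: (@abs_cont_ac _ _ s t x).
      move=> e e0; have [d d0 h] := acx e e0; exists d => // N u v uv.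
      apply: h => i; have [h1 [h2 h3]] := uv i; do !split => //.
        exact: le_trans h1.
      exact: le_trans tT.
    move=> a b sa ab bt; apply: le_trans (enorm_dist _ _) _.
    rewrite opprB addrA subrK !yx//.
      by rewrite (le_trans t0s sa) (le_trans ab (le_trans bt tT)).
    by rewrite (le_trans t0s (le_trans sa ab)) (le_trans bt tT).
  - by move=> a b _ ab _; exact: primitive_nondecreasing.
  - apply: (ae_S2 aex aegam) => q hx [dg gE] /andP[sq qt] e e0.
    have qT : t0 <= q <= T by rewrite (le_trans t0s sq) (le_trans (ltW qt) tT).
    have [dx xE] := hx qT; have e20 : 0 < e / 2 by rewrite divr_gt0.
    have [d1 d10 h1] := derivable_right dx e20.
    have [d2 d20 h2] := derivable_right_real dg e20.
    exists (Num.min d1 d2); first by rewrite lt_min d10 d20.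
    move=> z qz zd zt.
    have zd1 : z < q + d1 by apply: lt_le_trans zd _; rewrite lerD2l ge_min lexx.
    have zd2 : z < q + d2 by apply: lt_le_trans zd _; rewrite lerD2l ge_min lexx orbT.
    have := h1 z qz zd1; have := h2 z qz zd2; rewrite gE xE => h3 h4.
    have zq0 : 0 <= z - q by rewrite subr_ge0 ltW.
    have h5 : enorm (x z - x q) <= (z - q) * gam q + e / 2 * (z - q).
      have := enormD (x z - x q - (z - q) *: f q) ((z - q) *: f q).
      rewrite subrK enormZ (ger0_norm zq0) => h5.
      have := ler_wpM2l zq0 (fgam q qT); lra.
    have := enorm_dist (y z - y s) (y q - y s); rewrite opprB addrA subrK.
    rewrite (yx z) ?(yx q)// => [h6|]; last first.
      by rewrite (le_trans t0s (le_trans sq (ltW qz))) (le_trans zt tT).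
    have := ler_norm (enorm (x z - y s) - enorm (x q - y s)).
    by move: h3; rewrite ler_norml; lra.
have speedT s t : s <= t -> enorm (y t - y s) <= Ig gam s t.
  move=> st; rewrite (ycl s) (ycl t).
  have /andP[a1 a2] := clamp_itv t t0T; have /andP[a3 a4] := clamp_itv s t0T.
  apply: le_trans (speed _ _ a3 (clamp_le _ _ st) a2) _.
  exact: Ig_clamp.
have [rho [rho1 rhoE aerho]] := vector_density gam1 gam0 speedT.
(* [y] and [x] agree on [t0, T] only, so their derivatives are compared through increments to the
   right, which excludes the endpoint [T]. *)
have aef : {ae leb, forall t : LebT R, t0 <= t < T -> f t = rho t}.
  apply: (ae_S2 aex aerho) => t hx [dy yE] /andP[t0t tT].
  have [dx xE] := hx (introT andP (conj t0t (ltW tT))).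
  apply/eqP; rewrite -subr_eq0 -enorm_eq0 eq_le enorm_ge0 andbT.
  apply/ler_addgt0Pr => e e0; rewrite add0r; have e20 : 0 < e / 2 by rewrite divr_gt0.
  have [d1 d10 h1] := derivable_right dx e20.
  have [d2 d20 h2] := derivable_right dy e20.
  pose z := Num.min T (t + Num.min d1 d2 / 2).
  have md0 : 0 < Num.min d1 d2 by rewrite lt_min d10 d20.
  have tz : t < z by rewrite lt_min tT/= ltrDl divr_gt0.
  have zT : z <= T by rewrite ge_min lexx.
  have zm : z < t + Num.min d1 d2.
    apply: (@le_lt_trans _ _ (t + Num.min d1 d2 / 2)); first by rewrite ge_min lexx orbT.
    by rewrite ltrD2l ltr_pdivrMr// mulrDr mulr1 ltrDl.
  have zd1 : z < t + d1 by apply: lt_le_trans zm _; rewrite lerD2l ge_min lexx.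
  have zd2 : z < t + d2 by apply: lt_le_trans zm _; rewrite lerD2l ge_min lexx orbT.
  have := h1 z tz zd1; have := h2 z tz zd2; rewrite xE yE !yx; first last.
  - by rewrite zT (le_trans t0t (ltW tz)).
  - by rewrite t0t ltW.
  move=> h3 h4.
  have zt0 : 0 < z - t by rewrite subr_gt0.
  have : enorm ((z - t) *: (f t - rho t)) <= e * (z - t).
    have -> : (z - t) *: (f t - rho t) =
        (x z - x t - (z - t) *: rho t) - (x z - x t - (z - t) *: f t).
      by rewrite scalerBr opprB [in RHS]addrC addrA subrK.
    apply: le_trans (enormB _ _) _; lra.
  by rewrite enormZ gtr0_norm// mulrC ler_pM2r.
have [P [P0 dP]] := @dense_row_sequence R n.
have run1 p : L1 (running y p) by exact: (running_L1 tame).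
pose q := affine rho y P.
have q1 i : L1 (q i) by apply: L1B.
pose M N := maxseq q N.
have M1 N : L1 (M N) by exact: L1_maxseq.
have aeM N : {ae leb, forall t : LebT R, t0 <= t < T -> M N t <= l t}.
  apply: (ae_S aef) => t ft tT; have tT' : t0 <= t <= T by case/andP: tT => -> /ltW->.
  have [i qi] := maxseq_attained q N t; rewrite /M qi.
  by have := fl t (P i) tT'; rewrite (ft tT) /q /affine /running yx//; lra.
have q0l t : t0 <= t <= T -> q 0%N t <= l t.
  move=> tT; have := fl t 0 tT.
  by rewrite /q /affine P0 !dotv0r /running yx//; lra.
have MB N : Ig (M N) t0 T <= B.
  have : {ae leb, forall t : LebT R, t0 <= t <= T -> M N t <= l t}.
    have := ae_neq T.
    move=> /(ae_S2 (aeM N)); apply => t h tT /andP[t0t].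
    by rewrite le_eqVlt (negPf tT)/= => tT'; apply: h; rewrite t0t.
  move=> [N0 [mN0 N00 hN0]].
  (* On the exceptional set [M N] may exceed [l]; there it is replaced by [q 0], which lies below
     [l] at every time because the zero costate does not see the velocity. The comparison then holds
     everywhere on [t0, T], as [le_integral_nonmeasurable] requires. *)
  pose M' t := if t \in N0 then q 0%N t else M N t.
  have mab : measurable (`[t0, T]%classic : set (LebT R)).
    by apply: measurable_LebT; exact: measurable_itv.
  have mM' : measurable_fun (setT : set (LebT R)) (M' : LebT R -> R).
    apply: measurable_fun_ifT.
    - apply: (@measurable_fun_bool _ _ setT _ true); rewrite setTI (_ : _ @^-1` _ = N0)//.
      by apply/seteqP; split => t /=; [move=> /set_mem|move=> /mem_set].
    - exact: L1_measurable.
    - exact: L1_measurable.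
  rewrite -lee_fin -L1_integralE//; apply: le_trans lB.
  have mE h : measurable_fun (setT : set (LebT R)) (h : LebT R -> R) ->
      measurable_fun (`[t0, T]%classic : set (LebT R)) (EFin \o h).
    by move=> mh; apply/measurable_EFinP; exact: measurable_funTS.
  have aeMM' : ae_eq leb (`[t0, T]%classic : set (LebT R)) (EFin \o M N) (EFin \o M').
    exists N0; split => // t /= /not_implyP[_ h]; apply: contrapT => Nt; apply: h.
    by rewrite /M' memNset.
  have := ae_eq_integral _ _ mab (mE _ (L1_measurable (M1 N))) (mE _ mM') aeMM'.
  rewrite /comp => ->.
  apply: le_integral_nonmeasurable => t /=; rewrite in_itv/= lee_fin /M' => tT.
  case: ifPn => [_|]; first exact: q0l.
  rewrite notin_setE => Nt; apply: contrapT => h; apply: Nt; apply: hN0 => /= h'.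
  by apply: h; exact: h'.
have Msub N s t : t0 <= s -> s <= t -> Ig (M N) t0 t = Ig (M N) t0 s + Ig (M N) s t.
  by move=> t0s st; rewrite (@Ig_split _ _ t0 s t)// t0s.
pose A t := [set Ig (M N) t0 t | N in [set: nat]].
have Asup t : t0 <= t -> t <= T -> has_sup (A t).
  move=> t0t tT; split; first by exists (Ig (M 0%N) t0 t), 0%N.
  (* The integral over [t0, T] is at most [B], and its tail over [t, T] is bounded below through
     [q 0]. *)
  exists (B + Ig (fun t => `|q 0%N t|) t T) => _ [N _ <-].
  have := MB N; rewrite (Msub N t T)// => h.
  suff : - Ig (fun t => `|q 0%N t|) t T <= Ig (M N) t T by lra.
  rewrite -IgN ?L1_norm//; apply: Ig_le => //.
    by apply: L1N; exact: L1_norm.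
  move=> z _; have := @maxseq_ge _ q N 0 z (leq0n N); rewrite -/(M N z).
  by have := ler_norm (- q 0%N z); rewrite normrN; lra.
pose w t := sup (A t).
have w_ub t N : t0 <= t -> t <= T -> Ig (M N) t0 t <= w t.
  by move=> t0t tT; apply: ub_le_sup; [exact: (Asup t t0t tT).2|exists N].
exists w; split; last first.
  have w0 : w t0 = 0.
    rewrite /w (_ : A t0 = [set 0]) ?sup1//; apply/seteqP; split => z.
      by move=> [N _ <-]; rewrite Igss.
    by move=> ->; exists 0%N => //; rewrite Igss.
  rewrite w0 subr0; apply: ge_sup; first exact: (Asup T t0T (lexx T)).1.
  by move=> _ [N _ <-]; exact: MB.
apply: (@arc_dense t0 T y w r P) => // s t i t0s st tT.
have sT := le_trans st tT; have t0t := le_trans t0s st.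
have h1 : Ig (q i) s t = dotv (y t - y s) (P i) - Ig (running y (P i)) s t.
  by rewrite /q /affine IgB// -rhoE.
suff : Ig (q i) s t <= w t - w s by move: h1; clear; lra.
apply/ler_addgt0Pr => e e0.
have [_ [N _ <-] hN] := sup_adherent e0 (Asup s t0s sT); rewrite -/(w s) in hN.
(* One index serves both intervals: it keeps the near-optimality of [N] on [t0, s] and dominates
   [q i] on [s, t]. *)
pose N' := maxn N i.
have h2 : Ig (M N) t0 s <= Ig (M N') t0 s.
  by apply: Ig_le => // z _; apply: maxseq_nondecreasing; exact: leq_maxl.
have h3 : Ig (q i) s t <= Ig (M N') s t.
  by apply: Ig_le => // z _; apply: maxseq_ge; exact: leq_maxr.
have := w_ub t N' t0t tT; rewrite (Msub N' s t)//.
by move: hN h2 h3; clear; lra.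
Qed.

End ArcsAndTrajectories.

Section MonotoneLimit.
Context {R : realType}.
Local Notation leb := (@leb R).
Implicit Types (f g : R -> R) (s t : R).

Lemma ae_all (P : nat -> R -> Prop) : (forall i, {ae leb, forall t : LebT R, P i t}) ->
  {ae leb, forall t : LebT R, forall i, P i t}.
Proof.
move=> aeP; have : leb.-negligible (\bigcup_i ~` (P i : set (LebT R))).
  exact: negligible_bigcup.
move=> [N [mN N0 PN]]; exists N; split => // t /= nP; apply: PN.
by move/existsNP : nP => [i nPi]; exists i.
Qed.

(** Adding [eta] makes the sequence nonnegative, so monotone convergence applies; the bound on the
    integrals makes the limit finite almost everywhere. *)
Lemma monotone_limit (M : nat -> R -> R) eta (a b B : R) :
  (forall N, L1 (M N)) -> L1 eta -> (forall N t, 0 <= M N t + eta t) ->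
  (forall t, {homo M^~ t : N N' / (N <= N')%N >-> N <= N'}) ->
  (forall N, Ig (M N) a b <= B) ->
  exists l : R -> R, [/\ L1 l, Ig l a b <= B &
    {ae leb, forall t : LebT R, a <= t <= b -> forall N, M N t <= l t}].
Proof.
move=> M1 eta1 M0 ndM MB; set D : set (LebT R) := `[a, b]%classic.
have mD : measurable D by apply: measurable_LebT; exact: measurable_itv.
pose g N : LebT R -> \bar R := (fun t => (M N t + eta t)%:E) \_ D.
have Me1 N : L1 (fun t => M N t + eta t) by exact: L1D.
have mg N : measurable_fun setT (g N).
  apply/(measurable_restrictT _ mD); apply/measurable_EFinP.
  by apply: measurable_funTS; exact: L1_measurable.
have g0 N t : (0 <= g N t)%E by rewrite /g patchE; case: ifP => // _; rewrite lee_fin.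
have ndg t : {homo g^~ t : N N' / (N <= N')%N >-> (N <= N')%E}.
  move=> N N' NN'; rewrite /g !patchE; case: ifP => // _.
  by rewrite lee_fin lerD2r; exact: ndM.
have gI N : (\int[leb]_t g N t = (Ig (M N) a b + Ig eta a b)%:E)%E.
  by rewrite -integral_mkcond L1_integralE// IgD.
pose L (t : LebT R) : \bar R := limn (g^~ t).
have gL t : g^~ t @ \oo --> L t.
  by apply: ereal_nondecreasing_is_cvgn; exact: ndg.
have gleL N t : (g N t <= L t)%E.
  by apply: lime_ge; [exact: ereal_nondecreasing_is_cvgn (ndg t)|near=> i; apply: ndg; near: i; exact: nbhs_infty_ge].
have mL : measurable_fun (setT : set (LebT R)) L.
  by apply: (@emeasurable_fun_cvg _ _ _ _ g L mg) => t _; exact: gL.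
have L0 t : (0 <= L t)%E by exact: le_trans (g0 0%N t) (gleL _ _).
have LI : (\int[leb]_t L t <= (B + Ig eta a b)%:E)%E.
  rewrite /L (monotone_convergence leb measurableT mg)//.
  apply: lime_le.
    apply: ereal_nondecreasing_is_cvgn => N N' NN'; apply: ge0_le_integral => //.
    by move=> t _; exact: ndg.
  by near=> N; rewrite gI lee_fin lerD2r.
have iL : leb.-integrable setT L.
  apply/integrableP; split => //; under eq_integral do rewrite gee0_abs//.
  exact: le_lt_trans LI (ltry _).
have mfL : measurable_fun (setT : set (LebT R)) (fun t : LebT R => fine (L t)).
  by apply: (measurableT_comp _ mL).
have fL1 : L1 (fun t => fine (L t)).
  apply: (le_integrable measurableT _ _ iL); first exact/measurable_EFinP.
  move=> t _ /=; have := L0 t; case: (L t) => [r| |] //= r0; by rewrite ?normr0 ?lee_fin.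
have mfL' : measurable_fun (setT : set (LebT R)) (fun t : LebT R => (fine (L t))%:E).
  exact/measurable_EFinP.
have fL0 (t : LebT R) : setT t -> (0 <= (fine (L t))%:E)%E by rewrite lee_fin fine_ge0.
exists (fun t => fine (L t) - eta t); split; first exact: L1B.
- rewrite IgB// lerBlDr -lee_fin; apply: le_trans LI.
  rewrite -L1_integralE//.
  apply: (@le_trans _ _ (\int[leb]_t (fine (L t))%:E)%E).
    by apply: (ge0_subset_integral leb mD measurableT mfL' fL0).
  apply: (@ge0_le_integral _ _ _ leb _ measurableT _ _ fL0 mfL' mL) => t _.
  by have := L0 t; case: (L t) => [r| |] //= _; rewrite leey.
- have := integrable_ae measurableT iL.
  move=> /(ae_S (Q := fun t => a <= t <= b -> forall N, M N t <= fine (L t) - eta t)).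
  apply=> t /(_ Logic.I) fLt tab N; rewrite lerBrDr -lee_fin fineK//.
  apply: le_trans (gleL N t); rewrite /g patchE ifT//.
  by rewrite inE /D/= in_itv.
Unshelve. all: by end_near. Qed.

End MonotoneLimit.

Section ArcTrajectory.
Context {R : realType} {n : nat} {H : R -> 'rV[R]_n -> 'rV[R]_n -> R}.
Context {c : R -> R} {k : R -> R -> R} (tame : tame_hamiltonian H c k).
Local Notation leb := (@leb R).
Local Notation running := (@running R n H).
Local Notation arc := (@arc R n H).
Implicit Types (x y : R -> 'rV[R]_n) (p : 'rV[R]_n) (s t : R).

Lemma arc_trajectory (t0 T : R) x w : t0 <= T -> arc t0 T x w ->
  exists (rho : R -> 'rV[R]_n) (l : R -> R), let y := x \o clamp t0 T in
    [/\ abs_cont_on t0 T y, forall p, L1 (fun t => dotv (rho t) p), L1 l,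
      Ig l t0 T <= w T - w t0 &
      {ae leb, forall t : LebT R, t0 <= t <= T ->
        (derivable y t 1 /\ 'D_1 y t = rho t) /\
        forall p, dotv (rho t) p - l t <= H t (y t) p}].
Proof.
move=> t0T ax; have [cx [r xr] xw] := ax.
set y := x \o clamp t0 T.
have yx t : t0 <= t <= T -> y t = x t by move=> tT; rewrite /y/= clamp_id.
have cy : continuous y.
  by move=> t; exact: continuous_comp (@continuous_clamp _ t0 T t) (cx _).
have yr t : enorm (y t) <= r by exact: xr.
have r0 : 0 <= r := le_trans (enorm_ge0 _) (yr 0).
have c0 := tame_c_ge0 tame; have c1 := tame_c_L1 tame.
pose gam t := c t * (1 + r).
have gam1 : L1 gam by exact: L1Zr.
have gam0 t : 0 <= gam t by rewrite mulr_ge0 ?addr_ge0.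
have speed s t : s <= t -> enorm (y t - y s) <= Ig gam s t.
  move=> st; have /andP[a1 a2] := clamp_itv t t0T; have /andP[a3 a4] := clamp_itv s t0T.
  apply: le_trans (Ig_clamp gam1 gam0 t0T st).
  rewrite /gam IgZr// mulrC; apply: (arc_speed tame ax a3 (clamp_le _ _ st) a2).
  by move=> q _; rewrite lerD2l.
have run1 p : L1 (running y p) by exact: (running_L1 tame).
have yw s t p : t0 <= s -> s <= t -> t <= T ->
    dotv (y t - y s) p - (w t - w s) <= Ig (running y p) s t.
  move=> t0s st tT; rewrite !yx ?(le_trans t0s st)// ?t0s ?(le_trans st tT)//.
  apply: le_trans (xw s t p t0s st tT) _.
  rewrite (@eq_Ig _ (running x p) (running y p))// => q /andP[sq qt].
  by rewrite /running yx// (le_trans t0s sq) (le_trans qt tT).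
have [rho [rho1 rhoE aerho]] := vector_density gam1 gam0 speed.
have [P [P0 dP]] := @dense_row_sequence R n.
pose q i t := dotv (rho t) (P i) - running y (P i) t.
have q1 i : L1 (q i) by exact: L1B.
pose M := maxseq q.
have M1 N : L1 (M N) by exact: L1_maxseq.
pose eta t := `|H t 0 0| + k r t * r.
have eta1 : L1 eta.
  by apply: L1D; [exact: L1_norm (tame_0 tame)|apply: L1Zr; exact: (tame_k_L1 tame)].
have runeta t : `|running y 0 t| <= eta t by exact: (running_ge tame).
have M0 N t : 0 <= M N t + eta t.
  have := @maxseq_ge _ q N 0 t (leq0n N); rewrite -/M /q P0 dotv0r.
  have := runeta t; rewrite ler_norml; lra.
have Me1 N : L1 (fun t => M N t + eta t) by exact: L1D.
have aeMe N := ae_derivable_primitive (Me1 N).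
have aeeta := ae_derivable_primitive eta1.
have aerun := ae_all (fun i => ae_derivable_primitive (run1 (P i))).
(* The function [w] may jump, but the arc inequality at p = 0 makes [w + primitive eta]
   nondecreasing. It can thus serve as the comparison function for the absolutely continuous
   primitive of [M N + eta]. *)
have MB N : Ig (M N) t0 T <= w T - w t0.
  have := @ac_le_nondecreasing _ t0 T (primitive (fun t => M N t + eta t))
    (fun t => w t + primitive eta t) t0T.
  rewrite opprD addrACA !primitiveB// IgD// lerD2r; apply.
  - apply: (lipschitz_ac (Me1 N) (M0 N)) => s t _ st _.
    by rewrite primitiveB// ger0_norm// Ig_ge0.
  - move=> s t t0s st tT; rewrite -subr_ge0 opprD addrACA primitiveB//.
    have := yw s t 0 t0s st tT; rewrite dotv0r.
    have : Ig (running y 0) s t <= Ig eta s t.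
      by apply: Ig_le => // z _; exact: le_trans (ler_norm _) (runeta z).
    by clear; lra.
  - apply: (ae_S2 (ae_I (aeMe N) aeeta) (ae_I aerho aerun)).
    move=> t [[dM ME] [de eE]] [[dy yE] drun] /andP[t0t tT] e e0.
    have [i Mi] := maxseq_attained q N t; have [dr rE] := drun i.
    (* Four first-order expansions contribute [e / 4] each. That of [y] is taken with a smaller
       error because it is paired with [P i], the costate attaining the maximum at [t]. *)
    have e40 : 0 < e / 4 by rewrite divr_gt0.
    have p0 := enorm_ge0 (P i).
    have p1 : 0 < enorm (P i) + 1 by rewrite ltr_wpDl.
    have [d1 d10 h1] := derivable_right_real dM e40.
    have [d2 d20 h2] := derivable_right_real de e40.
    have [d3 d30 h3] := derivable_right_real dr e40.
    have [d4 d40 h4] := derivable_right dy (divr_gt0 e40 p1).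
    exists (Num.min (Num.min d1 d2) (Num.min d3 d4)); first by rewrite !lt_min d10 d20 d30 d40.
    move=> s ts sd sT; rewrite -ltrBlDl !lt_min in sd.
    move/andP: sd => [/andP[]]; rewrite !ltrBlDl => s1 s2 /andP[s3 s4].
    have {h1} := h1 s ts s1; have {h2} := h2 s ts s2; have {h3} := h3 s ts s3.
    have {h4} := h4 s ts s4; rewrite yE ME eE rE.
    have st0 : 0 <= s - t by rewrite subr_ge0 ltW.
    have := yw t s (P i) t0t (ltW ts) sT.
    rewrite -(primitiveB (run1 _) (ltW ts)) => h5 h4.
    have {h4} : - (e / 4 * (s - t)) <= dotv (y s - y t) (P i) - (s - t) * dotv (rho t) (P i).
      rewrite -dotvZl -dotvBl lerNl.
      have := normr_dotv_le (y s - y t - (s - t) *: rho t) (P i).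
      rewrite ler_norml => /andP[h6 _]; rewrite lerNl in h6; apply: le_trans h6 _.
      apply: le_trans (ler_wpM2r p0 h4) _.
      rewrite [leLHS]mulrAC ler_wpM2r// -mulrA ler_piMr ?(ltW e40)//.
      by rewrite ler_pdivrMl// mulr1 lerDl.
    by move: h5; rewrite /M Mi /q !ler_norml; clear; lra.
have ndM t : {homo M^~ t : N N' / (N <= N')%N >-> N <= N'}.
  by move=> N N' NN'; exact: maxseq_nondecreasing.
have [l [l1 lB ael]] := monotone_limit M1 eta1 M0 ndM MB.
exists rho, l; split => //.
  exact: (lipschitz_abs_cont t0 T gam1 gam0 speed).
apply: (ae_S2 aerho ael) => t dy Ml tT; split => // p.
apply/ler_addgt0Pr => e e0.
pose K := enorm (rho t) + gam t + 1.
have K0 : 0 < K by rewrite ltr_wpDl// addr_ge0 ?enorm_ge0.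
have [i ip] := dP p (e / K) (divr_gt0 e0 K0).
have h1 : q i t <= l t := le_trans (maxseq_ge _ _ (leqnn i)) (Ml tT i).
have h2 := dotv_le (rho t) (p - P i); rewrite dotvBr in h2.
have h3 := running_lip tame (P i) p yr t; rewrite /running enormC in h3.
have h4 : K * enorm (p - P i) <= e by rewrite mulrC -ler_pdivlMr// ltW.
have h5 := enorm_ge0 (p - P i).
move: h1 h4; rewrite /q /K /gam /running; lra.
Qed.

End ArcTrajectory.

(** * Limits of arcs *)

Section UltraLimit.
Context {R : realType} (U : set_system nat) {UU : UltraFilter U}.
Implicit Types (u v : nat -> R).

Definition tends {n : nat} (y : nat -> 'rV[R]_n) (x : 'rV[R]_n) :=
  forall e : R, 0 < e -> \forall i \near U, enorm (y i - x) < e.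

Definition tendsR (u : nat -> R) (l : R) :=
  forall e : R, 0 < e -> \forall i \near U, `|u i - l| < e.

Lemma near_le (a b : R) : (forall e : R, 0 < e -> \forall i \near U, a <= b + e) -> a <= b.
Proof. by move=> h; apply/ler_addgt0Pr => e /h/filter_ex[]. Qed.

(** The limit is the supremum of the eventual lower bounds; the upper half holds because an
    ultrafilter contains a set or its complement. A single ultrafilter serves all times at once,
    which replaces a selection theorem for the costs. *)
Lemma bounded_tendsR u (B : R) : (\forall i \near U, `|u i| <= B) -> exists l, tendsR u l.
Proof.
move=> uB; pose A : set R := [set a | \forall i \near U, a <= u i].
have A0 : A (- B).
  by apply: filterS uB => i; rewrite ler_norml => /andP[].
have Aub : has_ubound A.
  exists B => a Aa; have [i [ai iB]] := filter_ex (filterI Aa uB).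
  by apply: le_trans ai _; exact: le_trans (ler_norm _) iB.
have sA : has_sup A by split => //; exists (- B).
exists (sup A) => e e0.
have [a Aa ae] := sup_adherent e0 sA.
have : U [set i | u i < sup A + e].
  have [//|h] := in_ultra_setVsetC [set i | u i < sup A + e] UU.
  have : A (sup A + e) by apply: filterS h => i /= /negP; rewrite -leNgt.
  by move=> /(ub_le_sup Aub); rewrite gerDl leNgt e0.
move=> h; apply: filterS (filterI h Aa) => i /= [h1 h2].
by rewrite ltr_norml; apply/andP; split; lra.
Qed.

Lemma bounded_tends {n : nat} (y : nat -> 'rV[R]_n) (B : R) :
  (\forall i \near U, enorm (y i) <= B) -> exists x, tends y x.
Proof.
move=> yB; have /choice[l ul] : forall j : 'I_n, exists l, tendsR (fun i => y i ord0 j) l.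
  move=> j; apply: (@bounded_tendsR _ B); apply: filterS yB => i.
  by apply: le_trans; exact: normr_coord_le.
exists (\row_j l j) => e e0; have n0 : 0 < (n%:R : R) + 1 by rewrite ltr_wpDl.
have h j := ul j (e / (n%:R + 1)) (divr_gt0 e0 n0).
have /filter_forall hU := h; apply: filterS hU => i hi.
apply: le_lt_trans (enorm_le_sum _) _.
apply: (@le_lt_trans _ _ (\sum_(j < n) e / (n%:R + 1))).
  by apply: ler_sum => j _; rewrite !mxE; exact/ltW.
rewrite sumr_const card_ord -[ltLHS]mulr_natl mulrA ltr_pdivrMr//; lra.
Qed.

Lemma tends_enorm_le {n : nat} (y : nat -> 'rV[R]_n) x (B : R) :
  tends y x -> (\forall i \near U, enorm (y i) <= B) -> enorm x <= B.
Proof.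
move=> yx yB; apply: near_le => e /yx h; apply: filterS (filterI h yB) => i /= [h1 h2].
by have := enormB (y i) (y i - x); rewrite subKr; lra.
Qed.

Lemma tends_dist_le {n : nat} (y z : nat -> 'rV[R]_n) x x' (B : R) :
  tends y x -> tends z x' -> (\forall i \near U, enorm (y i - z i) <= B) ->
  enorm (x - x') <= B.
Proof.
move=> yx zx yz; apply: (tends_enorm_le _ yz) => e e0.
have e20 : 0 < e / 2 by rewrite divr_gt0.
apply: filterS (filterI (yx _ e20) (zx _ e20)) => i /= [h1 h2].
have -> : y i - z i - (x - x') = (y i - x) - (z i - x').
  by rewrite !opprD !opprK addrACA.
by have := enormB (y i - x) (z i - x'); lra.
Qed.

Lemma tends_unique {n : nat} (y : nat -> 'rV[R]_n) x x' : tends y x -> tends y x' -> x = x'.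
Proof.
move=> yx yx'; apply/eqP; rewrite -subr_eq0 -enorm_eq0 eq_le enorm_ge0 andbT.
by apply: (tends_dist_le yx yx'); apply: nearW => i; rewrite subrr enorm0.
Qed.

End UltraLimit.

Section ArcLimit.
Context {R : realType} {n : nat} {H : R -> 'rV[R]_n -> 'rV[R]_n -> R}.
Context {c : R -> R} {k : R -> R -> R} (tame : tame_hamiltonian H c k).
Local Notation running := (@running R n H).
Local Notation arc := (@arc R n H).
Implicit Types (x : R -> 'rV[R]_n) (p : 'rV[R]_n) (s t : R).

(** The time change [sig i] tends to the identity. The last hypothesis allows an approximating pair
    to be compared with any state [x] uniformly [delta]-close to it, at a price proportional to
    [delta]. This covers both uses: in [arc_closed], [sig i] clamps to a moving interval; in
    [filippov], it rounds to a grid and [y i] is a step function. *)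
Lemma arc_limit (U : set_system nat) {UU : UltraFilter U} (t0 T r K B : R)
    (y : nat -> R -> 'rV[R]_n) (v sig : nat -> R -> R) (gam : R -> R) (eps : nat -> R) :
  t0 <= T -> L1 gam -> 
  (forall i t, enorm (y i t) <= r) ->
  (forall i s t, t0 <= s -> s <= t -> t <= T ->
    enorm (y i t - y i s) <= primitive gam (sig i t) - primitive gam (sig i s)) ->
  (forall i s t, s <= t -> sig i s <= sig i t) ->
  (forall i t, t0 <= t <= T -> `|sig i t - t| <= eps i) -> tendsR U eps 0 ->
  (forall t, t0 <= t <= T -> \forall i \near U, `|v i t| <= B) ->
  (forall i x delta s t p, continuous x -> (forall t, enorm (x t) <= r) ->
    (forall t, t0 <= t <= T -> enorm (y i t - x t) <= delta) ->
    t0 <= s -> s <= t -> t <= T ->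
    dotv (y i t - y i s) p - (v i t - v i s) <=
      Ig (running x p) (sig i s) (sig i t) + (1 + enorm p) * (K * delta)) ->
  exists x w, [/\ arc t0 T x w,
    forall t, t0 <= t <= T -> tends U (y^~ t) (x t) &
    forall t, t0 <= t <= T -> tendsR U (v^~ t) (w t)].
Proof.
move=> t0T gam1 yr ygam ndsig sige eps0 vB yv.
have /choice[x0 yx0] : forall t, exists z, tends U (y^~ t) z.
  by move=> t; apply: (@bounded_tends _ _ _ _ _ r); apply: nearW.
have /choice[w vw] : forall t, exists z : R, t0 <= t <= T -> tendsR U (v^~ t) z.
  move=> t; have [tT|] := boolP (t0 <= t <= T); last by exists 0.
  by have [w vw] := bounded_tendsR (vB t tT); exists w.
pose x := x0 \o clamp t0 T.
have cl t : t0 <= clamp t0 T t <= T by exact: clamp_itv.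
have yx t : tends U (fun i => y i (clamp t0 T t)) (x t) by exact: yx0.
have yxT t : t0 <= t <= T -> tends U (y^~ t) (x t).
  by move=> tT; have := yx t; rewrite clamp_id.
have xr t : enorm (x t) <= r by apply: (tends_enorm_le (yx t)); exact: nearW.
have yequi (e : R) : 0 < e -> exists2 d : R, 0 < d & \forall i \near U, forall s t,
    t0 <= s <= T -> t0 <= t <= T -> `|t - s| < d -> enorm (y i t - y i s) <= e.
  move=> e0; have [d d0 dgam] := primitive_small gam1 e0.
  have d30 : 0 < d / 3 by rewrite divr_gt0.
  exists (d / 3) => //; apply: filterS (eps0 _ d30) => i; rewrite subr0 => epsd.
  have {}epsd := le_lt_trans (ler_norm _) epsd.
  suff key s t : t0 <= s <= T -> t0 <= t <= T -> s <= t -> `|t - s| < d / 3 ->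
      enorm (y i t - y i s) <= e.
    move=> s t sT tT std; have [/(key s t sT tT)|/ltW/(key t s tT sT)] := leP s t.
      exact.
    by rewrite distrC enormC; exact.
  move=> sT tT st std; have /andP[t0s _] := sT; have /andP[_ tT'] := tT.
  apply: le_trans (ygam i s t t0s st tT') _.
  apply: le_trans (ler_norm _) _; apply/ltW/dgam.
  have := sige i s sT; have := sige i t tT; move: std.
  by rewrite !ler_norml !ltr_norml; lra.
have xequi (e : R) : 0 < e -> exists2 d : R, 0 < d &
    forall s t, `|clamp t0 T t - clamp t0 T s| < d -> enorm (x t - x s) <= e.
  move=> e0; have [d d0 yd] := yequi e e0; exists d => // s t std.
  apply: (tends_dist_le (yx t) (yx s)); apply: filterS yd => i; apply => //.
have cx : continuous x.
  move=> t A /nbhs_enorm[e e0 eA]; have e20 : 0 < e / 2 by rewrite divr_gt0.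
  have [d d0 xd] := xequi _ e20.
  have [d' d'0 cd] := cts_near t (@continuous_clamp _ t0 T) d0.
  apply/nbhs_ballP; exists d' => //= s; rewrite /ball/= distrC => /cd sd; apply: eA.
  have := xd t s sd; rewrite enormC; lra.
(* Pointwise convergence and equicontinuity give uniform convergence by compactness of [t0, T]. *)
have unif (e : R) : 0 < e -> \forall i \near U, forall t, t0 <= t <= T -> enorm (y i t - x t) <= e.
  move=> e0; have e30 : 0 < e / 3 by rewrite divr_gt0.
  have [d d0 yd] := yequi _ e30; have [d' d'0 xd] := xequi _ e30.
  have h := (compact_near_coveringP _).1 (@segment_compact R t0 T) nat U
    (fun i t => t0 <= t <= T -> enorm (y i t - x t) <= e) _.
  apply: filterS (h _ _) => [i /= hi t tT|t].
    by apply: hi => //=; rewrite in_itv.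
  rewrite /= in_itv/= => tT.
  have [d2 d20 cd] := cts_near t (@continuous_clamp _ t0 T) d'0.
  have V := filterI yd (yxT t tT _ e30).
  exists ([set s | `|s - t| < Num.min d d2], [set i | (forall s t,
    t0 <= s <= T -> t0 <= t <= T -> `|t - s| < d -> enorm (y i t - y i s) <= e / 3) /\
    enorm (y i t - x t) < e / 3]) => /=.
    split; last exact: V.
    have : nbhs (t : R) [set s : R | `|s - t| < Num.min d d2].
      apply/nbhs_ballP; exists (Num.min d d2); first by rewrite /= lt_min d0.
      by move=> s; rewrite /ball/= distrC.
    by [].
  move=> [s i] [/=]; rewrite lt_min => /andP[s1 s2] [h1 h2] sT.
  have := h1 t s tT sT s1; have := xd s t; rewrite distrC => /(_ (cd s s2)) h3 h4.
  have := enormD (y i s - y i t) (y i t - x t); rewrite addrA subrK => h5.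
  have := enormD (y i s - x t) (x t - x s); rewrite addrA subrK; lra.
exists x, w; split => //; split => //; first by exists r.
move=> s t p t0s st tT; apply: near_le => e e0.
have p0 := enorm_ge0 p; have K0 := normr_ge0 K.
(* [D * d] collects the errors: two displacements paired with [p], two costs, two endpoints of the
   integral, and the price [K * d]. *)
pose D := 2 * enorm p + 4 + (1 + enorm p) * `|K|.
have D0 : 0 < D.
  have : 0 <= (1 + enorm p) * `|K| by rewrite mulr_ge0// addr_ge0.
  by rewrite /D; lra.
have [d d0 Dd] : exists2 d : R, 0 < d & D * d = e.
  by exists (e / D); [rewrite divr_gt0|rewrite mulrC divfK// lt0r_neq0].
have run1 : L1 (running x p) by exact: (running_L1 tame).
have [dd dd0 rdd] := primitive_small run1 d0.
have sT : t0 <= s <= T by rewrite t0s (le_trans st).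
have tT' : t0 <= t <= T by rewrite tT (le_trans t0s).
apply: filterS (filterI (filterI (unif _ d0) (eps0 _ dd0))
  (filterI (vw s sT _ d0) (vw t tT' _ d0))) => i [[/= hi ei] [/= h1 h2]].
have {}ei := le_lt_trans (ler_norm _) ei; rewrite subr0 in ei.
have h3 := rdd s (sig i s) (le_lt_trans (sige i s sT) ei).
have h4 := rdd t (sig i t) (le_lt_trans (sige i t tT') ei).
have := yv i x d s t p cx xr hi t0s st tT.
rewrite -(primitiveB run1 st) -(primitiveB run1 (ndsig i _ _ st)).
have h5 := dotv_le (x t - x s - (y i t - y i s)) p; rewrite dotvBl in h5.
have {h5} : dotv (x t - x s) p - dotv (y i t - y i s) p <= 2 * d * enorm p.
  apply: le_trans h5 _; apply: ler_wpM2r => //.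
  have -> : x t - x s - (y i t - y i s) = (y i s - x s) - (y i t - x t).
    by rewrite !opprD !opprK [LHS]addrC [RHS]addrC addrACA.
  have := hi s sT; have := hi t tT'; have := enormB (y i s - x s) (y i t - x t); lra.
have : (1 + enorm p) * (K * d) <= (1 + enorm p) * (`|K| * d).
  by rewrite ler_wpM2l ?addr_ge0// ler_wpM2r ?(ltW d0)// ler_norm.
move: h1 h2 h3 h4; rewrite !ltr_norml => /andP[a1 a2] /andP[a3 a4] /andP[a5 a6] /andP[a7 a8].
by move: Dd; rewrite /D; lra.
Qed.


Lemma arc_clamp t0 T x w : t0 <= T -> arc t0 T x w ->
  arc t0 T (x \o clamp t0 T) (w \o clamp t0 T).
Proof.
move=> t0T [cx [r xr] xw]; split; last 1 first.
- move=> s t p t0s st tT; have sT := le_trans st tT; have t0t := le_trans t0s st.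
  rewrite /= !clamp_id ?t0s ?t0t//; apply: le_trans (xw s t p t0s st tT) _.
  rewrite (@eq_Ig _ (running x p) (running (x \o clamp t0 T) p))// => q /andP[sq qt].
  by rewrite /running/= clamp_id// (le_trans t0s sq) (le_trans qt tT).
- by move=> t; exact: continuous_comp (@continuous_clamp _ t0 T t) (cx _).
- by exists r => t; exact: xr.
Qed.

Lemma arc_clamp_bound t0 T x w b A : t0 <= T -> arc t0 T x w -> enorm (x t0) <= b ->
  primitive c T - primitive c t0 <= A ->
  forall t, enorm (x (clamp t0 T t)) <= (1 + b) * expR (2 * A).
Proof.
move=> t0T ax xb cA t; have tT := clamp_itv t t0T; have := arc_bound tame ax tT.
have b0 := enorm_ge0 (x t0).
have : (1 + enorm (x t0)) * expR (2 * (primitive c (clamp t0 T t) - primitive c t0)) <=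
    (1 + b) * expR (2 * A).
  apply: ler_pM => //; rewrite ?addr_ge0 ?expR_ge0 ?lerD2l// ler_expR ler_wpM2l//.
  apply: le_trans cA; rewrite lerD2r; apply: primitive_nondecreasing.
  - exact: (tame_c_L1 tame).
  - exact: (tame_c_ge0 tame).
  - by case/andP: tT.
lra.
Qed.

(** It bounds |H(t, x, 0)| for |x| <= r; through the arc inequality at p = 0, its negative bounds
    the growth of the cost from below. *)
Definition running_lower r t := `|H t 0 0| + k r t * r.

Lemma running_lower_L1 r : L1 (running_lower r).
Proof.
by apply: L1D; [exact: L1_norm (tame_0 tame)|apply: L1Zr; exact: (tame_k_L1 tame)].
Qed.

Lemma running_lower_ge0 r t : 0 <= r -> 0 <= running_lower r t.
Proof. by move=> r0; rewrite addr_ge0// mulr_ge0// (tame_k_ge0 tame). Qed.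

Lemma arc_cost_ge t0 T x w r s t : arc t0 T x w -> (forall t, enorm (x t) <= r) ->
  t0 <= s -> s <= t -> t <= T -> - Ig (running_lower r) s t <= w t - w s.
Proof.
move=> ax xr t0s st tT; have [_ _ xw] := ax.
have := xw s t 0 t0s st tT; rewrite dotv0r.
have : Ig (running x 0) s t <= Ig (running_lower r) s t.
  apply: Ig_le; [exact: (arc_running tame _ ax)|exact: running_lower_L1|].
  move=> z _; apply: le_trans (ler_norm _) _; exact: (running_ge tame).
lra.
Qed.

(** The initial times may approach [t0] from either side, so each pair is frozen outside [t_ i, T]
    and its cost counted from [t_ i] before the limit is taken. *)
Lemma arc_closed (U : set_system nat) {UU : UltraFilter U} (t0 T B : R) (x0 : 'rV[R]_n)
    (t_ : nat -> R) (x_ : nat -> R -> 'rV[R]_n) (w_ : nat -> R -> R) :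
  t0 <= T -> (forall i, t_ i <= T) -> tendsR U t_ t0 -> (forall i, `|t_ i - t0| <= 1) ->
  (forall i, arc (t_ i) T (x_ i) (w_ i)) -> tends U (fun i => x_ i (t_ i)) x0 ->
  (forall i, enorm (x_ i (t_ i) - x0) <= 1) ->
  (\forall i \near U, w_ i T - w_ i (t_ i) <= B) ->
  exists x w, [/\ arc t0 T x w, x t0 = x0, tends U (fun i => x_ i T) (x T) &
    forall e : R, 0 < e -> \forall i \near U, w T - w t0 <= w_ i T - w_ i (t_ i) + e].
Proof.
move=> t0T t_T tt0 t_1 ax xx0 x_1 wB.
have c1 := tame_c_L1 tame; have c0 := tame_c_ge0 tame.
pose r := (1 + (enorm x0 + 1)) * expR (2 * (primitive c T - primitive c (t0 - 1))).
have t0i i : t0 - 1 <= t_ i by have := t_1 i; rewrite ler_norml; lra.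
pose y i := x_ i \o clamp (t_ i) T.
pose v i t := w_ i (clamp (t_ i) T t) - w_ i (t_ i).
have yr i t : enorm (y i t) <= r.
  apply: (arc_clamp_bound (t_T i) (ax i)).
    by have := enormD (x_ i (t_ i) - x0) x0; rewrite subrK; have := x_1 i; lra.
  by rewrite lerD2l lerN2; apply: primitive_nondecreasing.
have r0 : 0 <= r := le_trans (enorm_ge0 _) (yr 0%N 0).
have ay i : arc (t_ i) T (y i) (w_ i \o clamp (t_ i) T) by exact: arc_clamp.
pose gam t := c t * (1 + r).
have gam1 : L1 gam by exact: L1Zr.
have ygam i s t : t_ i <= s -> s <= t -> t <= T -> enorm (y i t - y i s) <= Ig gam s t.
  move=> tis st tT; rewrite IgZr// mulrC; apply: (arc_speed tame (ay i)) => // q _.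
  by rewrite lerD2l.
have ycl i t : y i t = y i (clamp (t_ i) T t).
  by rewrite /y/= (@clamp_id _ _ _ (clamp (t_ i) T t))//; exact: clamp_itv.
have clle i t : clamp (t_ i) T t <= T by have /andP[] := clamp_itv t (t_T i).
have clge i t : t_ i <= clamp (t_ i) T t by have /andP[] := clamp_itv t (t_T i).
have cle i t : t0 <= t <= T -> `|clamp (t_ i) T t - t| <= `|t_ i - t0|.
  move=> /andP[t0t tT]; rewrite /clamp (min_idPr tT); have [h|h] := leP t (t_ i).
    rewrite !ger0_norm ?subr_ge0//; last exact: le_trans h.
    by rewrite lerD2l lerN2.
  by rewrite subrr normr0.
pose eta := running_lower r.
have eta1 : L1 eta by exact: running_lower_L1.
have eta0 t : 0 <= eta t by exact: running_lower_ge0.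
have vlow i s t : s <= t -> - Ig eta (clamp (t_ i) T s) (clamp (t_ i) T t) <= v i t - v i s.
  move=> st; rewrite /v opprB addrA subrK.
  have := arc_cost_ge (ay i) (yr i) (clge i s) (clamp_le _ _ st) (clle i t).
  by rewrite /= ![clamp _ _ (clamp _ _ _)]clamp_id ?clge ?clle.
pose E := primitive eta T - primitive eta (t0 - 1).
have etaE i s t : s <= t -> Ig eta (clamp (t_ i) T s) (clamp (t_ i) T t) <= E.
  move=> st; rewrite -primitiveB//; last exact: clamp_le.
  apply: lerB; apply: primitive_nondecreasing => //.
  exact: le_trans (t0i i) (clge i s).
have vti i : v i (t_ i) = 0 by rewrite /v clamp_id ?lexx ?t_T// subrr.
have vt0 i t : t <= t_ i -> v i t = 0.
  move=> tti; rewrite /v (_ : clamp (t_ i) T t = t_ i) ?subrr//.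
  by apply/max_idPl; rewrite ge_min tti orbT.
have vE i t : - E <= v i t.
  have [h|/ltW h] := leP t (t_ i).
    by rewrite vt0// oppr_le0; apply: le_trans (etaE i _ _ (lexx 0)); exact: Ig_ge0.
  by have := vlow i _ _ h; have := etaE i _ _ h; rewrite vti; lra.
have vT i : v i T = w_ i T - w_ i (t_ i).
  by rewrite /v clamp_id ?lexx ?t_T.
have [||||||x [w [axw xlim wlim]]] := @arc_limit U UU t0 T r (Ig (k r) t0 T) (`|B| + E) y v
  (fun i => clamp (t_ i) T) gam (fun i => `|t_ i - t0|) t0T gam1 yr.
- move=> i s t t0s st tT; rewrite primitiveB//; last exact: clamp_le.
  by rewrite (ycl i t) (ycl i s); apply: ygam; rewrite ?clamp_le.
- by move=> i s t; exact: clamp_le.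
- by move=> i t tT; exact: cle.
- by move=> e /tt0; apply: filterS => i; rewrite subr0 normr_id.
- move=> t /andP[t0t tT]; apply: filterS wB => i; rewrite -vT => vB.
  have := vlow i _ _ tT; have := etaE i _ _ tT; have := vE i t.
  by have := ler_norm B; have := normr_ge0 B; rewrite ler_norml; lra.
- move=> i x delta s t p cx xr yx t0s st tT.
  set s' := clamp (t_ i) T s; set t' := clamp (t_ i) T t.
  have st' : s' <= t' by exact: clamp_le.
  have [_ _ yw] := ay i; have := yw s' t' p (clge i s) st' (clle i t).
  rewrite -!ycl /= !(@clamp_id _ _ _ (clamp _ _ _)) ?clge ?clle// => h.
  have -> : v i t - v i s = w_ i t' - w_ i s' by rewrite /v opprB addrA subrK.
  apply: le_trans h _.
  have run1 z : continuous z -> (forall t, enorm (z t) <= r) -> L1 (running z p).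
    by move=> *; exact: (running_L1 tame).
  have k1 := tame_k_L1 tame r; have k0 := tame_k_ge0 tame r.
  have [cy _ _] := ay i.
  have t0s' : t0 <= s' by apply: le_trans t0s _; rewrite /s' /clamp le_max le_min lexx (le_trans st tT) orbT.
  have h : Ig (running (y i) p) s' t' <=
      Ig (fun q => running x p q + k r q * ((1 + enorm p) * delta)) s' t'.
    apply: Ig_le; [exact: run1|by apply: L1D; [exact: run1|exact: L1Zr]|].
    move=> q /andP[sq qt]; have qT : t0 <= q <= T.
      by rewrite (le_trans t0s' sq) (le_trans qt (clle i t)).
    have := tame_lip_x tame q p (yr i q) (xr q).
    have : k r q * (1 + enorm p) * enorm (y i q - x q) <= k r q * ((1 + enorm p) * delta).
      by rewrite -mulrA ler_wpM2l// ler_wpM2l ?addr_ge0 ?enorm_ge0// yx.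
    by rewrite /running ler_norml; lra.
  rewrite IgD ?IgZr// in h; [|exact: run1|exact: L1Zr].
  apply: le_trans h _; rewrite lerD2l mulrCA ler_wpM2l ?addr_ge0 ?enorm_ge0//.
  have d0 : 0 <= delta by apply: le_trans (yx t0 _); rewrite ?enorm_ge0// lexx.
  apply: ler_wpM2r => //; rewrite -!primitiveB//; apply: lerB; apply: primitive_nondecreasing => //.
  exact: clle.
have t0T' : t0 <= t0 <= T by rewrite lexx.
have TT : t0 <= T <= T by rewrite t0T lexx.
have near_start f (e : R) : L1 f -> (forall t, 0 <= f t) -> 0 < e ->
    \forall i \near U, Ig f (t_ i) (clamp (t_ i) T t0) <= e.
  move=> f1 f0 e0; have [d d0 fd] := primitive_small f1 e0.
  apply: filterS (tt0 d d0) => i hi; rewrite -primitiveB//.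
  apply: le_trans (ler_norm _) _; apply/ltW/fd; apply: le_lt_trans hi.
  rewrite /clamp (min_idPr t0T); have [h|h] := leP t0 (t_ i); first by rewrite subrr normr0.
  by rewrite distrC.
exists x, w; split => //.
- apply: (tends_unique (xlim t0 t0T')) => e e0; have e30 : 0 < e / 3 by rewrite divr_gt0.
  have gam0 t : 0 <= gam t by rewrite mulr_ge0 ?addr_ge0.
  apply: filterS (filterI (near_start _ _ gam1 gam0 e30) (xx0 _ e30)) => i [/= h1 h2].
  have := ygam i _ _ (lexx _) (clge i t0) (clle i t0); rewrite -ycl => h3.
  have := enormD (y i t0 - y i (t_ i)) (y i (t_ i) - x0); rewrite addrA subrK.
  have yt : y i (t_ i) = x_ i (t_ i) by rewrite /y/= clamp_id ?lexx ?t_T.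
  by rewrite yt in h3 *; lra.
- move=> e /(xlim T TT); apply: filterS => i; by rewrite /y/= clamp_id ?t_T ?lexx.
- move=> e e0; have e30 : 0 < e / 3 by rewrite divr_gt0.
  apply: filterS (filterI (near_start _ _ eta1 eta0 e30)
    (filterI (wlim T TT _ e30) (wlim t0 t0T' _ e30))) => i [/= h1 [h2 h3]].
  (* If [t_ i < t0], the cost spent on [t_ i, t0] is dropped by the limit arc. It has no small upper
     bound, but it is at least a small negative number, which is the direction needed. *)
  have : - (e / 3) <= v i t0.
    have [h|/ltW h] := leP t0 (t_ i); first by rewrite vt0//; lra.
    by have := vlow i _ _ h; rewrite vti [clamp _ _ (t_ i)]clamp_id ?lexx ?t_T//; lra.
  by move: h2 h3; rewrite vT !ltr_norml; lra.
Qed.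

End ArcLimit.

(** * Filippov's theorem *)

Section Euler.
Context {R : realType} {n : nat} {H : R -> 'rV[R]_n -> 'rV[R]_n -> R}.
Context {c : R -> R} {k : R -> R -> R} (tame : tame_hamiltonian H c k).
Local Notation running := (@running R n H).
Local Notation arc := (@arc R n H).
Implicit Types (x : R -> 'rV[R]_n) (p z : 'rV[R]_n) (s t : R).

Lemma running_cst_L1 z p : L1 (running (fun=> z) p).
Proof. by apply: (@running_L1 _ _ _ _ _ tame _ _ (enorm z)) => // t; exact: cvg_cst. Qed.

Lemma convexf_Ig z s t : convexf (fun p => Ig (running (fun=> z) p) s t).
Proof.
move=> p q lam lam01; have L := running_cst_L1 z.
rewrite -!IgZ// -IgD; [|exact: L1Z|exact: L1Z].
apply: Ig_le => //; first by apply: L1D; exact: L1Z.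
by move=> tau _; exact: (tame_convex tame).
Qed.

(* In each cell the frozen Hamiltonian [Ig (running (fun=> z) p)] is convex in [p]
   and the increments of the reference arc almost lie below it, so the sandwich
   theorem moves them, at a controlled price, to increments that do. *)
Lemma euler_step s t z (X : 'rV[R]_n) (b r : R) : s <= t -> 0 <= r ->
  (forall p, dotv X p - b <= Ig (running (fun=> z) p) s t + (1 + enorm p) * r) ->
  exists Y, [/\ enorm (Y - X) <= r,
    forall p, dotv Y p - (b + r) <= Ig (running (fun=> z) p) s t &
    enorm Y <= Ig c s t * (1 + enorm z)].
Proof.
move=> st r0 Xb.
have [|Y [YX Yb]] := @convexf_sandwich _ _ _ X (b + r) r (@convexf_Ig z s t) r0.
  by move=> p; have := Xb p; lra.
exists Y; split => //.
have c1 := tame_c_L1 tame; have c0 := tame_c_ge0 tame.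
have C0 : 0 <= Ig c s t by exact: Ig_ge0.
apply: enorm_le_dotv; first by rewrite mulr_ge0// addr_ge0 ?enorm_ge0.
move=> p; rewrite -subr_le0; apply: (@scaled_le0 _ _ (b + r + Ig (running (fun=> z) 0) s t)).
move=> lam lam0; have := Yb (lam *: p).
have : Ig (running (fun=> z) (lam *: p)) s t <=
    Ig (fun tau => running (fun=> z) 0 tau + c tau * ((1 + enorm z) * (lam * enorm p))) s t.
  apply: Ig_le; [exact: running_cst_L1| |].
    by apply: L1D; [exact: running_cst_L1|exact: L1Zr].
  move=> tau _; have := running_lip tame (lam *: p) 0 (x := fun=> z) (fun=> lexx _) tau.
  by rewrite subr0 enormZ (gtr0_norm lam0).
rewrite IgD ?IgZr//; [|exact: running_cst_L1|exact: L1Zr].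
by rewrite dotvZr; lra.
Qed.

(** [E] is the amount by which the reference pair may fail to be an arc, as happens for the
    extension in [arc_extend_left]; [om] bounds the oscillation of [x] over one cell. [M] comes from
    a discrete Gronwall estimate for the distance to [x]. *)
Lemma euler_scheme (t1 T h : R) (m : nat) x w (E : R -> R) (x1 : 'rV[R]_n) (rad om M : R) :
  0 <= h -> m%:R * h = T - t1 -> 0 <= om -> continuous x ->
  (forall t, enorm (x t) <= rad) ->
  (1 + enorm x1) * expR (primitive c T - primitive c t1) <= rad ->
  (forall s t, s <= t -> t - s <= h -> enorm (x t - x s) <= om) ->
  {homo E : s t / s <= t} ->
  (forall s t p, t1 <= s -> s <= t -> t <= T ->
    dotv (x t - x s) p - (w t - w s) <= Ig (running x p) s t + (1 + enorm p) * (E t - E s)) ->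
  expR (primitive (k rad) T - primitive (k rad) t1) *
    (enorm (x1 - x t1) + om + (E T - E t1)) <= M ->
  exists (y : nat -> 'rV[R]_n) (v : nat -> R), let grid j := t1 + j%:R * h in
    [/\ y 0%N = x1 /\ v 0%N = w t1,
     forall j, (j < m)%N ->
       (forall p, dotv (y j.+1 - y j) p - (v j.+1 - v j) <=
         Ig (running (fun=> y j) p) (grid j) (grid j.+1)) /\
       enorm (y j.+1 - y j) <= Ig c (grid j) (grid j.+1) * (1 + rad),
     forall j, (j <= m)%N -> enorm (y j) <= rad,
     forall j, (j <= m)%N -> enorm (y j - x (grid j)) <= M &
     forall j, (j <= m)%N -> w (grid j) <= v j /\
       v j <= w (grid j) + (primitive (k rad) T - primitive (k rad) t1) * M + (E T - E t1)].
Proof.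
move=> h0 mh om0 cx xr x1r xom ndE xw leM.
have [grid gridE] : exists grid : nat -> R, forall j, grid j = t1 + j%:R * h.
  by exists (fun j => t1 + j%:R * h).
have grid0 : grid 0%N = t1 by rewrite gridE mul0r addr0.
have gridS j : grid j.+1 = grid j + h by rewrite !gridE -natr1 mulrDl mul1r addrA.
have gridm : grid m = T by rewrite gridE mh addrC subrK.
have ndgrid : {homo grid : i j / (i <= j)%N >-> i <= j}.
  by move=> i j ij; rewrite !gridE lerD2l ler_wpM2r// ler_nat.
have gridT j : (j <= m)%N -> t1 <= grid j <= T.
  by move=> jm; rewrite -{1}grid0 -gridm !ndgrid.
have c1 := tame_c_L1 tame; have c0 := tame_c_ge0 tame.
have k1 := tame_k_L1 tame rad; have k0 := tame_k_ge0 tame rad.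
have [r rE] : exists r : nat -> 'rV[R]_n -> R, forall j z, r j z =
    Ig (k rad) (grid j) (grid j.+1) * (enorm (z - x (grid j)) + om) +
    (E (grid j.+1) - E (grid j)).
  by exists (fun j z => Ig (k rad) (grid j) (grid j.+1) * (enorm (z - x (grid j)) + om) +
    (E (grid j.+1) - E (grid j))).
have dE0 j : 0 <= E (grid j.+1) - E (grid j) by rewrite subr_ge0; apply/ndE/ndgrid.
have r0 j z : 0 <= r j z.
  by rewrite rE addr_ge0// mulr_ge0 ?addr_ge0 ?enorm_ge0//; exact: Ig_ge0.
(* The bounds on [j] and [z] are premises under the existential, with 0 as default value, so that a
   total choice function can be iterated. *)
have step j z : exists Y, (j < m)%N -> enorm z <= rad ->
   [/\ enorm (Y - (x (grid j.+1) - x (grid j))) <= r j z,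
    forall p, dotv Y p - (w (grid j.+1) - w (grid j) + r j z) <=
      Ig (running (fun=> z) p) (grid j) (grid j.+1) &
    enorm Y <= Ig c (grid j) (grid j.+1) * (1 + enorm z)].
  have [jm|] := boolP (j < m)%N; last by exists 0.
  have [zr|] := boolP (enorm z <= rad); last by exists 0.
  have gj : grid j <= grid j.+1 by exact: ndgrid.
  have /andP[t1j _] := gridT j (ltnW jm); have /andP[_ jT] := gridT _ jm.
  have [|Y [Y1 Y2 Y3]] := @euler_step (grid j) (grid j.+1) z
    (x (grid j.+1) - x (grid j)) (w (grid j.+1) - w (grid j)) (r j z) gj (r0 j z).
    move=> p; apply: le_trans (xw _ _ p t1j gj jT) _.
    have e0 := enorm_ge0 p.
    have : Ig (running x p) (grid j) (grid j.+1) <=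
      Ig (fun tau => running (fun=> z) p tau +
        k rad tau * ((1 + enorm p) * (enorm (z - x (grid j)) + om))) (grid j) (grid j.+1).
      apply: Ig_le; [exact: (running_L1 tame)| |].
        by apply: L1D; [exact: running_cst_L1|exact: L1Zr].
      move=> tau /andP[jtau tauj]; have := tame_lip_x tame tau p (xr tau) zr.
      have : k rad tau * (1 + enorm p) * enorm (x tau - z) <=
        k rad tau * ((1 + enorm p) * (enorm (z - x (grid j)) + om)).
        rewrite -mulrA ler_wpM2l// ler_wpM2l ?addr_ge0//.
        have := xom (grid j) tau jtau; rewrite lerBlDl -gridS => /(_ tauj).
        have := enormB (x tau - x (grid j)) (z - x (grid j)).
        by rewrite opprB addrA subrK; clear; lra.
      by rewrite /running ler_norml; clear; lra.
    rewrite IgD ?IgZr//; [|exact: running_cst_L1|exact: L1Zr].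
    by rewrite rE; clear; lra.
  by exists Y.
have /choice[St StP] : forall jz : nat * 'rV[R]_n, exists Y, (jz.1 < m)%N ->
   enorm jz.2 <= rad -> [/\
    enorm (Y - (x (grid jz.1.+1) - x (grid jz.1))) <= r jz.1 jz.2,
    forall p, dotv Y p - (w (grid jz.1.+1) - w (grid jz.1) + r jz.1 jz.2) <=
      Ig (running (fun=> jz.2) p) (grid jz.1) (grid jz.1.+1) &
    enorm Y <= Ig c (grid jz.1) (grid jz.1.+1) * (1 + enorm jz.2)].
  by move=> [j z]; exact: step.
have [y [y0 yS]] : exists y : nat -> 'rV[R]_n,
    y 0%N = x1 /\ forall j, y j.+1 = y j + St (j, y j).
  by exists (fix y (j : nat) := if j is j'.+1 then y j' + St (j', y j') else x1).
pose v j := w (grid j) + \sum_(i < j) r i (y i).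
have yrad j : (j <= m)%N ->
    1 + enorm (y j) <= (1 + enorm x1) * expR (primitive c (grid j) - primitive c t1) /\
    enorm (y j) <= rad.
  have fin z j' : 1 + enorm z <= (1 + enorm x1) * expR (primitive c (grid j') - primitive c t1) ->
      (j' <= m)%N -> enorm z <= rad.
    move=> hz jm; have zz : enorm z <= 1 + enorm z by rewrite lerDr.
    apply: le_trans zz (le_trans hz (le_trans _ x1r)).
    apply: ler_wpM2l; first by apply: addr_ge0 => //; exact: enorm_ge0.
    rewrite ler_expR lerD2r; apply: primitive_nondecreasing => //.
    by have /andP[] := gridT _ jm.
  elim: j => [_|j IH jm].
    have h1 : 1 + enorm (y 0%N) <=
      (1 + enorm x1) * expR (primitive c (grid 0%N) - primitive c t1).
      by rewrite y0 grid0 subrr expR0 mulr1.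
    by split => //; exact: fin h1 _.
  have [h1 h2] := IH (ltnW jm); have [_ _ h3] := StP (j, y j) jm h2.
  suff h4 : 1 + enorm (y j.+1) <=
    (1 + enorm x1) * expR (primitive c (grid j.+1) - primitive c t1).
    by split => //; exact: fin h4 _.
  rewrite (_ : _ - _ = (primitive c (grid j) - primitive c t1) +
     (primitive c (grid j.+1) - primitive c (grid j))); last by rewrite [RHS]addrC addrA subrK.
  rewrite expRD mulrA (primitiveB c1 (ndgrid j j.+1 (leqnSn j))).
  apply: le_trans (ler_wpM2r (expR_ge0 _) h1).
  apply: (@le_trans _ _ ((1 + enorm (y j)) * (1 + Ig c (grid j) (grid j.+1)))).
    by have := enormD (y j) (St (j, y j)); rewrite yS; move: h3 => /=; clear; lra.
  by rewrite ler_wpM2l ?addr_ge0 ?enorm_ge0// expR_ge1Dx.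
have SP j : (j < m)%N -> _ := fun jm => StP (j, y j) jm (yrad j (ltnW jm)).2.
have ySB j : y j.+1 - y j = St (j, y j) by rewrite yS addrC addKr.
have vSB j : v j.+1 - v j = w (grid j.+1) - w (grid j) + r j (y j).
  by rewrite /v big_ord_recr/=; clear; lra.
pose KK j := primitive (k rad) (grid j) - primitive (k rad) t1.
have ndKK j : (j <= m)%N -> KK j <= KK m.
  by move=> jm; rewrite lerD2r; apply: primitive_nondecreasing => //; exact: ndgrid.
have KK0 j : 0 <= KK j.
  rewrite subr_ge0; apply: primitive_nondecreasing => //.
  by rewrite -grid0; exact: ndgrid.
have KKS j : KK j.+1 = KK j + Ig (k rad) (grid j) (grid j.+1).
  by rewrite -(primitiveB k1 (ndgrid j j.+1 (leqnSn j))) /KK; clear; lra.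
have EE0 j : 0 <= E (grid j) - E t1.
  by rewrite subr_ge0 -{1}grid0; apply/ndE/ndgrid.
(* Including [om] makes the price exactly [kap * a j] plus an increment of [E], so that [a]
   satisfies a plain discrete Gronwall recurrence. *)
pose a j := enorm (y j - x (grid j)) + om.
have a0 j : 0 <= a j by rewrite addr_ge0 ?enorm_ge0.
have aP j : (j <= m)%N -> a j <= expR (KK j) * (a 0%N + (E (grid j) - E t1)).
  elim: j => [_|j IH jm].
    by rewrite /KK grid0 !subrr expR0 mul1r addr0.
  have h1 := IH (ltnW jm); have [h2 _ _] := SP j jm.
  have h3 : a j.+1 <= a j + r j (y j).
    rewrite /a; have := enormD (y j - x (grid j)) (St (j, y j) - (x (grid j.+1) - x (grid j))).
    rewrite (_ : _ + _ = y j.+1 - x (grid j.+1)); last first.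
      by rewrite yS opprB addrACA addKr.
    by move: h2 => /=; clear; lra.
  have ex1 : 1 <= expR (KK j.+1) by rewrite -expR0 ler_expR.
  set kap := Ig (k rad) (grid j) (grid j.+1) in KKS *.
  have h4 : (1 + kap) * a j <= expR (KK j.+1) * (a 0%N + (E (grid j) - E t1)).
    apply: (@le_trans _ _ (expR kap * a j)); first by rewrite ler_wpM2r ?expR_ge1Dx.
    rewrite KKS (addrC (KK j)) expRD -mulrA ler_wpM2l ?expR_ge0//.
  have h5 := ler_wpM2r (dE0 j) ex1; rewrite mul1r in h5.
  by move: h3 h4 h5; rewrite rE -/kap -/(a j); clear; lra.
have aM j : (j <= m)%N -> a j <= M.
  move=> jm; apply: le_trans (aP j jm) (le_trans _ leM).
  rewrite /a grid0 y0 -gridm; apply: ler_pM.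
  - exact: expR_ge0.
  - by apply: addr_ge0; [exact: addr_ge0 (enorm_ge0 _) om0|exact: EE0].
  - by rewrite ler_expR; exact: ndKK.
  - by rewrite lerD2l lerD2r; apply/ndE/ndgrid.
have M0 : 0 <= M := le_trans (a0 0%N) (aM 0%N (leq0n m)).
have rsum j : (j <= m)%N ->
    0 <= \sum_(i < j) r i (y i) /\ \sum_(i < j) r i (y i) <= KK j * M + (E (grid j) - E t1).
  elim: j => [_|j IH jm]; first by rewrite big_ord0 /KK grid0 !subrr mul0r addr0.
  have [h1 h2] := IH (ltnW jm); rewrite big_ord_recr/= addr_ge0//; split => //.
  have := ler_wpM2l (Ig_ge0 (grid j) (grid j.+1) k0) (aM j (ltnW jm)).
  by move: h2; rewrite KKS /a rE; clear; lra.
exists y, v => g; have -> : g = grid by apply/funext => j; rewrite gridE.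
split.
- by split => //; rewrite /v grid0 big_ord0 addr0.
- move=> j jm; rewrite ySB vSB; have [_ h2 h3] := SP j jm; split => //.
  apply: le_trans h3 _; rewrite ler_wpM2l ?Ig_ge0// lerD2l.
  exact: (yrad j (ltnW jm)).2.
- by move=> j /yrad[].
- by move=> j /aM; apply: le_trans; rewrite lerDl.
- move=> j jm; have [h1 h2] := rsum j jm; rewrite /v.
  have h3 := ler_wpM2r M0 (ndKK j jm).
  have h4 : E (grid j) <= E (grid m) by apply/ndE/ndgrid.
  by rewrite /KK gridm in h3; rewrite gridm in h4; move: h2; rewrite /KK; lra.
Qed.

End Euler.

Section Filippov.
Context {R : realType} {n : nat} {H : R -> 'rV[R]_n -> 'rV[R]_n -> R}.
Context {c : R -> R} {k : R -> R -> R} (tame : tame_hamiltonian H c k).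
Local Notation running := (@running R n H).
Local Notation running_lower := (@running_lower R n H k).
Local Notation arc := (@arc R n H).
Implicit Types (x : R -> 'rV[R]_n) (p z : 'rV[R]_n) (s t : R).

(** The Euler polygons for meshes tending to 0 satisfy bounds independent of the mesh; their limit
    along an ultrafilter is an exact arc which keeps these bounds. *)
Lemma filippov (t1 T : R) x w (E : R -> R) (x1 : 'rV[R]_n) (rad om M d : R) :
  t1 < T -> 0 <= om -> continuous x -> (forall t, enorm (x t) <= rad) ->
  (1 + enorm x1) * expR (primitive c T - primitive c t1) <= rad ->
  0 < d -> (forall s t, s <= t -> t - s < d -> enorm (x t - x s) <= om) ->
  {homo E : s t / s <= t} ->
  (forall s t p, t1 <= s -> s <= t -> t <= T ->
    dotv (x t - x s) p - (w t - w s) <= Ig (running x p) s t + (1 + enorm p) * (E t - E s)) ->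
  expR (primitive (k rad) T - primitive (k rad) t1) *
    (enorm (x1 - x t1) + om + (E T - E t1)) <= M ->
  exists y v, [/\ arc t1 T y v, y t1 = x1, enorm (y T - x T) <= M &
    v T - v t1 <=
      w T - w t1 + (primitive (k rad) T - primitive (k rad) t1) * M + (E T - E t1)].
Proof.
move=> t1T om0 cx xr x1r d0 xom ndE xw leM.
have tT1 : 0 < T - t1 by rewrite subr_gt0.
have c1 := tame_c_L1 tame; have c0 := tame_c_ge0 tame.
have k1 := tame_k_L1 tame rad; have k0 := tame_k_ge0 tame rad.
have rad0 : 0 <= rad := le_trans (enorm_ge0 _) (xr 0).
(* The offset [N0] makes every mesh smaller than [d], where the oscillation bound [om] holds; the
   index [i] drives the mesh to 0. *)
pose N0 := Num.truncn ((T - t1) / d).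
pose m i := (i + N0).+1.
have [h hE] : exists h : nat -> R, forall i, h i = (T - t1) / (m i)%:R.
  by exists (fun i => (T - t1) / (m i)%:R).
have h0 i : 0 < h i by rewrite hE divr_gt0.
have mh i : (m i)%:R * h i = T - t1 by rewrite hE mulrC divfK// pnatr_eq0.
have hlt (e : R) i : 0 < e -> (Num.truncn ((T - t1) / e) <= i + N0)%N -> h i < e.
  move=> e0 ei; rewrite hE ltr_pdivrMr// mulrC -ltr_pdivrMr//.
  apply: (lt_le_trans (truncnS_gt _)); by rewrite ler_nat ltnS.
have hd i : h i < d by apply: hlt => //; exact: leq_addl.
pose KT := primitive (k rad) T - primitive (k rad) t1.
have xomh i s t : s <= t -> t - s <= h i -> enorm (x t - x s) <= om.
  by move=> st sth; apply: xom => //; exact: le_lt_trans sth (hd i).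
have /choice[y /choice[v yvP]] : forall i, _ := fun i => @euler_scheme _ _ _ _ _ tame t1 T
  (h i) (m i) x w E x1 rad om M (ltW (h0 i)) (mh i) om0 cx xr x1r (xomh i) ndE xw leM.
pose grid i j : R := t1 + j%:R * h i.
have ndgrid i : {homo grid i : j j' / (j <= j')%N >-> j <= j'}.
  by move=> j j' jj; rewrite /grid lerD2l ler_wpM2r ?(ltW (h0 i))// ler_nat.
have gridm i : grid i (m i) = T by rewrite /grid mh addrC subrK.
have grid0 i : grid i 0%N = t1 by rewrite /grid mul0r addr0.
have gridT i j : (j <= m i)%N -> t1 <= grid i j <= T.
  by move=> jm; rewrite -{1}(grid0 i) -(gridm i) !ndgrid.
(* The cap at [m i] keeps the index in range for all real [t], since the state bound in [arc_limit]
   is stated at all times. *)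
pose cell i t := minn (Num.truncn ((t - t1) / h i)) (m i).
have cellm i t : (cell i t <= m i)%N by exact: geq_minr.
have cellE i t j : (j < m i)%N -> grid i j <= t -> t < grid i j.+1 -> cell i t = j.
  move=> jm jt tj; rewrite /cell (@truncn_def _ _ j).
    by apply/minn_idPl; exact: ltnW.
  by rewrite ler_pdivlMr// ltr_pdivrMr// lerBrDl ltrBlDl jt tj.
have cellT i : cell i T = m i.
  by rewrite /cell -(mh i) mulfK ?lt0r_neq0// natrK minnn.
have cell1 i : cell i t1 = 0%N by rewrite /cell subrr mul0r truncn0 min0n.
have ndcell i s t : s <= t -> (cell i s <= cell i t)%N.
  move=> st; rewrite leq_min cellm andbT; apply: leq_trans (geq_minl _ _) _.
  by apply: le_truncn; rewrite ler_pM2r ?invr_gt0// lerD2r.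
have sige i t : t1 <= t <= T -> `|grid i (cell i t) - t| <= h i.
  move=> /andP[t1t tT]; have q0 : 0 <= (t - t1) / h i.
    by rewrite divr_ge0 ?(ltW (h0 i))// subr_ge0.
  have qm : (t - t1) / h i <= (m i)%:R by rewrite ler_pdivrMr// mh lerD2r.
  have -> : cell i t = Num.truncn ((t - t1) / h i).
    by apply/minn_idPl; rewrite -(@ler_nat R); apply: le_trans qm; rewrite truncn_le.
  have := truncn_itv q0; rewrite ler_pdivlMr// ltr_pdivrMr//.
  move: (Num.truncn _) => l; rewrite -natr1 mulrDl mul1r.
  by rewrite ler_norml /grid; move: (h0 i); clear; lra.
have [yv0 yvS yrad yM vw] : [/\ forall i, y i 0%N = x1 /\ v i 0%N = w t1,
   forall i j, (j < m i)%N ->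
       (forall p, dotv (y i j.+1 - y i j) p - (v i j.+1 - v i j) <=
         Ig (running (fun=> y i j) p) (grid i j) (grid i j.+1)) /\
       enorm (y i j.+1 - y i j) <= Ig c (grid i j) (grid i j.+1) * (1 + rad),
   forall i j, (j <= m i)%N -> enorm (y i j) <= rad,
   forall i j, (j <= m i)%N -> enorm (y i j - x (grid i j)) <= M &
   forall i j, (j <= m i)%N -> w (grid i j) <= v i j /\
       v i j <= w (grid i j) + KT * M + (E T - E t1)].
  by split=> i; have [] := yvP i.
have M0 : 0 <= M := le_trans (enorm_ge0 _) (yM 0%N 0%N (leq0n _)).
pose gam t := c t * (1 + rad).
have gam1 : L1 gam by exact: L1Zr.
have ystep i j j' : (j <= j')%N -> (j' <= m i)%N ->
    enorm (y i j' - y i j) <= primitive gam (grid i j') - primitive gam (grid i j).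
  move=> /subnK <-; elim: (j' - j)%N => [_|l IH] /=; first by rewrite add0n !subrr enorm0.
  rewrite addSn => lm; have := IH (ltnW lm); have [_ h2] := yvS i _ lm.
  have := enormD (y i (l + j).+1 - y i (l + j)%N) (y i (l + j)%N - y i j).
  rewrite addrA subrK; move: h2.
  rewrite -(IgZr (1 + rad) _ _ c1) -(primitiveB gam1 (ndgrid i _ _ (leqnSn (l + j)))).
  by clear; lra.
have KT0 : 0 <= KT.
  by rewrite subr_ge0; apply: primitive_nondecreasing => //; exact: ltW.
have ndk : {homo primitive (k rad) : s t / s <= t} by exact: primitive_nondecreasing.
(* Summation over the cells replaces each frozen state by a continuous [z] close to it, at a price
   given by (HLC). *)
have approx i (z : R -> 'rV[R]_n) delta p j j' : continuous z -> (forall t, enorm (z t) <= rad) ->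
    (forall t, t1 <= t <= T -> enorm (y i (cell i t) - z t) <= delta) ->
    (j <= j')%N -> (j' <= m i)%N ->
    dotv (y i j' - y i j) p - (v i j' - v i j) <= Ig (running z p) (grid i j) (grid i j') +
      (primitive (k rad) (grid i j') - primitive (k rad) (grid i j)) * ((1 + enorm p) * delta).
  move=> cz zr yz; have runz : L1 (running z p) by exact: (running_L1 tame).
  move=> /subnK <-; elim: (j' - j)%N => [_|l IH] /=.
    by rewrite add0n !subrr dotv0l Igss// mul0r subrr addr0.
  rewrite addSn => lm; have := IH (ltnW lm); have [/(_ p) h2 _] := yvS i _ lm.
  have gl : grid i (l + j)%N <= grid i (l + j).+1 by exact: ndgrid.
  rewrite (@Ig_split _ _ (grid i j) (grid i (l + j)%N) (grid i (l + j).+1))//; last first.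
    by rewrite gl andbT; apply: ndgrid; exact: leq_addl.
  have : Ig (running (fun=> y i (l + j)%N) p) (grid i (l + j)%N) (grid i (l + j).+1) <=
      Ig (fun q => running z p q + k rad q * ((1 + enorm p) * delta))
        (grid i (l + j)%N) (grid i (l + j).+1).
    (* At the right endpoint [cell] already points to the next state, so this single time is
       discarded as a null set. *)
    apply: Ig_le_ae; [exact: (running_cst_L1 tame)|by apply: L1D => //; exact: L1Zr|].
    apply: (ae_S (ae_neq (grid i (l + j).+1))) => q qn /andP[lq ql].
    have ql' : q < grid i (l + j).+1 by rewrite lt_neqAle qn.
    have /andP[a1 _] := gridT i _ (ltnW lm); have /andP[_ a2] := gridT i _ lm.
    have := yz q; rewrite (le_trans a1 lq) (le_trans ql a2) (cellE i q (l + j)%N)// => /(_ isT) yq.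
    have := tame_lip_x tame q p (yrad i _ (ltnW lm)) (zr q).
    have : k rad q * (1 + enorm p) * enorm (y i (l + j)%N - z q) <=
        k rad q * ((1 + enorm p) * delta).
      by rewrite -mulrA ler_wpM2l// ler_wpM2l ?addr_ge0 ?enorm_ge0.
    by rewrite /running ler_norml; clear; lra.
  rewrite IgD ?IgZr//; last exact: L1Zr.
  rewrite -(primitiveB k1 gl).
  have -> : y i (l + j).+1 - y i j =
      (y i (l + j).+1 - y i (l + j)%N) + (y i (l + j)%N - y i j) by rewrite addrA subrK.
  by move: h2; rewrite [dotv (_ + (_ - _)) _]dotvDl; clear; lra.
(* The reference cost may jump; this one-sided bound keeps it, up to a constant, above [w t1] and
   below [w T], hence the polygon costs bounded. *)
have wlow s t : t1 <= s -> s <= t -> t <= T ->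
    w s - (Ig (running_lower rad) t1 T + (E T - E t1)) <= w t.
  move=> t1s st tT; have := xw s t 0 t1s st tT; rewrite dotv0r enorm0 addr0 mul1r.
  have eta1 := running_lower_L1 tame rad.
  have eta0 u := running_lower_ge0 tame u rad0.
  have : Ig (running x 0) s t <= Ig (running_lower rad) s t.
    apply: Ig_le => //; first exact: (running_L1 tame).
    move=> q _; apply: le_trans (ler_norm _) _; exact: (running_ge tame).
  rewrite -(primitiveB eta1 st) -(primitiveB eta1 (ltW t1T)).
  have nde := primitive_nondecreasing eta1 eta0.
  move: (nde _ _ t1s) (nde _ _ tT) (ndE _ _ t1s) (ndE _ _ tT).
  by clear; lra.
have [U [UU hU]] := @ultraFilterLemma nat \oo _.
have [||||||y_ [w_ [ay ylim vlim]]] := @arc_limit _ _ _ _ _ tame U UU t1 T rad KT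
  (`|w t1| + `|w T| + (Ig (running_lower rad) t1 T + (E T - E t1)) + KT * M + (E T - E t1))
  (fun i t => y i (cell i t)) (fun i t => v i (cell i t)) (fun i t => grid i (cell i t))
  gam h (ltW t1T) gam1 (fun i t => yrad i _ (cellm i t)).
- by move=> i s t _ st _; apply: ystep => //; exact: ndcell.
- by move=> i s t st; exact/ndgrid/ndcell.
- exact: sige.
- move=> e e0; apply: hU; exists (Num.truncn ((T - t1) / e)) => // i /= ei.
  rewrite subr0 gtr0_norm//; apply: hlt => //; exact: leq_trans ei (leq_addr _ _).
- move=> t /andP[t1t tT]; apply: nearW => i.
  have [h1 h2] := vw i _ (cellm i t); have /andP[a1 a2] := gridT i _ (cellm i t).
  have := wlow _ _ (lexx _) a1 a2; have := wlow _ _ a1 a2 (lexx _).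
  have := ler_norm (w T); have := ler_norm (- w t1); rewrite normrN.
  have := normr_ge0 (w T); have := normr_ge0 (w t1); have := mulr_ge0 KT0 M0.
  have : 0 <= E T - E t1 by rewrite subr_ge0; apply/ndE/ltW.
  by rewrite ler_norml; move: h1 h2; clear; lra.
- move=> i z delta s t p cz zr yz t1s st tT.
  have jj := ndcell i _ _ st; have := approx i z delta p _ _ cz zr yz jj (cellm i t).
  have dl0 : 0 <= delta by apply: le_trans (yz t1 _); rewrite ?enorm_ge0// lexx ltW.
  have /andP[a1 _] := gridT i _ (cellm i s); have /andP[_ a2] := gridT i _ (cellm i t).
  have : (primitive (k rad) (grid i (cell i t)) - primitive (k rad) (grid i (cell i s))) *
      ((1 + enorm p) * delta) <= KT * ((1 + enorm p) * delta).
    apply: ler_wpM2r; first by rewrite mulr_ge0 ?addr_ge0 ?enorm_ge0.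
    by apply: lerB; exact: ndk.
  by clear; lra.
have t1t1 : t1 <= t1 <= T by rewrite lexx ltW.
have TT : t1 <= T <= T by rewrite lexx ltW.
exists y_, w_; split => //.
- apply: (tends_unique (ylim t1 t1t1)) => e e0; apply: nearW => i.
  by rewrite cell1 (yv0 i).1 subrr enorm0.
- apply: (@tends_dist_le _ U UU _ (fun i => y i (cell i T)) (fun=> x T)) => //.
  + exact: ylim.
  + by move=> e e0; apply: nearW => i; rewrite subrr enorm0.
  + by apply: nearW => i; have := yM i _ (leqnn _); rewrite gridm cellT.
- apply: near_le => e e0; have e20 : 0 < e / 2 by rewrite divr_gt0.
  apply: filterS (filterI (vlim T TT _ e20) (vlim t1 t1t1 _ e20)) => i /= [].
  rewrite cell1 cellT (yv0 i).2; have [_] := vw i _ (leqnn _); rewrite gridm.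
  by rewrite !ltr_norml -/KT; clear; lra.
Qed.

End Filippov.

(** * The value function *)

Section Reach.
Context {R : realType} {n : nat} {H : R -> 'rV[R]_n -> 'rV[R]_n -> R}.
Context {c : R -> R} {k : R -> R -> R} (tame : tame_hamiltonian H c k).
Local Notation running := (@running R n H).
Local Notation running_lower := (@running_lower R n H k).
Local Notation arc := (@arc R n H).
Implicit Types (x : R -> 'rV[R]_n) (p z : 'rV[R]_n) (s t : R).

(** V < B implies [reach], which implies V <= B, so the two semicontinuities of the value become
    stability of this relation under limits and, for slightly larger [B], under perturbation. *)
Definition reach (T : R) (g : 'rV[R]_n -> R) t0 z (B : R) := exists x w,
  [/\ arc t0 T x w, x t0 = z & g (x T) + (w T - w t0) <= B].

Lemma reach_closed (T : R) (g : 'rV[R]_n -> R) t0 z (B : R) (t_ : nat -> R) (z_ : nat -> 'rV[R]_n) :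
  (forall y (a : R), a < g y ->
    exists2 d : R, 0 < d & forall y', enorm (y' - y) < d -> a < g y') ->
  t0 <= T -> (forall i, t_ i <= T) -> (forall i, `|t_ i - t0| < i.+1%:R^-1) ->
  (forall i, enorm (z_ i - z) < i.+1%:R^-1) -> (forall i, reach T g (t_ i) (z_ i) B) ->
  reach T g t0 z B.
Proof.
move=> gl t0T tT t_t z_z rB.
have [x_ /choice[w_ axw]] := choice rB.
have ax i : arc (t_ i) T (x_ i) (w_ i) by have [] := axw i.
have xz i : x_ i (t_ i) = z_ i by have [] := axw i.
have cost i : g (x_ i T) + (w_ i T - w_ i (t_ i)) <= B by have [] := axw i.
have [U [UU hU]] := @ultraFilterLemma nat \oo _.
have small (e : R) : 0 < e -> \forall i \near U, i.+1%:R^-1 < e.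
  move=> e0; apply: hU; exact: (near_infty_natSinv_lt (PosNum e0)).
have inv1 i : i.+1%:R^-1 <= 1 :> R by rewrite invf_le1// ler1n.
have tt0 : tendsR U t_ t0.
  by move=> e /small; apply: filterS => i; exact: lt_trans (t_t i).
have xx0 : tends U (fun i => x_ i (t_ i)) z.
  by move=> e /small; apply: filterS => i; rewrite xz; exact: lt_trans (z_z i).
have t_1 i : `|t_ i - t0| <= 1 by exact: le_trans (ltW (t_t i)) (inv1 i).
have x_1 i : enorm (x_ i (t_ i) - z) <= 1.
  by rewrite xz; exact: le_trans (ltW (z_z i)) (inv1 i).
have xb i : enorm (x_ i T) <=
    (1 + (enorm z + 1)) * expR (2 * (primitive c T - primitive c (t0 - 1))).
  have := arc_clamp_bound tame (tT i) (ax i) (b := enorm z + 1)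
    (A := primitive c T - primitive c (t0 - 1)).
  move=> /(_ _ _ T); rewrite clamp_id ?lexx ?tT//; apply.
    by have := enormD (x_ i (t_ i) - z) z; rewrite subrK; move: (x_1 i); clear; lra.
  rewrite lerD2l lerN2; apply: primitive_nondecreasing.
  - exact: (tame_c_L1 tame).
  - exact: (tame_c_ge0 tame).
  - by move: (t_1 i); rewrite ler_norml; lra.
(* The limit of the terminal states is found before the limit arc: lower semicontinuity of [g] there
   bounds the costs from above, as [arc_closed] requires. *)
have [y xy] : exists y, tends U (fun i => x_ i T) y.
  by apply: bounded_tends; apply: nearW; exact: xb.
have [d d0 gd] : exists2 d : R, 0 < d & forall y', enorm (y' - y) < d -> g y - 1 < g y'.
  by apply: gl; rewrite ltrBlDr ltrDl.
have wB : \forall i \near U, w_ i T - w_ i (t_ i) <= B - g y + 1.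
  apply: filterS (xy d d0) => i /gd; move: (cost i); clear; lra.
have [x [w [axw' xz' xT wT]]] := arc_closed tame t0T tT tt0 t_1 ax xx0 x_1 wB.
exists x, w; split => //; apply: near_le => e e0; have e20 : 0 < e / 2 by rewrite divr_gt0.
have [d' d'0 gd'] : exists2 d : R, 0 < d & forall y', enorm (y' - x T) < d ->
    g (x T) - e / 2 < g y' by apply: gl; rewrite ltrBlDr ltrDl.
apply: filterS (filterI (xT d' d'0) (wT _ e20)) => i /= [/gd' h1 h2].
by move: (cost i) h1 h2; clear; lra.
Qed.

Lemma reach_end (T : R) (g : 'rV[R]_n -> R) z : reach T g T z (g z).
Proof.
exists (fun=> z), (fun=> 0); split => //; last by rewrite subrr addr0.
split; [by move=> t; exact: cvg_cst|by exists (enorm z)|].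
move=> s t p Ts st tT; have -> : s = t by apply: le_anti; rewrite st (le_trans tT Ts).
by rewrite !subrr dotv0l Igss//; exact: (running_cst_L1 tame).
Qed.

(** The state frozen to the left of [t0] at zero cost need not form an arc. Its defect is at most
    [1 + enorm p] times the integral of [e], since |H(t, x, p)| <= e(t) (1 + |p|) in the ball; [E]
    is constant after [t0]. *)
Lemma arc_extend_left (T t0 t1 : R) x w (r : R) : t0 <= T -> arc t0 T x w ->
  (forall t, enorm (x t) <= r) ->
  let e t := `|H t 0 0| + k r t * r + c t * (1 + r) in
  let E t := primitive e (Num.min t t0) in
  forall s t p, t1 <= s -> s <= t -> t <= T ->
    dotv (x (clamp t0 T t) - x (clamp t0 T s)) p - (w (clamp t0 T t) - w (clamp t0 T s)) <=
    Ig (running (x \o clamp t0 T) p) s t + (1 + enorm p) * (E t - E s).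
Proof.
move=> t0T ax xr e E s t p t1s st tT.
have [cxc _ xw] := arc_clamp t0T ax.
have r0 : 0 <= r := le_trans (enorm_ge0 _) (xr 0).
have c0 := tame_c_ge0 tame; have k0 := tame_k_ge0 tame.
have e1 : L1 e.
  apply: L1D; last exact: L1Zr (tame_c_L1 tame).
  exact: (running_lower_L1 tame).
have e0 q : 0 <= e q by rewrite addr_ge0 ?mulr_ge0 ?addr_ge0// mulr_ge0.
have run1 : L1 (running (x \o clamp t0 T) p).
  by apply: (@running_L1 _ _ _ _ _ tame _ _ r) => // q; exact: xr.
have p0 := enorm_ge0 p.
have low a b : a <= b -> - ((1 + enorm p) * (primitive e b - primitive e a)) <=
    Ig (running (x \o clamp t0 T) p) a b.
  move=> ab; rewrite (primitiveB e1 ab) lerNl -IgN//  mulrC -(IgZr _ _ _ e1).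
  apply: Ig_le; [exact: L1N|exact: L1Zr|].
  move=> q _; have := tame_bound tame q p (xr (clamp t0 T q)).
  have h1 : c q * (1 + r) * enorm p + (`|H q 0 0| + k r q * r) <= e q * (1 + enorm p).
    have : 0 <= c q * (1 + r) by rewrite mulr_ge0 ?addr_ge0.
    have : 0 <= (`|H q 0 0| + k r q * r) * enorm p.
      by rewrite mulr_ge0// addr_ge0// mulr_ge0.
    by rewrite /e; clear; lra.
  by rewrite /running/= ler_norml => /andP[]; move: h1; clear; lra.
have clE q : t0 <= q -> q <= T -> clamp t0 T q = q by move=> a b; rewrite clamp_id// a.
have cl0 q : q <= t0 -> clamp t0 T q = t0.
  by move=> qt; apply/max_idPl; rewrite ge_min qt orbT.
have [t0s|/ltW st0] := leP t0 s.
  have := xw s t p t0s st tT; rewrite /= => h.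
  rewrite /E (min_idPr t0s) (min_idPr (le_trans t0s st)) subrr mulr0 addr0.
  exact: h.
have [t0t|/ltW tt0] := leP t0 t.
  have := xw t0 t p (lexx _) t0t tT; rewrite /= [clamp t0 T s]cl0// [clamp t0 T t0]cl0// => h.
  rewrite (@Ig_split _ _ s t0 t)//; last by rewrite st0.
  have := low s t0 st0; rewrite /E (min_idPl st0) (min_idPr t0t).
  by move: h; clear; lra.
rewrite !cl0// !subrr dotv0l /E (min_idPl st0) (min_idPl tt0).
by have := low s t st; clear; lra.
Qed.

Lemma reach_open (T : R) (g : 'rV[R]_n -> R) t0 z (B b : R) : 
  (forall y (a : R), g y < a ->
    exists2 d : R, 0 < d & forall y', enorm (y' - y) < d -> g y' < a) ->
  t0 <= T -> reach T g t0 z B -> B < b ->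
  exists2 d : R, 0 < d & forall t1 z', t1 <= T -> `|t1 - t0| < d -> enorm (z' - z) < d ->
    reach T g t1 z' b.
Proof.
move=> gu t0T [x [w [ax xz xwB]]] Bb.
have eps0 : 0 < b - B by rewrite subr_gt0.
(* Four shares are spent: on the terminal cost, on [KT * mu], on the cost dropped between [t0] and a
   later [t1], and on the defect [E]. The fifth is slack. *)
have [eps eps_gt epsE] : exists2 e : R, 0 < e & 5 * e = b - B.
  by exists ((b - B) / 5); [rewrite divr_gt0|rewrite mulrC divfK].
have [th th0 gth] : exists2 d : R, 0 < d & forall y', enorm (y' - x T) < d ->
    g y' < g (x T) + eps by apply: gu; rewrite ltrDl.
have c1 := tame_c_L1 tame; have c0 := tame_c_ge0 tame.
have [cx [r0 xr0] _] := ax.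
have rp : 0 <= r0 := le_trans (enorm_ge0 _) (xr0 0).
pose rad := Num.max r0 ((1 + (enorm z + 1)) * expR (primitive c T - primitive c (t0 - 1))).
have xr t : enorm (x t) <= rad by rewrite le_max xr0.
have k1 := tame_k_L1 tame rad; have k0 := tame_k_ge0 tame rad.
pose KT := primitive (k rad) T - primitive (k rad) (t0 - 1).
have KT0 : 0 <= KT.
  rewrite subr_ge0; apply: primitive_nondecreasing => //.
  by apply: le_trans t0T; rewrite gerBl.
pose X := x \o clamp t0 T.
pose e t := `|H t 0 0| + k rad t * rad + c t * (1 + rad).
have rad0 : 0 <= rad := le_trans (enorm_ge0 _) (xr 0).
have e1 : L1 e.
  apply: L1D; last exact: L1Zr (tame_c_L1 tame).
  exact: (running_lower_L1 tame).
have e0 q : 0 <= e q by rewrite addr_ge0 ?mulr_ge0 ?addr_ge0// mulr_ge0.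
have eta1 : L1 (running_lower rad) by exact: (running_lower_L1 tame).
(* [mu] bounds the distance of the new terminal state from [x T]: it must be small for [g] and,
   multiplied by [KT], for the cost. *)
have [mu mu0 [muth muK]] : exists2 m : R, 0 < m & m < th /\ KT * m <= eps.
  exists (Num.min (th / 2) (eps / (KT + 1))).
    by rewrite lt_min !divr_gt0// ltr_wpDl.
  split; first by rewrite gt_min ltr_pdivrMr// mulrDr mulr1 ltrDl th0.
  apply: (@le_trans _ _ ((KT + 1) * (eps / (KT + 1)))).
    apply: ler_pM => //; last by rewrite ge_min lexx orbT.
      by rewrite ltW// lt_min !divr_gt0// ltr_wpDl.
    by rewrite lerDl.
  by rewrite mulrC divfK// lt0r_neq0// ltr_wpDl.
(* Of the four terms [nu], two bound the distance from [z'] to [X t1], one the oscillation in a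
   cell, and one the defect [E]. *)
have [nu nu0 nuE] : exists2 m : R, 0 < m & expR KT * (4 * m) = mu.
  exists (mu / (4 * expR KT)); first by rewrite divr_gt0// mulr_gt0// expR_gt0.
  by rewrite [LHS]mulrA [expR KT * 4]mulrC [LHS]mulrC divfK// lt0r_neq0// mulr_gt0 ?expR_gt0.
have Xr t : enorm (X t) <= rad by exact: xr.
have XcE : exists gam : R -> R, [/\ L1 gam, (forall t, 0 <= gam t) &
    forall s t, s <= t -> enorm (X t - X s) <= Ig gam s t].
  exists (fun t => c t * (1 + rad)).
  have gam1 : L1 (fun t => c t * (1 + rad)) by exact: L1Zr.
  have gam0 t : 0 <= c t * (1 + rad) by rewrite mulr_ge0 ?addr_ge0.
  split => // s t st.
  have /andP[a1 a2] := clamp_itv t t0T; have /andP[a3 a4] := clamp_itv s t0T.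
  apply: le_trans (Ig_clamp gam1 gam0 t0T st).
  rewrite IgZr// mulrC; apply: (arc_speed tame ax a3 (clamp_le _ _ st) a2) => q _.
  by rewrite lerD2l.
have [gam [gam1 gam0 Xgam]] := XcE.
have [dX dX0 XdX] := Ig_small gam1 nu0.
have {}XdX s t : s <= t -> t - s < dX -> enorm (X t - X s) < nu.
  move=> st /(XdX s t st); apply: le_lt_trans; apply: le_trans (Xgam s t st) _.
  by apply: Ig_le => //; [exact: L1_norm|move=> q _; exact: ler_norm].
pose mu' := Num.min nu eps.
have mu'0 : 0 < mu' by rewrite lt_min nu0.
have [de de0 ede] := primitive_small e1 mu'0.
have [dl dl0 edl] := primitive_small eta1 eps_gt.
(* If [t0 < T], a perturbation smaller than [T - t0] keeps [t1] away from [T]; thus [t1 = T] occurs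
   only for [t0 = T], where the constant arc and continuity of [g] suffice. *)
pose dT := if t0 < T then T - t0 else 1.
have dT0 : 0 < dT by rewrite /dT; case: ifPn => // h; rewrite subr_gt0.
exists (Num.min (Num.min 1 (Num.min th dT)) (Num.min (Num.min nu dX) (Num.min de dl))).
  by rewrite !lt_min ltr01 th0 dT0 nu0 dX0 de0 dl0.
move=> t1 z' t1T; rewrite !lt_min => /andP[/andP[t1a /andP[_ tdT]] /andP[/andP[_ tdX] /andP[tde tdl]]].
move=> /andP[/andP[z1 /andP[zth _]] /andP[/andP[znu _] _]].
move: t1T; rewrite le_eqVlt => /predU1P[t1T|t1T].
  rewrite t1T in tdT *.
  have t0T' : t0 = T.
    apply/eqP; rewrite eq_le t0T leNgt; apply/negP => h; move: tdT.
    by rewrite /dT h ger0_norm ?ltxx// subr_ge0.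
  have [x' [w' [a1 a2 a3]]] := reach_end T g z'; exists x', w'; split => //.
  have := gth z'; rewrite -{1}t0T' xz => /(_ zth).
  move: a3 xwB; rewrite -t0T' xz subrr; move: epsE eps_gt; clear; lra.
have t1X : enorm (X t1 - z) < nu.
  have <- : X t0 = z by rewrite /X/= clamp_id ?lexx.
  have [h|/ltW h] := leP t0 t1.
    by apply: XdX => //; apply: le_lt_trans tdX; exact: ler_norm.
  by rewrite enormC; apply: XdX => //; apply: le_lt_trans tdX; rewrite distrC ler_norm.
pose E t := primitive e (Num.min t t0).
have ndE : {homo E : s t / s <= t}.
  move=> s t st; apply: primitive_nondecreasing => //.
  by rewrite le_min !ge_min st lexx !orbT.
have dE : E T - E t1 < mu'.
  rewrite /E (min_idPr t0T); apply: le_lt_trans (ler_norm _) _; apply: ede.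
  apply: le_lt_trans tde; have [h|h] := leP t1 t0.
    by rewrite distrC.
  by rewrite subrr normr0.
have dEn : E T - E t1 < nu by apply: lt_le_trans dE _; rewrite ge_min lexx.
have dEe : E T - E t1 < eps by apply: lt_le_trans dE _; rewrite ge_min lexx orbT.
have t01 : t0 - 1 <= t1 by move: t1a; rewrite ltr_norml; lra.
have KT1 : primitive (k rad) T - primitive (k rad) t1 <= KT.
  by rewrite lerD2l lerN2; apply: primitive_nondecreasing.
have [||||y [v [ay yz yT vT]]] := @filippov _ _ _ _ _ tame t1 T X
  (w \o clamp t0 T) E z' rad nu mu dX t1T (ltW nu0) _ Xr _ dX0 _ ndE
  (arc_extend_left t0T ax xr) _.
- by have [] := arc_clamp t0T ax.
- rewrite le_max; apply/orP; right; apply: ler_pM.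
  + by apply: addr_ge0 => //; exact: enorm_ge0.
  + exact: expR_ge0.
  + have := enormD (z' - z) z; rewrite subrK addrC lerD2l => /le_trans; apply.
    by rewrite lerD2l; exact: ltW.
  + by rewrite ler_expR lerD2l lerN2; apply: primitive_nondecreasing.
- by move=> s t st std; exact/ltW/XdX.
- rewrite -nuE; apply: ler_pM.
  + exact: expR_ge0.
  + rewrite addr_ge0 ?subr_ge0//; last exact/ndE/ltW.
    by rewrite addr_ge0 ?enorm_ge0// ltW.
  + by rewrite ler_expR.
  + have := enormB (z' - z) (X t1 - z); rewrite opprB addrA subrK.
    by move: t1X dEn znu; clear; lra.
exists y, v; split => //.
have XT : X T = x T by rewrite /X/= clamp_id ?lexx ?t0T.
rewrite XT in yT; have h1 := gth (y T) (le_lt_trans yT muth).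
have h2 : (primitive (k rad) T - primitive (k rad) t1) * mu <= eps.
  by apply: le_trans muK; rewrite ler_wpM2r// ltW.
(* A start after [t0] drops the cost accumulated on [t0, t1], which is bounded below by a small
   negative number. *)
have h3 : (w \o clamp t0 T) T - (w \o clamp t0 T) t1 <= w T - w t0 + eps.
  rewrite /= [clamp t0 T T]clamp_id ?lexx ?t0T//.
  have /andP[a1 a2] := clamp_itv t1 t0T.
  have := arc_cost_ge tame ax xr (lexx t0) a1 a2.
  rewrite -(primitiveB eta1 a1).
  suff : primitive (running_lower rad) (clamp t0 T t1) - primitive (running_lower rad) t0 <= eps.
    by clear; lra.
  apply: le_trans (ler_norm _) _; apply/ltW/edl; apply: le_lt_trans tdl.
  rewrite /clamp (min_idPr (ltW t1T)); have [h|h] := leP t0 t1; first by [].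
  by rewrite subrr normr0.
by move: h1 h2 h3 vT xwB dEe epsE eps_gt; clear; lra.
Qed.

End Reach.

Section Value.
Context {R : realType} {n : nat} (T : R) (g : 'rV[R]_n -> R).
Context (H H' : R -> 'rV[R]_n -> 'rV[R]_n -> R) (c : R -> R) (k : R -> R -> R).
Context (mu : probability (BorelRV R (n + 1)) R) (hmu : sphere_measure mu).
Context (tame : tame_hamiltonian H' c k) (HE : forall t, 0 <= t <= T -> H' t = H t).
Local Notation leb := (@leb R).
Local Notation V := (value_fun T (steiner_f H mu) (steiner_l H mu) g).
Local Notation reach := (@reach R n H' T g).
Implicit Types (t : R) (z : 'rV[R]_n).

Lemma value_le_reach t0 z (B : R) : 0 <= t0 <= T -> reach t0 z B -> (V t0 z <= B%:E)%E.
Proof.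
move=> /andP[t00 t0T] [x [w [ax xz xB]]].
have [rho [l [acy rho1 l1 lw aeP]]] := arc_trajectory tame t0T ax.
set y := x \o clamp t0 T in acy aeP.
pose a t : 'rV[R]_(n + 1) := row_mx (rho t) (const_mx (l t)).
have al t : lsubmx (a t) = rho t by rewrite row_mxKl.
have ar t : rsubmx (a t) ord0 ord0 = l t by rewrite row_mxKr mxE.
have mD : measurable (`[t0, T]%classic : set (LebT R)).
  by apply: measurable_LebT; exact: measurable_itv.
have on_D h : L1 h -> leb.-integrable (`[t0, T]%classic : set (LebT R)) (EFin \o h).
  by move=> h1; apply: integrableS h1.
have epi t : t0 <= t <= T -> (forall p, dotv (rho t) p - l t <= H' t (y t) p) ->
    steiner_fl H mu t (y t) (a t) = a t.
  move=> /andP[t0t tT] h; apply: (steiner_fl_id hmu); apply/epiHstarP => p.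
  by rewrite al ar -HE ?(le_trans t00 t0t)//; exact: h.
have aeL : {ae leb, forall t : LebT R, t0 <= t <= T -> steiner_l H mu t (y t) (a t) = l t}.
  by apply: (ae_S aeP) => t h tT; rewrite /steiner_l (epi t tT (h tT).2).
apply: (@le_trans _ _ ((g (y T))%:E +
    \int[leb]_(t in (`[t0, T]%classic : set (LebT R))) (steiner_l H mu t (y t) (a t))%:E)%E).
  apply: ereal_inf_lbound; exists (y, a) => //; split => //=.
  - move=> i; have aE (t : R) : a t ord0 i =
        if fintype.split i is inl j then dotv (rho t) (delta_mx 0 j) else l t.
      rewrite mxE; case: (fintype.split i) => j; last by rewrite mxE.
      rewrite /dotv (bigD1 j)//= mxE !eqxx mulr1 big1 ?addr0// => j' jj'.
      by rewrite mxE (negPf jj') andbF mulr0.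
    have : L1 (fun t => a t ord0 i).
      by rewrite (funext aE); case: (fintype.split i) => [j|_].
    exact: on_D.
  - apply: (ae_S aeP) => t h; rewrite /= in_itv/= => tT.
    by have [dy hH] := h tT; rewrite /steiner_f (epi t tT hH) al.
  - by rewrite /y/= clamp_id ?lexx.
have <- : (\int[leb]_(t in (`[t0, T]%classic : set (LebT R))) (l t)%:E =
    \int[leb]_(t in (`[t0, T]%classic : set (LebT R))) (steiner_l H mu t (y t) (a t))%:E)%E.
  have ml : measurable_fun (`[t0, T]%classic : set (LebT R)) (EFin \o l).
    by apply/measurable_EFinP; apply: measurable_funTS; exact: L1_measurable.
  have aeE : ae_eq leb (`[t0, T]%classic : set (LebT R)) (EFin \o l)
      (fun t => (steiner_l H mu t (y t) (a t))%:E).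
    by apply: (ae_S aeL) => t h; rewrite /= in_itv/= => tT; rewrite h.
  apply: ae_eq_integral => //.
  (* Along this control the running cost equals the integrable [l] almost everywhere; completeness
     of [leb] makes it measurable. *)
  exact: (ae_measurable_fun (@completed_lebesgue_measure_is_complete R) aeE ml).
rewrite L1_integralE// -EFinD lee_fin; apply: le_trans xB.
by rewrite /y/= clamp_id ?lexx ?t0T// lerD2l.
Qed.

Lemma reach_value t0 z (B : R) : 0 <= t0 <= T -> (V t0 z < B%:E)%E -> reach t0 z B.
Proof.
move=> /andP[t00 t0T] /ereal_inf_lt[_ [[x a] /= [acx _ aex xz] <-]] vB.
have [|||w [ax wB]] := @trajectory_arc _ _ _ _ _ tame t0 T x
  (fun t => steiner_f H mu t (x t) (a t)) (fun t => steiner_l H mu t (x t) (a t))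
  (B - g (x T)) t0T acx.
- by apply: (ae_S aex) => t h tT; apply: h; rewrite /= in_itv.
- move=> t p /andP[t0t tT]; have tT' : 0 <= t <= T by rewrite (le_trans t00 t0t).
  have := @steiner_fl_in R n H mu hmu t (x t) (a t) (c t * (1 + enorm (x t))).
  rewrite -(HE tT') => /(_ _ (tame_convex tame t (x t)) (tame_lip_p tame t (x t))).
  have h0 : 0 <= c t * (1 + enorm (x t)).
    by rewrite mulr_ge0 ?addr_ge0 ?enorm_ge0// (tame_c_ge0 tame).
  by move=> /(_ h0)/epiHstarP/(_ p); rewrite HE.
- rewrite EFinB leeBrDl//; exact: ltW.
exists (x \o clamp t0 T), w; split => //.
  by rewrite /= clamp_id ?lexx.
by rewrite /= clamp_id ?lexx ?t0T//; move: wB; lra.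
Qed.

Lemma nbhs_box t0 z (e : R) : 0 < e ->
  nbhs (t0, z) [set tz : R * 'rV[R]_n | `|tz.1 - t0| < e /\ enorm (tz.2 - z) < e].
Proof.
move=> e0; exists ([set t | `|t - t0| < e], [set y | enorm (y - z) < e]) => //=.
split; last by apply: filterS (near_enorm z e0) => y; rewrite /= enormC.
by apply/nbhs_ballP; exists e => //= s; rewrite /ball/= distrC.
Qed.

Lemma value_lsc : lower_semicontinuous (fun z => (g z)%:E) ->
  lsc_on (`[0, T] `*` [set: 'rV[R]_n]) (fun z : R * 'rV[R]_n => V z.1 z.2).
Proof.
move=> glsc [t0 z] [/=]; rewrite in_itv/= => t0T _ a aV; apply: contrapT => noU.
have /andP[t00 t0T'] := t0T.
(* The gap between [a] and [a'] turns V <= a at nearby points into V < a', which yields arcs of cost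
   at most [a']; the limit arc then contradicts a' < V. *)
have [a' aa' a'V] : exists2 a' : R, a < a' & (a'%:E < V t0 z)%E.
  move: aV; case: (V t0 z) => [v| |]; last by [].
    by rewrite lte_fin => av; exists ((a + v) / 2); rewrite ?lte_fin; lra.
  by move=> _; exists (a + 1); rewrite ?ltry// ltrDl.
have /choice[tz tzP] : forall i : nat, exists tz : R * 'rV[R]_n,
    [/\ 0 <= tz.1 <= T, `|tz.1 - t0| < i.+1%:R^-1, enorm (tz.2 - z) < i.+1%:R^-1 &
       reach tz.1 tz.2 a'].
  move=> i; apply: contrapT => h; apply: noU.
  exists [set tz : R * 'rV[R]_n | `|tz.1 - t0| < i.+1%:R^-1 /\ enorm (tz.2 - z) < i.+1%:R^-1].
    by apply: nbhs_box; rewrite invr_gt0.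
  move=> [t1 z1] /= [h1 h2] [/=]; rewrite in_itv/= => h3 _; rewrite ltNge; apply/negP => h4.
  apply: h; exists (t1, z1); split => //; apply: reach_value => //.
  by apply: le_lt_trans h4 _; rewrite lte_fin.
have : reach t0 z a'.
  apply: (reach_closed tame (t_ := fst \o tz) (z_ := snd \o tz)) => //.
  - move=> y b gby; have /glsc[W] : (b%:E < (g y)%:E)%E by rewrite lte_fin.
    move=> /nbhs_enorm[e e0 eW] Wb; exists e => // y' y'y.
    by rewrite -lte_fin; apply/Wb/eW; rewrite enormC.
  - by move=> i /=; have [/andP[]] := tzP i.
  - by move=> i /=; have [] := tzP i.
  - by move=> i /=; have [] := tzP i.
  - by move=> i /=; have [] := tzP i.
by move=> /(value_le_reach t0T); rewrite leNgt a'V.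
Qed.

Lemma cvg_semicontinuous (I : Type) (F : set_system I) {FF : Filter F} (f : I -> \bar R)
    (l : \bar R) :
  (forall a : R, (a%:E < l)%E -> \forall i \near F, (a%:E < f i)%E) ->
  (forall a : R, (l < a%:E)%E -> \forall i \near F, (f i < a%:E)%E) -> f @ F --> l.
Proof.
case: l => [r| |] lo up.
- move=> A /nbhs_EFin/nbhs_ballP[e /= e0 eA].
  have h1 : ((r - e)%:E < r%:E)%E by rewrite lte_fin ltrBlDr ltrDl.
  have h2 : (r%:E < (r + e)%:E)%E by rewrite lte_fin ltrDl.
  apply: filterS (filterI (lo _ h1) (up _ h2)) => i [/=].
  case: (f i) => [v| |]; [rewrite !lte_fin => a1 a2|by []|by []].
  by apply: eA; rewrite /ball/= ltr_norml; lra.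
- move=> A [M [Mr MA]]; apply: filterS (lo M (ltry M)) => i; exact: MA.
- move=> A [M [Mr MA]]; apply: filterS (up M (ltNyr M)) => i; exact: MA.
Qed.

Lemma value_continuous : continuous g ->
  {within `[0, T] `*` [set: 'rV[R]_n], continuous (fun z : R * 'rV[R]_n => V z.1 z.2)}.
Proof.
move=> cg.
have gnear y (P : set R) : nbhs (g y) P ->
    exists2 d : R, 0 < d & forall y', enorm (y' - y) < d -> P (g y').
  move=> /(cg y)/nbhs_enorm[e e0 eP]; exists e => // y' y'y.
  by apply: eP; rewrite enormC.
have glsc : lower_semicontinuous (fun z => (g z)%:E).
  move=> y a; rewrite lte_fin => ay; exists (g @^-1` [set b | a < b]).
    by apply: cg; apply: open_nbhs_nbhs; split; [exact: open_gt|].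
  by move=> y' /=; rewrite lte_fin.
apply/subspace_continuousP => -[t0 z] [/=]; rewrite in_itv/= => t0T _.
have /andP[t00 t0T'] := t0T.
apply: cvg_semicontinuous => a.
  move=> aV; have [|U Uz UV] := value_lsc glsc (z := (t0, z)) _ aV.
    by split => //=; rewrite in_itv.
  by apply: filterS Uz => tz /UV.
move=> Va; have [b ab bV] : exists2 b : R, b < a & (V t0 z < b%:E)%E.
  have {Va} : (V t0 z < a%:E)%E := Va; case: (V t0 z) => [v| |].
  - by rewrite lte_fin => va; exists ((a + v) / 2); rewrite ?lte_fin; lra.
  - by [].
  - by move=> _; exists (a - 1); rewrite ?ltNyr// ltrBlDr ltrDl.
have [e e0 eb] : exists2 b' : R, b < b' & b' < a.
  by exists ((a + b) / 2); lra.
have [|d d0 dR] := reach_open tame (b := e) _ t0T' (reach_value t0T bV) e0.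
  move=> y b' h; apply: (gnear y [set v | v < b']).
  by apply: open_nbhs_nbhs; split; [exact: open_lt|].
apply: filterS (nbhs_box t0 z d0).
move=> [t1 z1] /= [h1 h2] [/=]; rewrite in_itv/= => t1T _.
have /andP[_ t1T'] := t1T.
apply: le_lt_trans (value_le_reach t1T (dR _ _ t1T' h1 h2)) _.
by rewrite lte_fin.
Qed.

End Value.

Section Truncation.
Context {R : realType} (T : R).
Local Notation leb := (@leb R).

Definition truncT (f : R -> R) t := if 0 <= t <= T then f t else 0.

Lemma truncT_patch (f : R -> R) : truncT f = f \_ (`[0, T]%classic : set R).
Proof.
by apply/funext => t; rewrite /truncT patchE mem_setE in_itv/=; case: ifP.
Qed.

Let mD : measurable (`[0, T]%classic : set (LebT R)).
Proof. by apply: measurable_LebT; exact: measurable_itv. Qed.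

Lemma truncT_measurable f : measurable_fun (`[0, T]%classic : set (LebT R)) f ->
  measurable_fun (setT : set (LebT R)) (truncT f : LebT R -> R).
Proof. by rewrite truncT_patch => mf; apply/(measurable_restrictT _ mD). Qed.

Lemma truncT_L1 f : leb.-integrable (`[0, T]%classic : set (LebT R)) (fun t => (f t)%:E) ->
  L1 (truncT f).
Proof.
move=> /(integrable_mkcond _ mD); rewrite /L1; congr (leb.-integrable _ _).
apply/funext => t; rewrite /truncT !patchE/= mem_setE in_itv/=.
by case: ifP.
Qed.

End Truncation.

(** Extension by 0 outside [0, T] preserves convexity and the Lipschitz bounds, and the value
    function only involves times in [0, T]. *)
Lemma tame_truncation (R : realType) (n : nat) (T : R) (H : R -> 'rV[R]_n -> 'rV[R]_n -> R) :
  (forall x p, measurable_fun (`[0, T] : set (LebT R)) (fun t => H t x p)) ->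
  (forall t, `[0, T] t -> forall x p q (lam : R), 0 <= lam <= 1 ->
    H t x (lam *: p + (1 - lam) *: q) <= lam * H t x p + (1 - lam) * H t x q) ->
  (exists c : R -> R,
    (@leb R).-integrable (`[0, T] : set (LebT R)) (fun t => (c t)%:E) /\
    forall t, `[0, T] t -> 0 <= c t /\
      forall x p q, `|H t x p - H t x q| <= c t * (1 + enorm x) * enorm (p - q)) ->
  (forall r : R, 0 < r -> exists k : R -> R,
    (@leb R).-integrable (`[0, T] : set (LebT R)) (fun t => (k t)%:E) /\
    forall t, `[0, T] t -> 0 <= k t /\
      forall x y p, enorm x <= r -> enorm y <= r ->
        `|H t x p - H t y p| <= k t * (1 + enorm p) * enorm (x - y)) ->
  (@leb R).-integrable (`[0, T] : set (LebT R)) (fun t => (H t 0 0)%:E) ->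
  exists c k, tame_hamiltonian (fun t x p => truncT T (fun t => H t x p) t) c k.
Proof.
move=> H1 H3 [c [c1 cP]] HLC H0.
have /choice[k kP] : forall r : R, exists k : R -> R,
    (@leb R).-integrable (`[0, T]%classic : set (LebT R)) (fun t => (k t)%:E) /\
    forall t, `[0, T]%classic t -> 0 <= k t /\
      forall x y p, enorm x <= r -> enorm y <= r ->
        `|H t x p - H t y p| <= k t * (1 + enorm p) * enorm (x - y).
  (* (HLC) speaks of positive radii only; the radius max(r, 1) covers every real [r]. *)
  move=> r; have r1 : 0 < Num.max r 1 by rewrite lt_max ltr01 orbT.
  have [kr [kr1 krP]] := HLC _ r1; exists kr; split => // t tT.
  have [kr0 h] := krP t tT; split => // x y p xr yr.
  by apply: h; rewrite le_max ?xr ?yr.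
exists (truncT T c), (fun r => truncT T (k r)); split.
- by move=> x p; exact: truncT_measurable.
- move=> t x p q lam lam01; rewrite /truncT; case: ifPn => tT.
    by apply: H3 => //=; rewrite in_itv.
  by rewrite !mulr0 addr0.
- by move=> t; rewrite /truncT; case: ifPn => // tT; apply: (cP t _).1; rewrite /= in_itv.
- exact: truncT_L1.
- move=> t x p q; rewrite /truncT; case: ifPn => tT.
    by apply: (cP t _).2; rewrite /= in_itv.
  by rewrite subrr normr0 !mul0r.
- by move=> r t; rewrite /truncT; case: ifPn => // tT; apply: ((kP r).2 t _).1; rewrite /= in_itv.
- by move=> r; apply: truncT_L1; exact: (kP r).1.
- move=> r t x y p xr yr; rewrite /truncT; case: ifPn => tT.
    by apply: ((kP r).2 t _).2; rewrite //= in_itv.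
  by rewrite subrr normr0 !mul0r.
- exact: truncT_L1.
Qed.

Theorem theorem4p10 (R : realType) (n : nat) (T : R) (hT : 0 < T)
  (H : R -> 'rV[R]_n -> 'rV[R]_n -> R)
  (mu : probability (BorelRV R (n + 1)) R) (hmu : sphere_measure mu)
  (* (H1) *)
  (H1 : forall x p, measurable_fun (`[0, T] : set (LebT R)) (fun t => H t x p))
  (* (H2) *)
  (H2 : forall t, `[0, T] t ->
          continuous (fun xp : 'rV[R]_n * 'rV[R]_n => H t xp.1 xp.2))
  (* (H3) *)
  (H3 : forall t, `[0, T] t -> forall x p q (lam : R), 0 <= lam <= 1 ->
          H t x (lam *: p + (1 - lam) *: q) <= lam * H t x p + (1 - lam) * H t x q)
  (* (H4), with c integrable *)
  (H4 : exists c : R -> R,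
          (@leb R).-integrable (`[0, T] : set (LebT R)) (fun t => (c t)%:E) /\
          forall t, `[0, T] t -> 0 <= c t /\
            forall x p q, `|H t x p - H t x q| <= c t * (1 + enorm x) * enorm (p - q))
  (* (HLC), with each k_R integrable *)
  (HLC : forall r : R, 0 < r -> exists k : R -> R,
          (@leb R).-integrable (`[0, T] : set (LebT R)) (fun t => (k t)%:E) /\
          forall t, `[0, T] t -> 0 <= k t /\
            forall x y p, enorm x <= r -> enorm y <= r ->
              `|H t x p - H t y p| <= k t * (1 + enorm p) * enorm (x - y))
  (* t |-> H(t,0,0) integrable *)
  (H0 : (@leb R).-integrable (`[0, T] : set (LebT R)) (fun t => (H t 0 0)%:E)) :
  forall g : 'rV[R]_n -> R,
    let V := fun z : R * 'rV[R]_n =>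
      value_fun T (steiner_f H mu) (steiner_l H mu) g z.1 z.2 in
    (continuous g ->
       {within `[0, T] `*` [set: 'rV[R]_n], continuous V}) /\
    (lower_semicontinuous (fun x => (g x)%:E) ->
       lsc_on (`[0, T] `*` [set: 'rV[R]_n]) V).
Proof.
move=> g V; have [c [k tame]] := tame_truncation H1 H3 H4 HLC H0.
have HE t : 0 <= t <= T -> (fun x p => truncT T (fun t => H t x p) t) = H t.
  by move=> tT; apply/funext => x; apply/funext => p; rewrite /truncT tT.
split=> [cg|glsc]; first exact: (value_continuous hmu tame HE cg).
exact: (value_lsc hmu tame HE glsc).
Qed.
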